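(* Let $z>0$ and consider the optimization problem $$\textbf{minimize } J(\psi)\quad\textbf{subject to }\ \psi\in L^+[0,1]\ \text{ and }\ \int_0^1\psi(s)\,ds=z. \qquad (P)$$ An optimal solution to (P) exists, and any optimal solution $\psi^*$ satisfies the following properties: there exist $0\le T_0<T_1\le1$ such that (i) $\psi^*(t)>0$ on the open interval $(T_0,T_1)$ and $\psi^*(t)=0$ for $t\in[0,1]\setminus[T_0,T_1]$; (ii) $\psi^*$ is concave on $[T_0,T_1]$; (iii) $\psi^*$ is continuous on $(T_0,T_1]$, with a possible jump at $t=T_0$.
   Context: $D[0,1]$ is the space of real-valued càdlàg functions on $[0,1]$ with the Skorohod $J_1$ topology; $L[0,1]\subset D[0,1]$ is the set of functions of finite variation; $L^+[0,1]$ is the set of non-negative elements of $L[0,1]$. Each $\phi\in L[0,1]$ has a Lebesgue decomposition $\phi(t)=\int_0^t\dot\phi^{(a)}(s)\,ds+\phi^{(s)}(t)$ into absolutely continuous and singular parts (so $\phi^{(s)}(0)=\phi(0)$; a value $\phi(0)\neq0$ counts as a jump at $0$), and $\phi^{(s)}=\phi^{\uparrow}-\phi^{\downarrow}$ is its Hahn decomposition into positive part $\phi^{\uparrow}$ and negative part $\phi^{\downarrow}$, both non-negative and non-decreasing. Standing assumptions. $\{X_n\}_{n\ge0}$ is a real-valued process; the scaled paths $x^n(t)=\frac1n\sum_{i=0}^{\lfloor nt\rfloor-1}X_i$ satisfy the large deviation principle in $D[0,1]$ with good rate function $$I_X(\gamma)=\int_0^1 I(\dot\gamma^{(a)}(s))\,ds+\theta^{\downarrow}\gamma^{\downarrow}(1)+\theta^{\uparrow}\gamma^{\uparrow}(1)\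 \text{ if }\gamma\in L[0,1],\qquad I_X(\gamma)=+\infty\ \text{ otherwise.}$$ Here, with $\Lambda_X(\theta)=\lim_n n^{-1}\log\mathsf{E}[\exp(\theta(X_0+\cdots+X_{n-1}))]$ (equal to $\log\mathsf{E}[e^{\theta X_0}]$ in the i.i.d. case), $I(y)=\sup_\theta(\theta y-\Lambda_X(\theta))$, $\theta^{\downarrow}=\sup\{\theta>0:\Lambda_X(-\theta)<\infty\}$, $\theta^{\uparrow}=\sup\{\theta>0:\Lambda_X(\theta)<\infty\}$, both in $(0,\infty]$. Moreover $I$ is a good, convex rate function and there exists $\delta>0$ with $I(-\delta)=0$. The objective function is $$J(\psi)=\int_0^1\left(I(\dot\psi^{(a)}(s))1_{\{\psi(s)>0\}}+\inf_{y\le0}I(y)\,1_{\{\psi(s)=0\}}\right)ds+\theta^{\downarrow}\psi^{\downarrow}(1)+\theta^{\uparrow}\psi^{\uparrow}(1),$$ with the convention $\infty\cdot0=0$ in the last two terms.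
   Formalization: Properties (i)–(iii) are claimed only for optimal solutions with 0 < J(ψ* ) < ∞; they can fail when the optimal value is +∞ (every feasible path is then optimal) or 0 (possible if I vanishes at positive slopes). Existence is unrestricted. *)

(* Defs.v *)
From HB Require Import structures.
From mathcomp Require Import all_boot all_order all_algebra.
From mathcomp Require Import all_classical all_reals all_analysis.
From mathcomp Require Import lra.

Set Implicit Arguments.
Unset Strict Implicit.
Unset Printing Implicit Defensive.

Import Order.TTheory GRing.Theory Num.Theory.
Import numFieldNormedType.Exports.

Local Open Scope classical_set_scope.
Local Open Scope ring_scope.

Definition cadlag {R : realType} (f : R -> R) : Prop :=
  (forall t : R, 0 <= t < 1 -> f x @[x --> t^'+] --> f t) /\
  (forall t : R, 0 < t <= 1 -> cvg (f x @[x --> t^'-])).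

(* The space D[0,1]. A path is stored as a function on the whole line that is
   0 off [0,1], so that equality in this type is equality on [0,1]. *)
Record skorohod (R : realType) := Skorohod {
  path :> R -> R ;
  path_cadlag : cadlag path ;
  path_out : forall t, ~ (0 <= t <= 1) -> path t = 0 }.

HB.instance Definition _ (R : realType) := gen_eqMixin (skorohod R).
HB.instance Definition _ (R : realType) := gen_choiceMixin (skorohod R).

Section J1.
Context {R : realType}.
Implicit Types (f g h : skorohod R) (l : R -> R).

Definition time_change l : Prop :=
  set_bij `[0, 1] `[0, 1] l /\
  (forall s t, 0 <= s <= 1 -> 0 <= t <= 1 -> s < t -> l s < l t).

(* Pointwise strict bounds are used in place of bounds on the suprema: the balls
   of radius e for the two versions differ, the topology does not. *)
Definition J1_ball f (e : R) g : Prop := exists l, time_change l /\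
  forall t, 0 <= t <= 1 -> `|l t - t| < e /\ `|f t - g (l t)| < e.

Lemma J1_ball_center f (e : R) : 0 < e -> J1_ball f e f.
Proof.
move=> e0; exists id; split.
  by split => //; split => [t //|s t _ _ //|t t01]; exists t.
by move=> t _; rewrite !subrr normr0.
Qed.

Lemma J1_ball_sym f g (e : R) : J1_ball f e g -> J1_ball g e f.
Proof.
move=> [l [[[lfun linj lsurj] lhomo] lfg]].
have /choice[k kP] : forall t, exists s,
    0 <= t <= 1 -> 0 <= s <= 1 /\ l s = t.
  move=> t; have [t01|] := boolP (0 <= t <= 1); last by exists 0.
  have /lsurj[s /= s01 <-] : `[0, 1]%classic t by rewrite /= in_itv.
  by exists s => _; split => //; move: s01; rewrite in_itv.
exists k; split; first split.
- split.
  + by move=> t /=; rewrite !in_itv/= => /kP[].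
  + move=> s t; rewrite !inE/= !in_itv/= => /kP[_ ks] /kP[_ kt] kst.
    by rewrite -ks -kt kst.
  + move=> s /= s01; have ls01 := lfun _ s01.
    exists (l s) => //; move: ls01; rewrite /= in_itv/= => /kP[kls01 lk].
    by apply: linj => //; rewrite inE/= ?in_itv.
- move=> s t /kP[ks01 lks] /kP[kt01 lkt] st.
  rewrite ltNge le_eqVlt; apply/negP => /orP[/eqP kst|kts].
    by move: st; rewrite -lks -lkt kst ltxx.
  by have := lhomo _ _ kt01 ks01 kts; rewrite lks lkt ltNge (ltW st).
- move=> t /kP[kt01 lkt]; have [] := lfg _ kt01.
  by rewrite lkt => ? ?; split; rewrite distrC.
Qed.

Lemma J1_ball_triangle f g h (e1 e2 : R) :
  J1_ball f e1 g -> J1_ball g e2 h -> J1_ball f (e1 + e2) h.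
Proof.
move=> [l [[lb lhomo] lfg]] [k [[kb khomo] kgh]].
have l01 t : 0 <= t <= 1 -> 0 <= l t <= 1.
  by have [+ _ _] := lb => /(_ t); rewrite /= !in_itv.
exists (k \o l); split; first split.
- by have := set_bij_comp lb kb.
- by move=> s t s01 t01 st; apply: khomo; [exact: l01..|exact: lhomo].
- move=> t t01; have [lt1 fgl] := lfg _ t01; have [kl ghk] := kgh _ (l01 _ t01).
  split => /=.
    rewrite [X in X < _](_ : _ = `|(l t - t) + (k (l t) - l t)|); last first.
      by congr (`| _ |); lra.
    by rewrite (le_lt_trans (ler_normD _ _))// ltrD.
  rewrite [X in X < _](_ : _ = `|(f t - g (l t)) + (g (l t) - h (k (l t)))|).
    by rewrite (le_lt_trans (ler_normD _ _))// ltrD.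
  by congr (`| _ |); lra.
Qed.

End J1.

HB.instance Definition _ (R : realType) :=
  hasNbhs.Build (skorohod R) (nbhs_ (entourage_ (@J1_ball R))).

HB.instance Definition _ (R : realType) :=
  @Nbhs_isPseudoMetric.Build R (skorohod R)
    (entourage_ (@J1_ball R)) erefl (@J1_ball R)
    J1_ball_center J1_ball_sym J1_ball_triangle erefl.

Section scaled_path.
Context {R : realType}.

Definition step_fun (n : nat) (u : nat -> R) (t : R) : R :=
  if 0 <= t <= 1 then u (Num.truncn (n%:R * t)) else 0.

Lemma step_fun_cadlag n u : cadlag (step_fun n u).
Proof.
have [->|n0] := eqVneq n 0%N.
  have E t : 0 <= t <= 1 -> step_fun 0 u t = u 0%N.
    by rewrite /step_fun => ->; rewrite mul0r truncn0.
  split=> t /andP[t0 t1].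
    rewrite E; last by lra.
    apply: cvg_near_cst; near=> s; apply: E; apply/andP; split.
      by apply: (le_trans t0); apply: ltW; near: s; exact: nbhs_right_gt.
    by near: s; exact: nbhs_right_le.
  apply: (cvgP (u 0%N)); apply: cvg_near_cst.
  near=> s; apply: E; apply/andP; split.
    by near: s; exact: nbhs_left_ge.
  by apply: le_trans t1; apply: ltW; near: s; exact: nbhs_left_lt.
have {}n0 : 0 < n%:R :> R by rewrite ltr0n lt0n.
split=> t /andP[t0 t1].
  apply: cvg_near_cst.
  have /andP[kl ku] : (Num.truncn (n%:R * t))%:R <= n%:R * t
      < (Num.truncn (n%:R * t)).+1%:R by rewrite truncn_itv// mulr_ge0// ltW.
  set k := Num.truncn (n%:R * t) in kl ku *.
  near=> s.
  have ts : t < s by near: s; exact: nbhs_right_gt.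
  have s1 : s <= 1 by near: s; exact: nbhs_right_le.
  have sk : s < k.+1%:R / n%:R.
    by near: s; apply: nbhs_right_lt; rewrite ltr_pdivlMr// mulrC.
  rewrite /step_fun (ltW t1) t0 s1 (ltW (le_lt_trans t0 ts))/=.
  congr u; rewrite -/k; apply: truncn_def; apply/andP; split.
    by apply: (le_trans kl); rewrite ler_pM2l// ltW.
  by rewrite mulrC -ltr_pdivlMr.
have [k /andP[kl ku]] : exists k : nat, k%:R < n%:R * t <= k.+1%:R.
  have /andP[] : (Num.truncn (n%:R * t))%:R <= n%:R * t
      < (Num.truncn (n%:R * t)).+1%:R by rewrite truncn_itv// mulr_ge0// ltW.
  rewrite le_eqVlt => /orP[/eqP e|kl] ku; last first.
    by exists (Num.truncn (n%:R * t)); rewrite kl ltW.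
  have : 0 < n%:R * t by rewrite mulr_gt0.
  rewrite -e; case: (Num.truncn _) => [|m _]; first by rewrite ltxx.
  by exists m; rewrite lexx ltr_nat ltnSn.
apply: (cvgP (u k)); apply: cvg_near_cst.
near=> s.
have st : s < t by near: s; exact: nbhs_left_lt.
have s0 : 0 <= s by near: s; exact: nbhs_left_ge.
have ks : k%:R / n%:R < s.
  by near: s; apply: nbhs_left_gt; rewrite ltr_pdivrMr// mulrC.
rewrite /step_fun s0 (le_trans (ltW st) t1)/=.
congr u; apply: truncn_def; apply/andP; split.
  by rewrite mulrC -ler_pdivrMr// ltW.
by apply: lt_le_trans ku; rewrite ltr_pM2l.
Unshelve. all: by end_near. Qed.

Lemma step_fun_out n u t : ~ (0 <= t <= 1) -> step_fun n u t = 0.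
Proof. by rewrite /step_fun; case: ifP. Qed.

Definition scaled_path (x : nat -> R) (n : nat) : skorohod R :=
  Skorohod
    (@step_fun_cadlag n (fun k => n%:R^-1 * \sum_(i < k) x i))
    (@step_fun_out n (fun k => n%:R^-1 * \sum_(i < k) x i)).

End scaled_path.

Section large_deviations.
Context {R : realType}.
Local Open Scope ereal_scope.

Definition good_rate_function (S : topologicalType) (I : S -> \bar R) : Prop :=
  [/\ forall x, 0 <= I x, lower_semicontinuous I
    & forall a : R, compact [set x | I x <= a%:E]].

Definition satisfies_ldp d (T : measurableType d) (P : probability T R)
    (S : topologicalType) (Y : nat -> T -> S) (I : S -> \bar R) : Prop :=
  (forall F : set S, closed F ->
     limn_esup (fun n : nat => n%:R^-1%:E * lne (P (Y n @^-1` F)))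
       <= - ereal_inf (I @` F)) /\
  (forall G : set S, open G ->
     - ereal_inf (I @` G)
       <= limn_einf (fun n : nat => n%:R^-1%:E * lne (P (Y n @^-1` G)))).

Definition convex_ereal (f : R -> \bar R) : Prop :=
  forall (x y t : R), (0 <= t <= 1)%R ->
    f (t * x + (1 - t) * y)%R <= t%:E * f x + (1 - t)%:E * f y.

Definition scaled_cgf d (T : measurableType d) (P : probability T R)
    (X : nat -> T -> R) (theta : R) (n : nat) : \bar R :=
  n%:R^-1%:E * lne 'E_P[fun w => expR (theta * \sum_(i < n) X i w)].

Definition rate (Lam : R -> \bar R) (y : R) : \bar R :=
  ereal_sup (range (fun theta : R => (theta * y)%:E - Lam theta)).

Definition theta_dn (Lam : R -> \bar R) : \bar R :=
  ereal_sup [set theta%:E | theta in [set theta : R |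
    (0 < theta)%R /\ Lam (- theta)%R < +oo]].

Definition theta_up (Lam : R -> \bar R) : \bar R :=
  ereal_sup [set theta%:E | theta in [set theta : R |
    (0 < theta)%R /\ Lam theta < +oo]].

End large_deviations.

Section decomposition.
Context {R : realType}.
Notation mu := (@lebesgue_measure R).

Definition finite_variation (f : skorohod R) : Prop :=
  bounded_variation 0 1 f.

Record components := Components {
  density : R -> R ;
  up_measure : {finite_measure set (measurableTypeR R) -> \bar R} ;
  dn_measure : {finite_measure set (measurableTypeR R) -> \bar R} }.

(* f(t) = int_0^t a + p[0,t] - q[0,t] where p - q is the Hahn decomposition of
   the part of df that is singular to Lebesgue measure; the masses p{0}, q{0}
   account for f(0). *)
Definition decomposes (f : skorohod R) (c : components) : Prop :=
  [/\ mu.-integrable `[0, 1] (EFin \o density c),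
      forall t : R, 0 <= t <= 1 ->
        f t = \int[mu]_(s in `[0, t]) density c s
              + fine (up_measure c `[0, t]%classic) - fine (dn_measure c `[0, t]%classic)
    & exists A B : set (measurableTypeR R),
      [/\ measurable A /\ measurable B,
          A `|` B `<=` `[0, 1] /\ A `&` B = set0,
          mu (A `|` B) = 0%E
        & up_measure c (~` A) = 0%E /\ dn_measure c (~` B) = 0%E]].

(* The components of a path of finite variation, unique up to a Lebesgue-null
   modification of the density; a dummy value for other paths. *)
Definition decomposition (f : skorohod R) : components :=
  if pselect (exists c, decomposes f c) is left h then projT1 (cid h)
  else Components (fun=> 0) mzero mzero.

Definition dot_ac (f : skorohod R) : R -> R := density (decomposition f).

Definition up_part (f : skorohod R) (t : R) : R :=
  fine (up_measure (decomposition f) `[0, t]%classic).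

Definition dn_part (f : skorohod R) (t : R) : R :=
  fine (dn_measure (decomposition f) `[0, t]%classic).

End decomposition.

Section problem.
Context {R : realType}.
Notation mu := (@lebesgue_measure R).
Local Open Scope ereal_scope.

(* +oo * 0 = 0 in \bar R *)
Definition path_rate (Lam : R -> \bar R) (f : skorohod R) : \bar R :=
  if `[< finite_variation f >] then
    \int[mu]_(s in `[0%R, 1%R]) rate Lam (dot_ac f s)
    + theta_dn Lam * (dn_part f 1)%:E + theta_up Lam * (up_part f 1)%:E
  else +oo.

Definition objective (Lam : R -> \bar R) (psi : skorohod R) : \bar R :=
  \int[mu]_(s in `[0%R, 1%R])
    (rate Lam (dot_ac psi s) * (\1_[set t | (0 < psi t)%R] s)%:E
     + ereal_inf (rate Lam @` [set y : R | (y <= 0)%R])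
       * (\1_[set t | psi t = 0%R] s)%:E)
  + theta_dn Lam * (dn_part psi 1)%:E + theta_up Lam * (up_part psi 1)%:E.

Definition feasible (z : R) (psi : skorohod R) : Prop :=
  [/\ finite_variation psi, forall t, (0 <= t <= 1)%R -> (0 <= psi t)%R
    & \int[mu]_(s in `[0%R, 1%R]) (psi s)%:E = z%:E].

Definition optimal (Lam : R -> \bar R) (z : R) (psi : skorohod R) : Prop :=
  feasible z psi /\
  forall phi, feasible z phi -> objective Lam psi <= objective Lam phi.

End problem.

Definition concave_on {R : realType} (D : set R) (f : R -> R) : Prop :=
  convex_function (E := R^o) D (fun t => - f t).

(* Main.v *)
Require Import Defs.
From HB Require Import structures.
From mathcomp Require Import all_boot all_order all_algebra.
From mathcomp Require Import all_classical all_reals all_analysis.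
From mathcomp Require Import measurable_realfun lra ring.

Set Implicit Arguments.
Unset Strict Implicit.
Unset Printing Implicit Defensive.

Import Order.TTheory GRing.Theory Num.Theory.
Import numFieldNormedType.Exports.

Local Open Scope classical_set_scope.
Local Open Scope ring_scope.

(** Idling is free: the rate vanishes at a negative slope [- delta], hence so
    does its infimum over nonpositive slopes, and the objective charges a
    feasible path [psi] only for its slope on [E = {psi > 0}] and for the
    singular parts [p] and [q] of its derivative.

    Concave competitor. Let [b] be the slope of [psi] on [E] and [- delta] off
    [E], let [b*] be its decreasing rearrangement, and let [c] be the total mass
    of [p]. The concave path [x |-> c + int_0^x b*] costs as much as [psi], less
    what [psi] pays for [q] ([excursion_cost]). Read [psi] on the clock [u t],
    the time spent in [E] up to [t]; then
      [psi t <= c + int_0^(u t) b* - p ]t, 1]]   ([excursion_le_path]).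
    Indeed a nonnegative path gains nothing while it sits at zero, so [psi t] is
    at most its own mass on [E] up to [t] ([path_le_positive_mass]), and the
    absolutely continuous part of this mass is at most the integral of [b*] over
    an interval of the same length ([hardy_littlewood]). Integrating over [E],
    the concave path has at least area [z] above the axis
    ([excursion_area_ge]).

    Back to feasible paths. If a concave path of cost [C] has at least area [z]
    above the axis, then for some [l] in [[0, 1]] its combination with the line
    [t |-> - delta t], with weights [l] and [1 - l], has exactly area [z]. By
    convexity, and because the line is free, following the combination until it
    hits zero and idling from then on is a feasible path of cost at most [l C]
    ([feasible_of_concave]).

    Existence. The concave competitors of a minimizing sequence have bounded
    rate, so they have a cluster point in the Skorohod topology. Its rate is at
    most the infimum by lower semicontinuity, and its area above the axis is at
    least [z] ([J1_pos_area]). Rearranging its density gives a concave path,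
    which is turned into an optimal feasible path ([optimal_exists]).

    Structure. Let [psi] be optimal of positive finite cost. A downward singular
    mass, or a factor [l < 1], would yield a cheaper feasible path; hence
    [q = 0] and the concave competitor has exactly area [z] ([optimal_tight]).
    The comparison is then an equality: [psi t = c + int_0^(u t) b*] and
    [p ]t, 1] = 0] for every [t < 1] in [E] ([optimal_path]). So [psi] is
    continuous from any such [t] on. Between two times of [E] the concave
    competitor stays away from zero, and a continuous [psi] cannot drop to zero
    there without taking small positive values
    ([optimal_positive_between]). Therefore [E] is an interval up to its
    endpoints [T0 < T1], the clock is [t - T0] on it, and [psi] is a translate
    of the concave competitor. *)

(** * The zero set of a nonnegative function carries no positive net mass *)

Section bounded_cvg.
Context d (T : measurableType d) (R : realType).
Variables (m : {finite_measure set T -> \bar R}) (D : set T) (mD : measurable D).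

Lemma bounded_integrable (f : T -> R) (M : R) : measurable_fun D f ->
  (forall x, D x -> `|f x| <= M) -> m.-integrable D (EFin \o f).
Proof.
move=> mf fM; apply: measurable_bounded_integrable => //.
- by rewrite ltey_eq fin_num_measure.
- exists M; split; first exact: num_real.
  by move=> y My x Dx; apply: le_trans (fM x Dx) (ltW My).
Qed.

Lemma bounded_Rintegral_cvg (f_ : nat -> T -> R) (f : T -> R) (M : R) :
  (forall n, measurable_fun D (f_ n)) -> measurable_fun D f ->
  (forall n x, D x -> `|f_ n x| <= M) ->
  (forall x, D x -> f_ n x @[n --> \oo] --> f x) ->
  (\int[m]_(x in D) f_ n x) @[n --> \oo] --> \int[m]_(x in D) f x.
Proof.
move=> mf_ mf fM cf.
have [intf _ cv] : [/\ m.-integrable D (EFin \o f),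
    [sequence (\int[m]_(x in D) `|(f_ n x)%:E - (f x)%:E|)%E]_n @ \oo --> 0%E &
    [sequence (\int[m]_(x in D) (f_ n x)%:E)%E]_n @ \oo --> (\int[m]_(x in D) (f x)%:E)%E].
  apply: (@dominated_convergence _ _ _ m D mD (fun n => EFin \o f_ n) (EFin \o f)
    (cst M%:E)).
  - by move=> n; exact/measurable_EFinP.
  - exact/measurable_EFinP.
  - apply: aeW => x Dx; apply: cvg_EFin; first exact: nearW.
    exact: cf.
  - exact: finite_measure_integrable_cst.
  - by apply: aeW => x n Dx; rewrite lee_fin fM.
apply: fine_cvg; rewrite /= fineK; first exact: cv.
exact: integrable_fin_num.
Qed.

End bounded_cvg.

(** A path that starts from zero and stays nonnegative gains nothing while it is
    at zero. Formally, with [dF = m1 - m2] and [wt k x = exp (- k x)],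
      [int wt k (F) d(m1 - m2) <= (wt k (F a) - wt k (F t)) / k <= 1 / k],
    because [wt k] is the derivative of the concave function
    [(1 - wt k) / k]; letting [k] grow, [wt k (F)] tends to the indicator of
    [{F = 0}]. As [F] jumps, the chain rule is replaced by sums over a grid. *)
Section zero_set.
Context {R : realType}.
Variables (m1 m2 : {finite_measure set (measurableTypeR R) -> \bar R}).
Variables (F : R -> R) (a t : R).
Hypotheses (at_ : a < t)
  (mF : measurable_fun setT F)
  (F_ge0 : forall x, a <= x <= t -> 0 <= F x) (Fa : F a = 0)
  (F_rc : forall x, a < x < t -> F y @[y --> x^'+] --> F x)
  (dF : forall x y, a <= x -> x <= y -> y <= t ->
     fine (m1 `]x, y]%classic) - fine (m2 `]x, y]%classic) = F y - F x).

Let step n := (t - a) / n.+1%:R.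
(* The point of the grid t - k (t - a) / (n + 1) that is next to s on the right:
   anchoring the grid at t makes r n t = t, and right continuity of F is used
   only before t. *)
Let r n s := t - (Num.truncn ((t - s) / step n))%:R * step n.

Let step_gt0 n : 0 < step n.
Proof. by rewrite divr_gt0// subr_gt0. Qed.

Let step_total n : n.+1%:R * step n = t - a.
Proof. by rewrite /step mulrC divfK// pnatr_eq0. Qed.

Let r_itv n s : s <= t -> s <= r n s < s + step n.
Proof.
move=> st; have := truncn_itv (divr_ge0 (_ : 0 <= t - s) (ltW (step_gt0 n))).
rewrite subr_ge0 => /(_ st) /andP[+ +]; rewrite ler_pdivlMr// ltr_pdivrMr//.
rewrite /r; set k := Num.truncn _; rewrite -natr1 mulrDl mul1r => h1 h2.
by apply/andP; split; lra.
Qed.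

Let r_le n s : r n s <= t.
Proof. by rewrite /r lerBlDr lerDl mulr_ge0// ltW. Qed.

Let r_cell n k s : t - k.+1%:R * step n < s -> s <= t - k%:R * step n ->
  r n s = t - k%:R * step n.
Proof.
move=> h1 h2; congr (_ - _%:R * _); apply: truncn_def.
rewrite ler_pdivlMr// ltr_pdivrMr//; apply/andP; split; lra.
Qed.

Let r_cvg s : s <= t -> r n s @[n --> \oo] --> s.
Proof.
move=> st; apply: (@squeeze_cvgr _ _ _ _ (cst s) (fun n => s + step n)).
- by near=> n; have /andP[-> /ltW ->] := r_itv n st.
- exact: cvg_cst.
- rewrite -[X in _ --> X]addr0; apply: cvgD; first exact: cvg_cst.
  rewrite -(mulr0 (t - a)); apply: cvgM; first exact: cvg_cst.
  exact: cvg_harmonic.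
Unshelve. all: by end_near. Qed.

Let D := `]a, t]%classic.
Let mD : measurable D. Proof. exact: measurable_itv. Qed.

Let mr n : measurable_fun setT (r n).
Proof.
apply: nondecreasing_measurable => // x y xy.
rewrite lerD2l lerN2 ler_pM2r// ler_nat le_truncn// ler_pM2r ?invr_gt0//.
by rewrite lerD2l lerN2.
Qed.

Let wt (k x : R) := expR (- (k * x)).

Let continuous_wt k : continuous (wt k).
Proof.
move=> x; apply: continuous_comp; last exact: continuous_expR.
by apply: cvgN; apply: cvgM; [exact: cvg_cst|exact: cvg_id].
Qed.

Let m_wt k (g : R -> R) : measurable_fun setT g ->
  measurable_fun setT (fun s => wt k (g s)).
Proof.
move=> mg; apply: (@measurableT_comp _ _ _ _ _ _ (wt k)) => //.
by apply: continuous_measurable_fun; exact: continuous_wt.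
Qed.

Let wt_bound k x : 0 <= k -> 0 <= x -> `|wt k x| <= 1.
Proof.
move=> k0 x0; rewrite ger0_norm ?expR_ge0// -expR0 ler_expR oppr_le0.
exact: mulr_ge0.
Qed.

Let wt_concave k x y : 0 < k ->
  wt k y * (y - x) <= (wt k x - wt k y) / k.
Proof.
move=> k0; rewrite ler_pdivlMr//.
have -> : wt k x = wt k y * expR (k * (y - x)).
  by rewrite -expRD; congr expR; lra.
have -> : wt k y * expR (k * (y - x)) - wt k y =
  wt k y * (expR (k * (y - x)) - 1) by lra.
rewrite -mulrA ler_pM2l ?expR_gt0//.
have := expR_ge1Dx (k * (y - x)); lra.
Qed.

Let F0 s : D s -> 0 <= F s.
Proof. by rewrite /D /= in_itv/= => /andP[/ltW ? ?]; apply: F_ge0; apply/andP. Qed.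

Let r_D n s : D s -> D (r n s).
Proof.
rewrite /D /= !in_itv/= => /andP[as_ st].
by rewrite r_le (lt_le_trans as_)//; have /andP[] := r_itv n st.
Qed.

(* On the cell ]x, y] the integrand is wt k (F y) and m1 - m2 has mass
   F y - F x, so concavity bounds each cell by a term of a telescoping sum. *)
Let int_cells k n j : 0 < k -> (j <= n.+1)%N ->
  \int[m1]_(s in `]t - j%:R * step n, t]) wt k (F (r n s)) -
  \int[m2]_(s in `]t - j%:R * step n, t]) wt k (F (r n s))
  <= (wt k (F (t - j%:R * step n)) - wt k (F t)) / k.
Proof.
move=> k0; elim: j => [|j ih] jn.
  by rewrite mul0r subr0 set_itvoc0 !Rintegral_set0 !subrr mul0r.
have la : a <= t - j.+1%:R * step n.
  have : j.+1%:R * step n <= n.+1%:R * step n by rewrite ler_pM2r// ler_nat.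
  by rewrite step_total; lra.
have l1 : t - j.+1%:R * step n <= t - j%:R * step n.
  by rewrite lerD2l lerN2 ler_pM2r// ler_nat.
have l2 : t - j%:R * step n <= t by rewrite lerBlDr lerDl mulr_ge0// ltW.
set y := t - j%:R * step n in ih l1 l2 *; set x := t - j.+1%:R * step n in la l1 *.
have split_int (m : {finite_measure set (measurableTypeR R) -> \bar R}) :
    \int[m]_(s in `]x, t]) wt k (F (r n s)) =
    wt k (F y) * fine (m `]x, y]%classic) + \int[m]_(s in `]y, t]) wt k (F (r n s)).
  have -> : `]x, t]%classic = `]x, y]%classic `|` `]y, t]%classic.
    by rewrite -itv_bndbnd_setU// bnd_simp.
  rewrite Rintegral_setU//=; first congr (_ + _).
  - rewrite -Rintegral_cst//; apply: eq_Rintegral => s.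
    by rewrite inE/= in_itv/= => /andP[xs sy]; rewrite (@r_cell _ j).
  - rewrite -itv_bndbnd_setU// ?bnd_simp//.
    apply: (@bounded_integrable _ _ _ _ _ _ _ 1).
    - exact: measurable_itv.
    - by apply: measurable_funTS; apply: m_wt; exact: measurableT_comp.
    - move=> s; rewrite /= in_itv/= => /andP[xs st]; apply: wt_bound; first exact: ltW.
      by apply/F0/r_D; rewrite /D/= in_itv/= st (le_lt_trans la).
  - apply/disj_setPS => s/=; rewrite !in_itv/= => -[/andP[_ sy] /andP[ys _]].
    by have := lt_le_trans ys sy; rewrite ltxx.
rewrite !split_int.
have := ih (ltnW jn); have := wt_concave (F x) (F y) k0.
rewrite -(dF la l1 l2) !mulrDl !mulNr mulrBr; lra.
Qed.

Let int_wtF k : 0 < k ->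
  \int[m1]_(s in D) wt k (F s) - \int[m2]_(s in D) wt k (F s) <= k^-1.
Proof.
move=> k0.
have cv (m : {finite_measure set (measurableTypeR R) -> \bar R}) :
    \int[m]_(s in D) wt k (F (r n s)) @[n --> \oo] --> \int[m]_(s in D) wt k (F s).
  apply: (@bounded_Rintegral_cvg _ _ _ m D mD _ _ 1).
  - by move=> n; apply: measurable_funTS; apply: m_wt; exact: measurableT_comp.
  - by apply: measurable_funTS; exact: m_wt.
  - by move=> n s Ds; apply: wt_bound; [exact: ltW|exact/F0/r_D].
  - move=> s Ds.
    have Fr : F (r n s) @[n --> \oo] --> F s.
      move: Ds; rewrite /D/= in_itv/= => /andP[as_]; rewrite le_eqVlt => /predU1P[->|st].
        apply: cvg_near_cst; apply: nearW => n; congr F.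
        by rewrite /r subrr mul0r truncn0 mul0r subr0.
      apply/cvgrPdist_le => e e0.
      have /F_rc/cvgrPdist_le/(_ e e0) : a < s < t by rewrite as_ st.
      rewrite near_withinE => -[d /= d0 dP].
      have /cvgrPdist_lt/(_ d d0) := r_cvg (ltW st).
      apply: filterS => n rd.
      have /andP[] := r_itv n (ltW st); rewrite le_eqVlt => /predU1P[<- _|sr _].
        by rewrite subrr normr0 ltW.
      exact: dP.
    exact: (cvg_comp _ _ Fr (@continuous_wt _ _)).
have rn n : t - n.+1%:R * step n = a.
  by rewrite step_total; lra.
apply: (cvgr_to_le (cvgB (cv m1) (cv m2))); apply: nearW => n /=.
have := int_cells k0 (leqnn n.+1); rewrite rn Fa -/D => /le_trans; apply.
rewrite ler_pdivrMr// mulVf ?gt_eqF// /wt mulr0 oppr0 expR0.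
by rewrite lerBlDr lerDl expR_ge0.
Qed.

Let wt_cvg (x : R) : 0 <= x -> wt k.+1%:R x @[k --> \oo] --> (\1_[set 0] x : R).
Proof.
rewrite le_eqVlt => /predU1P[<-|x0].
  rewrite indicE mem_set//=; apply: cvg_near_cst; apply: nearW => k.
  by rewrite /wt mulr0 oppr0 expR0.
rewrite indicE memNset; last by move/eqP; rewrite gt_eqF.
rewrite [X in _ --> X](_ : _ = 0)//.
apply: (@squeeze_cvgr _ _ _ _ (cst 0) (fun k => x^-1 * harmonic k)).
- apply: nearW => k; rewrite expR_ge0/= /wt expRN -invfM lef_pV2 ?posrE ?expR_gt0 ?mulr_gt0//.
  by rewrite mulrC (le_trans _ (expR_ge1Dx _))// lerDr.
- exact: cvg_cst.
- rewrite -(mulr0 x^-1); apply: cvgM; first exact: cvg_cst.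
  exact: cvg_harmonic.
Qed.

Lemma zero_set_le :
  fine (m1 (D `&` F @^-1` [set 0])) <= fine (m2 (D `&` F @^-1` [set 0])).
Proof.
have mZ : measurable (F @^-1` [set 0]).
  by rewrite -[X in measurable X]setTI; exact: mF.
have cv (m : {finite_measure set (measurableTypeR R) -> \bar R}) :
    \int[m]_(s in D) wt k.+1%:R (F s) @[k --> \oo] -->
    fine (m (D `&` F @^-1` [set 0])).
  have -> : fine (m (D `&` F @^-1` [set 0])) =
      \int[m]_(s in D) (\1_(F @^-1` [set 0]) s : R).
    by rewrite /Rintegral integral_indic// setIC.
  apply: (@bounded_Rintegral_cvg _ _ _ m D mD _ _ 1).
  - by move=> n; apply: measurable_funTS; exact: m_wt.
  - exact: measurable_indic.
  - by move=> n s Ds; apply: wt_bound => //; exact: F0.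
  - move=> s Ds; exact: wt_cvg (F0 Ds).
rewrite -subr_le0.
apply: (ler_cvg_to (cvgB (cv m1) (cv m2)) (@cvg_harmonic R)).
by apply: nearW => k; exact: int_wtF.
Qed.

End zero_set.

(** * Lebesgue and Hahn decompositions of a difference of measures *)

Section lebesgue_hahn.
Context {R : realType}.
Notation mu := (@lebesgue_measure R).
Notation fmeasure := {finite_measure set (measurableTypeR R) -> \bar R}.

(** A Lebesgue-null set of maximal [m]-mass absorbs the singular part of [m]: a
    null set disjoint from it cannot have positive mass. *)
Lemma maximal_null_set (m : fmeasure) : exists N : set (measurableTypeR R),
  [/\ measurable N, mu N = 0%E &
    forall S, measurable S -> mu S = 0%E -> S `&` N = set0 -> m S = 0%E].
Proof.
pose V := [set m N | N in [set N | measurable N /\ mu N = 0%E]].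
have Vfin : ereal_sup V \is a fin_num.
  rewrite ge0_fin_numE.
    apply: (@le_lt_trans _ _ (m setT)); last by rewrite ltey_eq fin_num_measure.
    apply: ge_ereal_sup => _ [N [mN _] <-]; by apply: le_measure; rewrite ?inE//; exact: measurableT.
  by apply: ereal_sup_ubound; exists set0; rewrite ?measure0.
have /choice[N_ N_P] : forall k : nat, exists N,
    [/\ measurable N, mu N = 0%E & (ereal_sup V - (k.+1%:R^-1)%:E < m N)%E].
  move=> k; have k0 : (0 : R) < k.+1%:R^-1 by rewrite invr_gt0.
  by have [_ [N [mN N0] <-] lN] := ub_ereal_sup_adherent k0 Vfin; exists N.
have mN k : measurable (N_ k) by have [] := N_P k.
have mUN : measurable (\bigcup_k N_ k) by exact: bigcup_measurable.
have UN0 : mu (\bigcup_k N_ k) = 0%E.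
  apply/negligibleP => //; apply: negligible_bigcup => k.
  by apply/negligibleP => //; have [] := N_P k.
exists (\bigcup_k N_ k); split => // S mS S0 SN.
have mSU : measurable (S `|` \bigcup_k N_ k) by exact: measurableU.
have SU0 : mu (S `|` \bigcup_k N_ k) = 0%E.
  by apply/negligibleP => //; apply: negligibleU; exact/negligibleP.
have supN : ereal_sup V = m (\bigcup_k N_ k).
  apply/eqP; rewrite eq_le; apply/andP; split; last first.
    by apply: ereal_sup_ubound; exists (\bigcup_k N_ k).
  apply/lee_addgt0Pr => e e0.
  have [k ke] : exists k : nat, k.+1%:R^-1 < e.
    exists (Num.truncn e^-1); rewrite invf_plt ?posrE//.
    by rewrite truncnS_gt.
  have [_ _ /ltW] := N_P k; rewrite leeBlDr// => /le_trans; apply.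
  apply: leeD; last by rewrite lee_fin ltW.
  by apply: le_measure; rewrite ?inE//; exact: bigcup_sup.
have : (m (S `|` \bigcup_k N_ k) <= m (\bigcup_k N_ k))%E.
  by rewrite -supN; apply: ereal_sup_ubound; exists (S `|` \bigcup_k N_ k).
rewrite measureU// -[leRHS]add0e leeD2rE ?fin_num_measure// => mS0.
by apply/eqP; rewrite eq_le mS0 measure_ge0.
Qed.

(** Off the union [N] of maximal null sets for [m1] and [m2] both measures are
    absolutely continuous, and Radon-Nikodym gives the density. On [N] the
    difference is a charge carried by a null set, and its Hahn decomposition
    gives [p] and [q]. *)
Lemma lebesgue_hahn (m1 m2 : fmeasure) :
  exists (a : R -> R) (p q : fmeasure) (A B : set (measurableTypeR R)),
  [/\ mu.-integrable setT (EFin \o a),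
     forall S, measurable S ->
       fine (m1 S) - fine (m2 S) = \int[mu]_(s in S) a s + fine (p S) - fine (q S),
     [/\ measurable A, measurable B, A `&` B = set0 & mu (A `|` B) = 0%E]
   & p (~` A) = 0%E /\ q (~` B) = 0%E].
Proof.
have [N1 [mN1 N10 N1P]] := maximal_null_set m1.
have [N2 [mN2 N20 N2P]] := maximal_null_set m2.
pose N := N1 `|` N2.
have mN : measurable N by exact: measurableU.
have mCN : measurable (~` N) by exact: measurableC.
have N0 : mu N = 0%E.
  by apply/negligibleP => //; apply: negligibleU; exact/negligibleP.
have fin (m : fmeasure) S : measurable S -> (m S < +oo)%E.
  by move=> mS; rewrite ltey_eq fin_num_measure.
pose a1 : fmeasure := mfrestr mCN (fin m1 _ mCN).
pose a2 : fmeasure := mfrestr mCN (fin m2 _ mCN).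
pose s1 : fmeasure := mfrestr mN (fin m1 _ mN).
pose s2 : fmeasure := mfrestr mN (fin m2 _ mN).
have a1mu : a1 `<< mu.
  apply/null_content_dominatesP => S mS S0; rewrite /a1 /= /mfrestr /mrestr.
  apply: N1P; first exact: measurableI.
    apply/eqP; rewrite eq_le measure_ge0 andbT -S0.
    by apply: le_measure; rewrite ?inE//; exact: measurableI.
  by rewrite /N setCU; apply/seteqP; split=> x //= [[_ [? _]]].
have a2mu : a2 `<< mu.
  apply/null_content_dominatesP => S mS S0; rewrite /a2 /= /mfrestr /mrestr.
  apply: N2P; first exact: measurableI.
    apply/eqP; rewrite eq_le measure_ge0 andbT -S0.
    by apply: le_measure; rewrite ?inE//; exact: measurableI.
  by rewrite /N setCU; apply/seteqP; split=> x //= [[_ [_ ?]]].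
have [f1 [_ f1fin f1int f1P]] := radon_nikodym_sigma_finite a1mu.
have [f2 [_ f2fin f2int f2P]] := radon_nikodym_sigma_finite a2mu.
pose sg : {charge set (measurableTypeR R) -> \bar R} :=
  cadd (charge_of_finite_measure s1) (copp (charge_of_finite_measure s2)).
have [P [Q PQ]] := Hahn_decomposition sg.
have [[mP _] [mQ _] PQT PQ0] := PQ.
have fE f : (forall x, f x \is a fin_num) -> EFin \o (fine \o f) = f.
  by move=> ff; apply/funext => x /=; rewrite fineK.
exists (fun x => fine (f1 x) - fine (f2 x)), (jordan_pos PQ), (jordan_neg PQ),
  (P `&` N), (Q `&` N); split.
- rewrite (_ : _ \o _ = (f1 \- f2)%E); first exact: integrableB.
  by apply/funext => x /=; rewrite EFinB !fineK.
- move=> S mS.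
  have split_m (m : fmeasure) : m S = (m (S `&` ~` N) + m (S `&` N))%E.
    rewrite -measureU; first by rewrite -setIUr setUC setUv setIT.
    + exact: measurableI.
    + exact: measurableI.
    + by rewrite setIACA setICl setI0.
  have fin_ (m : fmeasure) U : measurable U -> m U \is a fin_num.
    exact: fin_num_measure.
  have mSN : measurable (S `&` N) by exact: measurableI.
  have mSCN : measurable (S `&` ~` N) by exact: measurableI.
  have := jordan_decomp PQ mS; rewrite /cadd /= cscaleN1 /=.
  rewrite /sg /= /cadd /copp /= /charge_of_finite_measure /= => sgE.
  have {}sgE : fine (m1 (S `&` N)) - fine (m2 (S `&` N)) =
      fine (jordan_pos PQ S) - fine (jordan_neg PQ S).
    rewrite -[LHS]fineB ?fin_num_measure// -[RHS]fineB ?fin_num_measure//.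
    by congr fine; exact: sgE.
  rewrite (split_m m1) (split_m m2) !fineD ?fin_num_measure//.
  have -> : m1 (S `&` ~` N) = (\int[mu]_(x in S) f1 x)%E by rewrite -f1P.
  have -> : m2 (S `&` ~` N) = (\int[mu]_(x in S) f2 x)%E by rewrite -f2P.
  rewrite RintegralB//; last 2 first.
    by rewrite fE//; exact: integrableS f1int.
    by rewrite fE//; exact: integrableS f2int.
  rewrite /Rintegral.
  under eq_integral do rewrite fineK//.
  under [X in _ - fine X + _ - _]eq_integral do rewrite fineK//.
  by move: sgE; lra.
- split.
  + exact: measurableI.
  + exact: measurableI.
  + by rewrite setIACA PQ0 set0I.
  + by rewrite -setIUl PQT setTI.
- have mC U : measurable U -> measurable (~` (U `&` N)).
    by move=> mU; apply/measurableC/measurableI.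
  have set0E U : ~` (U `&` N) `&` U `&` N = set0.
    by rewrite -setIA setICl.
  have sgE U : sg U = (m1 (U `&` N) - m2 (U `&` N))%E by [].
  split.
  + change (crestr0 sg mP (~` (P `&` N)) = 0%E).
    by rewrite /crestr0 mem_set /crestr ?sgE ?set0E ?measure0 ?sube0//; exact: mC.
  + rewrite -[LHS]/(cscale (-1) (crestr0 sg mQ) (~` (Q `&` N))) cscaleN1 /=.
    rewrite /crestr0 mem_set /crestr ?sgE ?set0E ?measure0 ?sube0 ?oppe0//.
    exact: mC.
Qed.

End lebesgue_hahn.

(** * Every path of finite variation has components *)

Section stieltjes.
Context {R : realType}.
Notation mu := (@lebesgue_measure R).
Notation fmeasure := {finite_measure set (measurableTypeR R) -> \bar R}.

Lemma stieltjes_measure_itv (G : cumulative R R) (x y : R) : x <= y ->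
  lebesgue_stieltjes_measure G `]x, y]%classic = (G y - G x)%:E.
Proof.
move=> xy; rewrite /lebesgue_stieltjes_measure /measure_extension/=.
by rewrite measurable_mu_extE/= ?wlength_itv_bnd//; exact: is_ocitv.
Qed.

(** The value [g 0] is turned into an atom at the origin by extending [g] by [0]
    on the negative half-line. *)
Lemma monotone_measure (g : R -> R) :
  0 <= g 0 -> {in `[0, 1] &, nondecreasing_fun g} ->
  (forall t : R, 0 <= t < 1 -> g x @[x --> t^'+] --> g t) ->
  exists m : fmeasure, m (~` `[0, 1]) = 0%E /\
    forall t : R, 0 <= t <= 1 -> m `[0, t]%classic = (g t)%:E.
Proof.
move=> g0 gnd grc.
pose G (t : R) := if t < 0 then 0 else g (Num.min t 1).
have min01 (t : R) : 0 <= t -> Num.min t 1 \in `[0, 1].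
  by move=> t0; rewrite in_itv/= le_min t0 ler01/= ge_min lexx orbT.
have gge0 (t : R) : t \in `[0, 1] -> 0 <= g t.
  move=> t01; apply: (le_trans g0); apply: gnd => //; first by rewrite in_itv/= lexx ler01.
  by move: t01; rewrite in_itv => /andP[].
have Gnd : nondecreasing G.
  move=> x y xy; rewrite /G; case: ltP => x0.
    by case: ltP => // y0; apply/gge0/min01.
  rewrite ltNge (le_trans x0 xy)/=; apply: gnd; [exact: min01|exact/min01/(le_trans x0 xy)|].
  by rewrite le_min !ge_min xy lexx !orbT.
have Grc : right_continuous G.
  move=> t; have [t0|t0] := ltP t 0.
    apply: cvg_near_cst; near=> s; rewrite /G t0.
    by have -> : s < 0 by near: s; exact: nbhs_right_lt.
  have [t1|t1] := ltP t 1.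
    have -> : G t = g t by rewrite /G ltNge t0/= min_l ?ltW.
    apply: cvg_trans (grc t _); last by rewrite t0.
    apply: near_eq_cvg; near=> s.
    have ts : t < s by near: s; exact: nbhs_right_gt.
    rewrite /G ltNge (le_trans t0 (ltW ts))/= min_l//.
    by near: s; exact: nbhs_right_le.
  apply: cvg_near_cst; near=> s.
  have ts : t < s by near: s; exact: nbhs_right_gt.
  by rewrite /G !ltNge t0 (le_trans t0 (ltW ts))/= !min_r// (le_trans t1)// ltW.
pose C : cumulative R R := HB.pack G (isCumulative.Build R _ R G Gnd Grc).
pose LS := lebesgue_stieltjes_measure C.
have LSE (x y : R) : x <= y -> LS `]x, y]%classic = (G y - G x)%:E.
  exact: stieltjes_measure_itv.
(* G is constant before 0, so the intervals ]-1, - 1/(k + 1)] have no mass. *)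
have LS0 : LS `](-1), 0[%classic = 0%E.
  rewrite itv_bnd_open_bigcup; apply/negligibleP; first exact: bigcup_measurable.
  apply: negligible_bigcup => k; apply/negligibleP => //.
  have [k1|k1] := leP (-1) (0 - k.+1%:R^-1 : R).
    by rewrite -[LHS]/(LS _) LSE// /G !oppr_lt0 ltr01 sub0r oppr_lt0 invr_gt0 ltr0n subrr.
  by rewrite set_itv_ge ?measure0// bnd_simp -leNgt ltW.
have LSt (t : R) : 0 <= t -> LS `[0, t]%classic = (G t)%:E.
  move=> t0; have := @LSE (-1) t; rewrite {2}/G oppr_lt0 ltr01 subr0.
  have -> : `](-1), t]%classic = `](-1), 0[%classic `|` `[0, t]%classic.
    by rewrite -itv_bndbnd_setU// bnd_simp// ?oppr_lt0.
  have -> : LS (`](-1), 0[%classic `|` `[0, t]%classic) =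
      adde (LS `](-1), 0[%classic) (LS `[0, t]%classic).
    apply: measureU => //; apply/seteqP; split => x //=.
    by rewrite !in_itv/= => -[/andP[_ x0] /andP[]]; rewrite leNgt x0.
  by rewrite LS0 -[adde _ _]/(_ + _)%E add0e => ->//; rewrite (le_trans _ t0)// lerN10.
have m01 : measurable (`[0, 1]%classic : set (measurableTypeR R)) by exact: measurable_itv.
have LSoo : (LS `[0%R, 1%R]%classic < +oo)%E by rewrite LSt// ltry.
exists (mfrestr m01 LSoo); split.
  by rewrite /= /mfrestr /mrestr setICl measure0.
move=> t /andP[t0 t1]; rewrite /= /mfrestr /mrestr.
rewrite (_ : _ `&` _ = `[0, t]%classic); last first.
  apply/setIidl => x/=; rewrite !in_itv/= => /andP[-> xt]/=; exact: le_trans xt t1.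
rewrite -[LHS]/(LS `[0, t]%classic) LSt// /G ltNge t0/= min_l//.
Unshelve. all: by end_near. Qed.

(** Jordan: [f] is the difference of the negative variations of [- f] and of [f],
    both of which are distribution functions of measures. *)
Lemma decomposes_exists (f : skorohod R) : finite_variation f ->
  exists c, decomposes f c.
Proof.
move=> fBV; have [frc _] := path_cadlag f.
have fNBV : bounded_variation 0 1 (\- f) by exact: bounded_variationN.
have rcN (t : R) : 0 <= t < 1 -> (\- f) x @[x --> t^'+] --> (\- f) t.
  by move=> t01; apply: cvgN; exact: frc.
(* The constant |u 0| makes h u nonnegative at 0; it contributes the same to
   both measures and cancels. *)
pose h (u : R -> R) (t : R) := fine (neg_tv 0 u t) + `|u 0|.
have hP u : bounded_variation 0 1 u ->
   (forall t : R, 0 <= t < 1 -> u x @[x --> t^'+] --> u t) ->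
   exists m : fmeasure, m (~` `[0, 1]) = 0%E /\
    forall t : R, 0 <= t <= 1 -> m `[0, t]%classic = (h u t)%:E.
  move=> uBV urc; apply: monotone_measure.
  - rewrite /h /neg_tv total_variationxx sub0e -EFinN -EFinM /=.
    have := ler_norm (u 0); have := normr_ge0 (u 0); lra.
  - move=> x y x01 y01 xy; rewrite lerD2r.
    exact: (fine_neg_tv_nondecreasing uBV).
  - move=> t /andP[t0 t1]; apply: cvgD; last exact: cvg_cst.
    by apply: (neg_tv_right_continuous _ t1) => //; apply: urc; rewrite t0.
have [m1 [m10 m1E]] := hP _ fNBV rcN.
have [m2 [m20 m2E]] := hP _ fBV frc.
have [a [p [q [A [B [aint dE [mA mB AB0 AB] [pA qB]]]]]]] := lebesgue_hahn m1 m2.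
have m01 : measurable (`[0, 1]%classic : set (measurableTypeR R)) by exact: measurable_itv.
exists (Components a p q); split => /=.
- exact: integrableS aint.
- move=> t t01.
  have mt : measurable (`[0, t]%classic : set (measurableTypeR R)) by exact: measurable_itv.
  rewrite -(dE _ mt).
  rewrite m1E// m2E//= (bounded_variation_pos_neg_tvE fBV)/=; last by rewrite in_itv.
  rewrite /h /pos_tv /= normrN; lra.
have mAB : measurable (A `|` B) by exact: measurableU.
have mC : measurable (~` `[0, 1]%classic : set (measurableTypeR R)) by exact: measurableC.
(* The Hahn sets may stick out of the unit interval, where the charge vanishes;
   trimming them loses no mass. *)
have out0 S : measurable S -> S `<=` A `|` B -> S `&` `[0, 1] = set0 ->
    fine (p S) - fine (q S) = 0.
  move=> mS SAB S01.
  have S0 : mu S = 0%E := subset_measure0 mS mAB SAB AB.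
  have SC : S `<=` ~` `[0, 1] by move=> x Sx x01; rewrite -[False]/(set0 x) -S01.
  have := dE S mS; rewrite (subset_measure0 mS mC SC m10) (subset_measure0 mS mC SC m20).
  rewrite /Rintegral null_set_integral//; first by move=> /=; lra.
  by apply: measurable_funTS; exact: measurable_int aint.
exists (A `&` `[0, 1]), (B `&` `[0, 1]); split.
- by split; exact: measurableI.
- split; first by rewrite -setIUl; exact: subIsetr.
  by rewrite setIACA AB0 set0I.
- apply: (subset_measure0 _ mAB _ AB); first by apply: measurableU; exact: measurableI.
  by rewrite -setIUl; exact: subIsetl.
have mCA : measurable (~` A) by exact: measurableC.
have mCB : measurable (~` B) by exact: measurableC.
have mAo : measurable (A `\` `[0, 1]) by exact: measurableD.
have mBo : measurable (B `\` `[0, 1]) by exact: measurableD.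
have fine0 (m : fmeasure) S : measurable S -> fine (m S) = 0 -> m S = 0%E.
  by move=> mS m0; rewrite -(fineK (fin_num_measure m S mS)) m0.
split.
- rewrite setCI; apply/negligibleP; first exact: measurableU.
  apply: (@negligibleS _ _ _ _ (~` A `|` A `\` `[0, 1])).
    by move=> x [?|?]; [left|have [|] := pselect (A x); [right|left]].
  apply: negligibleU; apply/negligibleP => //; apply: fine0 => //.
  have := out0 _ mAo; rewrite (subset_measure0 mAo mCB _ qB) /= ?subr0; first apply.
  + by move=> x [Ax _]; left.
  + by apply/seteqP; split => x // -[[_ ?]].
  + by move=> x [Ax _] Bx; rewrite -[False]/(set0 x) -AB0.
- rewrite setCI; apply/negligibleP; first exact: measurableU.
  apply: (@negligibleS _ _ _ _ (~` B `|` B `\` `[0, 1])).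
    by move=> x [?|?]; [left|have [|] := pselect (B x); [right|left]].
  apply: negligibleU; apply/negligibleP => //; apply: fine0 => //.
  have := out0 _ mBo; rewrite (subset_measure0 mBo mCA _ pA) /=; last first.
    by move=> x [Bx _] Ax; rewrite -[False]/(set0 x) -AB0.
  rewrite sub0r => /(_ _ _)/eqP; rewrite oppr_eq0 => H; apply/eqP/H.
  + by move=> x [Bx _]; right.
  + by apply/seteqP; split => x // -[[_ ?]].
Qed.

Lemma decompositionP (f : skorohod R) : finite_variation f ->
  decomposes f (decomposition f).
Proof.
move=> /decomposes_exists fd; rewrite /decomposition; case: pselect => // h.
exact: projT2 (cid h).
Qed.

End stieltjes.

(** * Uniqueness of the components *)

Section charge_ext.
Context {R : realType}.

Lemma charge_ext (n1 n2 : {charge set (measurableTypeR R) -> \bar R}) :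
  n1 setT = n2 setT ->
  (forall t : R, n1 `]t, +oo[%classic = n2 `]t, +oo[%classic) ->
  forall S, measurable S -> n1 S = n2 S.
Proof.
move=> nT nray S mS.
apply: (@dynkin_induction _ (measurableTypeR R) (@RGenOInfty.G R)
  (fun S => n1 S = n2 S)) => //.
- exact: RGenOInfty.measurableE.
- move=> _ _ [x ->] [y ->]; exists (Num.max x y).
  by apply/seteqP; split => z /=; rewrite !in_itv/= !andbT gt_max => /andP.
- by move=> _ [t ->].
- move=> U mU nU; rewrite -setTD !chargeD//.
  by rewrite nT setTI nU.
- move=> F mF tF nF.
  have mUF : measurable (\bigcup_k F k) by exact: bigcup_measurable.
  have c1 := @charge_semi_sigma_additive _ _ _ n1 F mF tF mUF.
  have c2 := @charge_semi_sigma_additive _ _ _ n2 F mF tF mUF.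
  have e : (fun n => \sum_(0 <= i < n) n1 (F i))%E =
      (fun n => \sum_(0 <= i < n) n2 (F i))%E.
    by apply/funext => n; apply: eq_bigr => i _; exact: nF.
  by rewrite e in c1; exact: (cvg_unique _ c1 c2).
- by have := mS; rewrite [X in X S -> _]RGenOInfty.measurableE.
Qed.

End charge_ext.

Section uniqueness.
Context {R : realType}.
Notation mu := (@lebesgue_measure R).
Implicit Type c : components (R := R).

(** The charge [df], as it is read off the components. *)
Definition signed_mass c (S : set R) : R :=
  \int[mu]_(s in S `&` `[0, 1]) density c s
    + fine (up_measure c S) - fine (dn_measure c S).

(** Packs the components into one charge, for which uniqueness, restriction to
    the unit interval and Hahn decompositions are available. *)
Lemma decomposes_charge (f : skorohod R) c : decomposes f c ->
  exists nu : {charge set (measurableTypeR R) -> \bar R},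
  [/\ forall S, measurable S -> nu S = (signed_mass c S)%:E,
     forall S, measurable S -> nu S = nu (S `&` `[0, 1])
   & forall t : R, 0 <= t <= 1 -> nu `[0, t]%classic = (f t)%:E].
Proof.
pose I01 := `[0, 1]%classic : set (measurableTypeR R).
have m01 : measurable I01 by exact: measurable_itv.
move=> [aint fE [A [B [[mA mB] [AB01 AB0] AB [pA qB]]]]].
have aint' : mu.-integrable setT ((EFin \o density c) \_ I01) by apply/(integrable_mkcond _ m01).
pose nu : {charge set (measurableTypeR R) -> \bar R} :=
  cadd (induced_charge aint') (cadd (charge_of_finite_measure (up_measure c))
    (copp (charge_of_finite_measure (dn_measure c)))).
have nuE S : measurable S -> nu S = (signed_mass c S)%:E.
  move=> mS.
  have -> : nu S = adde (\int[mu]_(t in S) ((EFin \o density c) \_ I01) t)%E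
    (adde (up_measure c S) (oppe (dn_measure c S))) by [].
  have -> : (\int[mu]_(t in S) ((EFin \o density c) \_ I01) t)%E =
      (\int[mu]_(s in S `&` I01) density c s)%:E.
    rewrite -integral_mkcondr /Rintegral fineK//.
    apply: integrable_fin_num; first exact: measurableI.
    by apply: integrableS aint => //; exact: measurableI.
  rewrite -[up_measure c S]fineK; last exact: fin_num_measure.
  rewrite -[dn_measure c S]fineK; last exact: fin_num_measure.
  by rewrite /signed_mass -addrA.
have out0 (m : {measure set (measurableTypeR R) -> \bar R}) C S : measurable S ->
   measurable C -> m (~` C) = 0%E -> C `<=` I01 -> S `&` I01 = set0 -> m S = 0%E.
  move=> mS mC mC0 C01 S0; apply/eqP; rewrite eq_le measure_ge0 andbT -mC0.
  apply: le_measure; rewrite ?inE//; first exact: measurableC.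
  by move=> x Sx Cx; rewrite -[False]/(set0 x) -S0; split => //; exact: C01.
have A01 : A `<=` I01 by move=> x Ax; apply: AB01; left.
have B01 : B `<=` I01 by move=> x Bx; apply: AB01; right.
have nu_out S : measurable S -> S `&` I01 = set0 -> nu S = 0%E.
  move=> mS S0; rewrite nuE// /signed_mass -/I01 S0 Rintegral_set0.
  by rewrite (out0 _ A)// (out0 _ B)//= addr0 subr0.
have nu_f (t : R) : 0 <= t <= 1 -> nu `[0, t]%classic = (f t)%:E.
  move=> t01; rewrite nuE; last exact: measurable_itv.
  rewrite /signed_mass fE//; congr (_ + _ - _)%:E; congr (Rintegral _ _ _).
  apply/setIidl => x/=; rewrite !in_itv/= => /andP[-> xt]/=.
  by apply: le_trans xt _; case/andP: t01.
have nuI S : measurable S -> nu S = nu (S `&` I01).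
  move=> mS; have mSI : measurable (S `\` I01) by exact: measurableD.
  rewrite (chargeDI nu mS m01) (nu_out _ mSI) ?add0e//.
  by apply/seteqP; split => x // -[[]].
by exists nu; split.
Qed.

(** Rays generate the Borel sets and the mass of a ray is a value of [f]. *)
Lemma signed_mass_uniq (f : skorohod R) c c' : decomposes f c -> decomposes f c' ->
  forall S : set (measurableTypeR R), measurable S -> signed_mass c S = signed_mass c' S.
Proof.
move=> /decomposes_charge[nu [nuE nuI nu_f]] /decomposes_charge[nu' [nuE' nuI' nu_f']] S mS.
apply: EFin_inj; rewrite -nuE// -nuE'//; apply: charge_ext => //.
  by rewrite nuI// nuI'// setTI nu_f ?nu_f' ?ler01 ?lexx.
have ray (m : {charge set (measurableTypeR R) -> \bar R}) (t : R) :
    m `]t, +oo[%classic = (m setT - m `]-oo, t]%classic)%E.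
  have mt : measurable (`]-oo, t]%classic : set (measurableTypeR R)) by exact: measurable_itv.
  by rewrite -setCitvl -setTD chargeD// setTI.
move=> t; rewrite !ray; congr (_ - _)%E.
  by rewrite nuI// nuI'// setTI nu_f ?nu_f' ?ler01 ?lexx.
have mt : measurable (`]-oo, t]%classic : set (measurableTypeR R)) by exact: measurable_itv.
rewrite nuI// nuI'//; have [t0|t0] := ltP t 0.
  rewrite (_ : _ `&` _ = set0) ?charge0//.
  apply/seteqP; split => x //=; rewrite !in_itv/= => -[xt /andP[x0 _]].
  by have := le_lt_trans xt t0; rewrite ltNge x0.
rewrite (_ : _ `&` _ = `[0, Num.min t 1]%classic).
  by rewrite nu_f ?nu_f'// le_min t0 ler01 ge_min lexx orbT.
apply/seteqP; split => x /=; rewrite !in_itv/= le_min.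
  by move=> [-> /andP[-> ->]].
by move=> /and3P[-> -> ->].
Qed.

Lemma signed_massE c (S : set (measurableTypeR R)) :
  mu.-integrable `[0, 1] (EFin \o density c) -> measurable S -> mu S = 0%E ->
  signed_mass c S = fine (up_measure c S) - fine (dn_measure c S).
Proof.
move=> aint mS S0; rewrite /signed_mass /Rintegral null_set_integral ?add0r//.
- by apply: measurableI => //; exact: measurable_itv.
- apply: measurable_funS (measurable_int _ aint) => //; exact: measurable_itv.
- apply/eqP; rewrite eq_le measure_ge0 andbT -S0.
  apply: le_measure; rewrite ?inE//; apply: measurableI => //; exact: measurable_itv.
Qed.

(** On the carrier [A] of the positive singular part of [c] the charge reduces to
    that part, whereas for [c'] it may in addition see a negative part. *)
Lemma decomposes_mass_le (f : skorohod R) c c' :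
  decomposes f c -> decomposes f c' ->
  (up_measure c `[0%R, 1%R]%classic <= up_measure c' `[0%R, 1%R]%classic)%E /\
  (dn_measure c `[0%R, 1%R]%classic <= dn_measure c' `[0%R, 1%R]%classic)%E.
Proof.
move=> fc fc'; have massE := signed_mass_uniq fc fc'.
have [aint' _ _] := fc'.
have [aint _ [A [B [[mA mB] [AB01 AB0] AB [pA qB]]]]] := fc.
pose I01 := `[0, 1]%classic : set (measurableTypeR R).
have m01 : measurable I01 by exact: measurable_itv.
have mAB : measurable (A `|` B) by exact: measurableU.
have A0 : mu A = 0%E by apply: subset_measure0 mAB _ AB => // x; left.
have B0 : mu B = 0%E by apply: subset_measure0 mAB _ AB => // x; right.
have A01 : A `<=` I01 by move=> x Ax; apply: AB01; left.
have B01 : B `<=` I01 by move=> x Bx; apply: AB01; right.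
have conc (m : {finite_measure set (measurableTypeR R) -> \bar R}) C : measurable C ->
    C `<=` I01 -> m (~` C) = 0%E -> m I01 = m C.
  move=> mC C01 mC0; rewrite -(setDUK C01) measureU//; last 2 first.
    exact: measurableD.
    by rewrite setDIK.
  have mC' : measurable (~` C) by exact: measurableC.
  have mD : measurable (I01 `\` C) by exact: measurableD.
  rewrite -[RHS]adde0; congr (_ + _)%E.
  by apply: (subset_measure0 mD mC' _ mC0) => x [].
have fin (m : {finite_measure set (measurableTypeR R) -> \bar R}) S :
  measurable S -> m S \is a fin_num by exact: fin_num_measure.
split.
- rewrite -/I01 (conc _ A)//.
  have mCB : measurable (~` B) by exact: measurableC.
  have qA : dn_measure c A = 0%E.
    by apply: (subset_measure0 mA mCB _ qB) => x Ax Bx; rewrite -[False]/(set0 x) -AB0.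
  have := massE _ mA; rewrite !signed_massE// qA subr0 => pE.
  apply: (@le_trans _ _ (up_measure c' A)); last by apply: le_measure; rewrite ?inE.
  rewrite -(fineK (fin (up_measure c) _ mA)) -(fineK (fin (up_measure c') _ mA)) lee_fin.
  by have : 0 <= fine (dn_measure c' A) := fine_ge0 (measure_ge0 _ _); lra.
- rewrite -/I01 (conc _ B)//.
  have mCA : measurable (~` A) by exact: measurableC.
  have pB : up_measure c B = 0%E.
    by apply: (subset_measure0 mB mCA _ pA) => x Bx Ax; rewrite -[False]/(set0 x) -AB0.
  have := massE _ mB; rewrite !signed_massE// pB sub0r => qE.
  apply: (@le_trans _ _ (dn_measure c' B)); last by apply: le_measure; rewrite ?inE.
  rewrite -(fineK (fin (dn_measure c) _ mB)) -(fineK (fin (dn_measure c') _ mB)) lee_fin.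
  by have : 0 <= fine (up_measure c' B) := fine_ge0 (measure_ge0 _ _); lra.
Qed.

Lemma decomposes_mass_uniq (f : skorohod R) c c' :
  decomposes f c -> decomposes f c' ->
  up_measure c `[0, 1]%classic = up_measure c' `[0, 1]%classic /\
  dn_measure c `[0, 1]%classic = dn_measure c' `[0, 1]%classic.
Proof.
move=> fc fc'; have [u1 d1] := decomposes_mass_le fc fc'.
have [u2 d2] := decomposes_mass_le fc' fc.
by split; apply/eqP; rewrite eq_le ?u1 ?u2 ?d1 ?d2.
Qed.

Lemma decomposes_density_uniq (f : skorohod R) c c' :
  decomposes f c -> decomposes f c' ->
  ae_eq mu `[0, 1]%classic (EFin \o density c) (EFin \o density c').
Proof.
move=> fc fc'; have massE := signed_mass_uniq fc fc'.
have [aint' _ [A' [B' [[mA' mB'] _ AB' [pA' qB']]]]] := fc'.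
have [aint _ [A [B [[mA mB] _ AB [pA qB]]]]] := fc.
pose I01 := `[0, 1]%classic : set (measurableTypeR R).
have m01 : measurable I01 by exact: measurable_itv.
pose N := (A `|` B) `|` (A' `|` B').
have mAB : measurable (A `|` B) by exact: measurableU.
have mAB' : measurable (A' `|` B') by exact: measurableU.
have mN : measurable N by exact: measurableU.
have N0 : mu N = 0%E.
  by apply/negligibleP => //; apply: negligibleU; exact/negligibleP.
apply: integral_ae_eq => //; first exact: measurable_int aint'.
move=> S S01 mS.
have mSN : measurable (S `\` N) by exact: measurableD.
have SN01 : S `\` N `<=` I01 by move=> x [Sx _]; exact: S01.
have iS a : mu.-integrable `[0, 1] a -> mu.-integrable S a by exact: integrableS.
have iSN a : mu.-integrable `[0, 1] a -> mu.-integrable (S `\` N) a by exact: integrableS.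
rewrite (negligible_integral mN mS (iS _ aint) N0).
rewrite (negligible_integral mN mS (iS _ aint') N0).
have mC (U : set (measurableTypeR R)) : measurable U -> measurable (~` U) by exact: measurableC.
have := massE _ mSN; rewrite /signed_mass.
rewrite (subset_measure0 mSN (mC _ mA) _ pA); last by move=> x [_ Nx] ?; apply: Nx; left; left.
rewrite (subset_measure0 mSN (mC _ mB) _ qB); last by move=> x [_ Nx] ?; apply: Nx; left; right.
rewrite (subset_measure0 mSN (mC _ mA') _ pA'); last by move=> x [_ Nx] ?; apply: Nx; right; left.
rewrite (subset_measure0 mSN (mC _ mB') _ qB'); last by move=> x [_ Nx] ?; apply: Nx; right; right.
rewrite !addr0 !subr0 (setIidl SN01) /Rintegral => e.
rewrite -[LHS]fineK; last by apply: integrable_fin_num => //; exact: iSN.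
rewrite -[RHS]fineK; last by apply: integrable_fin_num => //; exact: iSN.
by congr (_%:E).
Qed.

End uniqueness.

(** * Decreasing rearrangement on the unit interval *)

Section equimeasurable.
Context {R : realType}.
Notation mu := (@lebesgue_measure R).
Notation RR := (measurableTypeR R).

Lemma integral_image_measure (D : set RR) (f : RR -> RR) (mD : measurable D)
    (mf : measurable_fun setT f) (h : RR -> \bar R) :
  measurable_fun setT h -> (forall x, 0 <= h x)%E ->
  (\int[pushforward (mrestr mu mD) f]_x h x = \int[mu]_(x in D) h (f x))%E.
Proof.
move=> mh h0; rewrite ge0_integral_pushforward//= preimage_setT.
have mhf : measurable_fun setT (h \o f) by exact: measurableT_comp.
rewrite (@ge0_negligible_integral _ _ _ (mrestr mu mD) setT (~` D))//.
- rewrite setTD setCK; apply: eq_measure_integral => A mA AD.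
  by rewrite /= /mrestr setIidl.
- exact: measurableC.
- by rewrite /= /mrestr setICl measure0.
Qed.

(** The two functions push Lebesgue measure to measures that agree on rays. *)
Lemma equimeasurable_integral (D1 D2 : set RR) (f1 f2 : RR -> RR) :
  measurable D1 -> measurable D2 ->
  measurable_fun D1 f1 -> measurable_fun D2 f2 ->
  (mu D1 < +oo)%E ->
  (forall y : R, mu (D1 `&` [set x | y < f1 x]) = mu (D2 `&` [set x | y < f2 x])) ->
  forall h : RR -> \bar R, measurable_fun setT h -> (forall x, 0 <= h x)%E ->
  (\int[mu]_(x in D1) h (f1 x) = \int[mu]_(x in D2) h (f2 x))%E.
Proof.
move=> mD1 mD2 mf1 mf2 D1oo ray h mh h0.
have mg D (f : RR -> RR) : measurable D -> measurable_fun D f ->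
    measurable_fun setT (f \_ D : RR -> RR).
  by move=> mD mf; apply/(measurable_restrictT _ mD).
have toD D (f : RR -> RR) : measurable D ->
    (\int[mu]_(x in D) h (f x) = \int[mu]_(x in D) h ((f \_ D) x))%E.
  by move=> mD; apply: eq_integral => x xD; rewrite patchE xD.
rewrite (toD _ f1)// (toD _ f2)//.
rewrite -(integral_image_measure mD1 (mg _ _ mD1 mf1) mh h0).
rewrite -(integral_image_measure mD2 (mg _ _ mD2 mf2) mh h0).
have pre D (f : RR -> RR) S : (f \_ D) @^-1` S `&` D = D `&` f @^-1` S.
  apply/seteqP; split => x /=; first by move=> [+ Dx]; rewrite patchE mem_set.
  by move=> [Dx Sx]; rewrite patchE mem_set.
pose image (D : set RR) (f : RR -> RR) (mD : measurable D) (mf : measurable_fun D f) :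
    {measure set RR -> \bar R} :=
  measure_function_pushforward__canonical__measure_function_Measure
    (mrestr mu mD) (mg _ _ mD mf).
suff imageE A : measurable A -> image _ _ mD1 mf1 A = image _ _ mD2 mf2 A.
  by apply: (@eq_measure_integral _ _ _ _ (image _ _ mD2 mf2) (image _ _ mD1 mf1)) => A mA _; exact: imageE.
move: A; apply: (@measure_unique _ R RR (@RGenOInfty.G R)
  (fun k => `](- k%:R), +oo[%classic : set RR)
  _ _ _ _ (image _ _ mD1 mf1) (image _ _ mD2 mf2)).
- exact: RGenOInfty.measurableE.
- move=> _ _ [x ->] [y ->]; exists (Num.max x y).
  by apply/seteqP; split => z /=; rewrite !in_itv/= !andbT gt_max => /andP.
- by move=> k; eexists.
- apply/seteqP; split => // x _; exists (Num.truncn `|x|).+1 => //=.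
  rewrite in_itv/= andbT ltrNl (le_lt_trans (ler_norm _))// normrN.
  by rewrite truncnS_gt.
- move=> _ [y ->]; rewrite /= /pushforward /mrestr !pre.
  have := ray y; congr (mu _ = mu _).
  + by apply/seteqP; split => x /=; rewrite in_itv/= andbT.
  + by apply/seteqP; split => x /=; rewrite in_itv/= andbT.
- move=> k; rewrite /= /pushforward /mrestr pre (le_lt_trans _ D1oo)//.
  apply: le_measure; rewrite ?inE//.
  by apply: mf1 => //; exact: measurable_itv.
Qed.

End equimeasurable.

Section rearrangement.
Context {R : realType}.
Notation mu := (@lebesgue_measure R).
Notation I01 := (`[0%R, 1%R]%classic : set (measurableTypeR R)).
Variable b : R -> R.
Hypothesis bint : mu.-integrable I01 (EFin \o b).

Let m01 : measurable I01. Proof. exact: measurable_itv. Qed.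

Let mu01 : mu I01 = 1%E.
Proof. by rewrite lebesgue_measure_itv/= lte_fin ltr01 oppr0 adde0. Qed.

Let mb : measurable_fun I01 b.
Proof. by apply/measurable_EFinP; exact: measurable_int bint. Qed.

Let super y : set (measurableTypeR R) := I01 `&` [set x | y < b x].

Let m_super y : measurable (super y).
Proof.
have := mb m01 (measurable_itv `]y, +oo[); congr (measurable (_ `&` _)).
by apply/seteqP; split => x /=; rewrite in_itv/= andbT.
Qed.

Let mu_fin (S : set (measurableTypeR R)) : measurable S -> S `<=` I01 ->
  mu S \is a fin_num.
Proof.
move=> mS S01; rewrite ge0_fin_numE ?measure_ge0//.
by apply: (@le_lt_trans _ _ (mu I01)); [apply: le_measure; rewrite ?inE|rewrite mu01 ltry].
Qed.

(** Distribution function of [b]; the rearrangement is its generalized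
    inverse. *)
Definition tail y : R := fine (mu (I01 `&` [set x | y < b x])).

Let tailE y : (tail y)%:E = mu (super y).
Proof. by rewrite /tail fineK//; apply: mu_fin (m_super y) _; exact: subIsetl. Qed.

Let super_lty y : (mu (super y) < +oo)%E.
Proof. by rewrite -tailE ltry. Qed.

Lemma tail_nonincreasing (y y' : R) : y <= y' -> tail y' <= tail y.
Proof.
move=> yy'; rewrite -lee_fin !tailE; apply: le_measure; rewrite ?inE//.
by move=> x [x01 /= h]; split => //=; exact: le_lt_trans h.
Qed.

Lemma tail_small (s : R) : 0 < s -> exists y, tail y <= s.
Proof.
move=> s0.
have cv : tail n%:R @[n --> \oo] --> (0 : R).
  have capE : \bigcap_n super n%:R = set0.
    apply/seteqP; split => // x /(_ (Num.truncn `|b x|).+1 Logic.I)[_ /=].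
    rewrite ltNge => /negP; apply; apply: le_trans (ler_norm _) _.
    by rewrite ltW// truncnS_gt.
  have := @nonincreasing_cvg_mu _ _ _ mu (fun n => super n%:R) _ (fun n => m_super n%:R).
  rewrite capE measure0 => cv; apply: fine_cvg; apply: cv => //.
  - exact: super_lty.
  - move=> m n mn; apply/subsetPset => x [x01 /= h]; split => //=.
    by apply: le_lt_trans h; rewrite ler_nat.
have /cvgrPdist_lt/(_ s s0)[N _ /(_ N (leqnn N))] := cv.
rewrite /= sub0r normrN => h; exists N%:R; apply: ltW; apply: le_lt_trans h.
exact: ler_norm.
Qed.

Lemma tail_large (s : R) : s < 1 -> exists y, s < tail y.
Proof.
move=> s1.
have cv : tail (- n%:R) @[n --> \oo] --> (1 : R).
  have cupE : \bigcup_n super (- n%:R) = I01.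
    apply/seteqP; split => [x [n _ []]//|x x01].
    exists (Num.truncn `|b x|).+1 => //; split => //=.
    by rewrite ltrNl (le_lt_trans (ler_norm _))// normrN truncnS_gt.
  have := @nondecreasing_cvg_mu _ _ _ mu (fun n => super (- n%:R)) (fun n => m_super (- n%:R)).
  rewrite cupE -[X in _ --> X]/(mu I01) mu01 => cv; apply: fine_cvg; apply: cv => //.
  move=> m n mn; apply/subsetPset => x [x01 /= h]; split => //=.
  by apply: le_lt_trans h; rewrite lerN2 ler_nat.
have s10 : 0 < 1 - s by rewrite subr_gt0.
have /cvgrPdist_lt/(_ _ s10)[N _ /(_ N (leqnn N))] := cv.
move=> /= /ltr_normlP[_ h]; exists (- N%:R); move: h; lra.
Qed.

Lemma tail_right_continuous y s : (forall z, y < z -> tail z <= s) -> tail y <= s.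
Proof.
move=> H.
have cv : tail (y + n.+1%:R^-1) @[n --> \oo] --> tail y.
  have cupE : \bigcup_n super (y + n.+1%:R^-1) = super y.
    apply/seteqP; split => [x [n _ [x01 /= h]]|x [x01 /= h]].
      by split => //=; apply: lt_trans h; rewrite ltrDl.
    exists (Num.truncn (b x - y)^-1) => //; split => //=.
    rewrite -ltrBrDl invf_plt ?posrE ?subr_gt0//.
    exact: truncnS_gt.
  have := @nondecreasing_cvg_mu _ _ _ mu (fun n => super (y + n.+1%:R^-1))
    (fun n => m_super (y + n.+1%:R^-1)).
  rewrite cupE -[X in _ --> X]/(mu (super y)) -tailE => cv; apply: fine_cvg; apply: cv => //.
  move=> m n mn; apply/subsetPset => x [x01 /= h]; split => //=.
  by apply: le_lt_trans h; rewrite lerD2l lef_pV2 ?posrE ?ltr0n// ler_nat.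
by apply: (cvgr_to_le cv); apply: nearW => n; apply: H; rewrite ltrDl.
Qed.

Definition rearr (s : R) : R := inf [set y | tail y <= s].

(** The Galois connection from which measurability, monotonicity and
    equimeasurability follow. The endpoints are excluded because there the
    infimum may run over an empty or an unbounded set. *)
Lemma rearr_gt (s y : R) : 0 < s < 1 -> (y < rearr s) = (s < tail y).
Proof.
move=> /andP[s0 s1]; rewrite [RHS]ltNge; apply/idP/negP.
  move=> + ty; apply/negP; rewrite -leNgt; apply: ge_inf => //.
  have [l ls] := tail_large s1; exists l => z /= zs.
  rewrite leNgt; apply/negP => zl; move: (tail_nonincreasing (ltW zl)).
  by rewrite leNgt (le_lt_trans zs ls).
move=> nty; rewrite ltNge; apply/negP => ry; apply: nty.
apply: tail_right_continuous => z yz.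
have hinf : has_inf [set y | tail y <= s].
  split; first by have [w] := tail_small s0; exists w.
  have [l ls] := tail_large s1; exists l => w /= zs.
  rewrite leNgt; apply/negP => zl; move: (tail_nonincreasing (ltW zl)).
  by rewrite leNgt (le_lt_trans zs ls).
have [w /= ws wz] := inf_lt hinf.1 (le_lt_trans ry yz).
exact: le_trans (tail_nonincreasing (ltW wz)) ws.
Qed.

Lemma rearr_nonincreasing (s s' : R) : 0 < s -> s <= s' -> s' < 1 -> rearr s' <= rearr s.
Proof.
move=> s0 ss' s1; rewrite leNgt; apply/negP.
rewrite rearr_gt ?s1 ?(lt_le_trans s0)// => h.
have : rearr s < rearr s by rewrite rearr_gt ?s0 ?(le_lt_trans ss')// (le_lt_trans ss').
by rewrite ltxx.
Qed.

Let D := (`]0%R, 1%R[%classic : set (measurableTypeR R)).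
Let mD : measurable D. Proof. exact: measurable_itv. Qed.

Let tail01 y : 0 <= tail y <= 1.
Proof.
rewrite -!lee_fin tailE measure_ge0/= -mu01.
by apply: le_measure; rewrite ?inE//; exact: subIsetl.
Qed.

Let rearr_preimage y : D `&` [set x | y < rearr x] = `]0, tail y[%classic.
Proof.
apply/seteqP; split => x /=; rewrite /D/= !in_itv/=.
  by move=> [x01]; rewrite rearr_gt// => ->; case/andP: x01 => ->.
move=> /andP[x0 xt]; have x01 : 0 < x < 1.
  by rewrite x0/= (lt_le_trans xt)//; case/andP: (tail01 y).
by split => //; rewrite rearr_gt.
Qed.

Let m_rearr_D : measurable_fun D rearr.
Proof.
apply: (measurability (@RGenOInfty.G R)) => [|/= _ [_ [r ->] <-]].
  exact: RGenOInfty.measurableE.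
rewrite (_ : _ `&` _ = D `&` [set x | r < rearr x]).
  by rewrite rearr_preimage; exact: measurable_itv.
by apply/seteqP; split => x /=; rewrite in_itv/= andbT.
Qed.

Lemma measurable_rearr : measurable_fun I01 rearr.
Proof. exact: measurable_fun_itv_cc m_rearr_D. Qed.

Lemma rearr_integral (h : R -> \bar R) : measurable_fun setT h ->
  (forall x, 0 <= h x)%E ->
  (\int[mu]_(x in I01) h (rearr x) = \int[mu]_(x in I01) h (b x))%E.
Proof.
move=> mh h0; rewrite -(@equimeasurable_integral R D I01 rearr b)//.
- rewrite integral_itv_bndoo//.
  by apply: measurableT_comp => //; exact: m_rearr_D.
- by rewrite lebesgue_measure_itv/= lte_fin ltr01 oppr0 adde0 ltry.
- move=> y; rewrite rearr_preimage -tailE lebesgue_measure_itv/= lte_fin.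
  rewrite oppr0 adde0; case: ltP => // t0.
  by congr (_%:E); apply/eqP; rewrite eq_le t0; case/andP: (tail01 y) => ->.
Qed.

Lemma rearr_integrable : mu.-integrable I01 (EFin \o rearr).
Proof.
apply/integrableP; split; first by apply/measurable_EFinP; exact: measurable_rearr.
have /integrableP[_] := bint; apply: le_lt_trans.
rewrite -(@rearr_integral (fun x => `|x%:E|%E))//.
exact: measurableT_comp.
Qed.

Let rearr_mass : \int[mu]_(x in I01) rearr x = \int[mu]_(x in I01) b x.
Proof.
rewrite /Rintegral integralE [in RHS]integralE; congr (fine (_ - _)).
- under eq_integral do rewrite funeposE.
  under [in RHS]eq_integral do rewrite funeposE.
  apply: (@rearr_integral (fun x => maxe x%:E 0)%E).
  + exact: measurable_maxe.
  + by move=> x; rewrite le_max lexx orbT.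
- under eq_integral do rewrite funenegE.
  under [in RHS]eq_integral do rewrite funenegE.
  apply: (@rearr_integral (fun x => maxe (- x%:E) 0)%E).
  + by apply: measurable_maxe => //; exact: measurableT_comp.
  + by move=> x; rewrite le_max lexx orbT.
Qed.

Let I01_lty : (mu I01 < +oo)%E. Proof. by rewrite mu01 ltry. Qed.

(** With the level [y = b*(x)], [b <= (b - y)^+ + y] on [F]; the integral of
    [(b - y)^+] over the unit interval does not change under rearrangement, and
    [(b* - y)^+] is [b* - y] before [x] and zero after [x]. *)
Lemma hardy_littlewood (F : set (measurableTypeR R)) (x : R) :
  measurable F -> F `<=` I01 -> mu F = x%:E ->
  \int[mu]_(s in F) b s <= \int[mu]_(s in `[0, x]) rearr s.
Proof.
move=> mF F01 Fx.
have x0 : 0 <= x by rewrite -lee_fin -Fx measure_ge0.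
have x1 : x <= 1 by rewrite -lee_fin -Fx -mu01; apply: le_measure; rewrite ?inE.
have bF : mu.-integrable F (EFin \o b) by exact: integrableS bint.
have [x_0|{}x0] := leP x 0.
  have xE : x = 0 by apply/eqP; rewrite eq_le x_0 x0.
  rewrite xE set_itv1 Rintegral_set1 /Rintegral null_set_integral//.
    exact: measurable_int bF.
  by rewrite -[LHS]/(mu F) Fx xE.
have cst_int S k : measurable S -> S `<=` I01 -> mu.-integrable S (EFin \o cst (k : R)).
  move=> mS S01; apply: (@integrableS _ _ _ mu I01) => //.
  apply: measurable_bounded_integrable => //.
  by exists `|k|; split; [exact: num_real|move=> y ky z _; exact: ltW].
(* The level b*(1) is the infimum of an unbounded set, hence no use here; but F
   is then the unit interval up to a null set. *)
have [x_1|{}x1] := leP 1 x.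
  have xE : x = 1 by apply/eqP; rewrite eq_le x_1 x1.
  rewrite xE rearr_mass -(setDUK F01) Rintegral_setU//; last 3 first.
    exact: measurableD.
    by rewrite setDUK.
    by apply/disj_setPS; rewrite setDIK.
  rewrite [X in _ + X](_ : _ = 0) ?addr0// /Rintegral null_set_integral//.
  - exact: measurableD.
  - by apply: (measurable_funS m01) => //; exact: measurable_int bint.
  - transitivity (mu I01 - mu F)%E; last by rewrite mu01 Fx xE subee.
    by rewrite [LHS]measureD// ?setIidr//; exact: I01_lty.
pose y := rearr x.
have m0x : measurable (`]0, x]%classic : set (measurableTypeR R)) by exact: measurable_itv.
have mx1 : measurable (`]x, 1[%classic : set (measurableTypeR R)) by exact: measurable_itv.
have s0x : `]0, x]%classic `<=` I01.
  by move=> z /=; rewrite !in_itv/= => /andP[/ltW -> /le_trans]; apply; exact: ltW.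
have sx1 : `]x, 1[%classic `<=` I01.
  by move=> z /=; rewrite !in_itv/= => /andP[xz /ltW ->]; rewrite (le_trans (ltW x0) (ltW xz)).
pose pb (s : R) := Num.max (b s - y) 0.
pose pr (s : R) := Num.max (rearr s - y) 0.
have int_max (g : R -> R) : mu.-integrable I01 (EFin \o g) ->
    mu.-integrable I01 (EFin \o (fun s => Num.max (g s - y) 0)).
  move=> ig; have := integrable_funrpos m01 (integrableB m01 ig (cst_int _ y m01 (@subset_refl _ _))).
  by apply: eq_integrable => // z _ /=.
have pbint : mu.-integrable I01 (EFin \o pb) by exact: int_max.
have prpint : mu.-integrable I01 (EFin \o pr) by apply: int_max; exact: rearr_integrable.
have yx_int (S : set (measurableTypeR R)) : measurable S -> mu S = x%:E ->
    \int[mu]_(s in S) y = y * x.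
  by move=> mS Sx; rewrite Rintegral_cst//; congr (_ * _); exact: (congr1 fine Sx).
have step1 : \int[mu]_(s in F) b s <= \int[mu]_(s in I01) pb s + y * x.
  have pbF : mu.-integrable F (EFin \o pb) by exact: integrableS pbint.
  apply: (@le_trans _ _ (\int[mu]_(s in F) (pb s + y))).
    apply: le_Rintegral => //.
      have := integrableD mF pbF (cst_int _ y mF F01).
      by apply: eq_integrable => // z _ /=.
    by move=> s Fs; rewrite /pb -lerBlDr le_max lexx.
  rewrite RintegralD//; last exact: cst_int.
  rewrite yx_int// lerD2r -(setDUK F01) Rintegral_setU//.
  - by rewrite lerDl; apply: Rintegral_ge0 => s _; rewrite le_max lexx orbT.
  - exact: measurableD.
  - by rewrite setDUK.
  - by apply/disj_setPS; rewrite setDIK.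
have step2 : \int[mu]_(s in I01) pb s = \int[mu]_(s in I01) pr s.
  congr fine; rewrite (@rearr_integral (fun t => (Num.max (t - y) 0)%:E))//.
  - apply/measurable_EFinP; apply: measurable_maxr => //.
    by apply: measurable_funB.
  - by move=> t; rewrite lee_fin le_max lexx orbT.
have step3 : \int[mu]_(s in I01) pr s = \int[mu]_(s in `]0, x]) (rearr s - y).
  have prD : mu.-integrable D (EFin \o pr).
    by apply: integrableS prpint => //; exact: subset_itv_oo_cc.
  have -> : \int[mu]_(s in I01) pr s = \int[mu]_(s in D) pr s.
    rewrite /Rintegral integral_itv_bndoo//.
    by apply: measurable_int prD.
  have DE : D = `]0, x]%classic `|` `]x, 1[%classic.
    by rewrite /D -itv_bndbnd_setU// bnd_simp// ltW.
  rewrite DE Rintegral_setU//; last 2 first.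
    by rewrite -DE.
    apply/disj_setPS => s /=; rewrite !in_itv/= => -[/andP[_ sx] /andP[xs _]].
    by have := lt_le_trans xs sx; rewrite ltxx.
  rewrite [X in _ + X](_ : _ = 0) ?addr0; last first.
    transitivity (\int[mu]_(s in `]x, 1[) (0 : R)); last by rewrite Rintegral_cst// mul0r.
    apply: eq_Rintegral => s.
    rewrite inE/= in_itv/= => /andP[xs s1].
    by rewrite /pr max_r// subr_le0; apply: rearr_nonincreasing => //; exact: ltW.
  apply: eq_Rintegral => s; rewrite inE/= in_itv/= => /andP[s0 sx].
  by rewrite /pr max_l// subr_ge0; exact: rearr_nonincreasing.
have rint : mu.-integrable `]0, x] (EFin \o rearr) by exact: integrableS rearr_integrable.
apply: (le_trans step1); rewrite step2 step3 RintegralB//; last exact: cst_int.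
rewrite yx_int//; last first.
  by rewrite lebesgue_measure_itv/= lte_fin x0 oppr0 adde0.
by rewrite subrK Rintegral_itv_obnd_cbnd.
Qed.

End rearrangement.

(** * Absolutely continuous paths with a jump at the origin *)

Section primitive.
Context {R : realType}.
Notation mu := (@lebesgue_measure R).
Notation RR := (measurableTypeR R).
Notation I01 := (`[0%R, 1%R]%classic : set RR).
Implicit Types (a : R -> R) (t x y : R).

Definition prim a t : R := \int[mu]_(s in `[0, t]) a s.

Lemma itv01_measurable : measurable I01.
Proof. exact: measurable_itv. Qed.

Lemma integrable_sub01 a (S : set RR) : mu.-integrable I01 (EFin \o a) ->
  measurable S -> S `<=` I01 -> mu.-integrable S (EFin \o a).
Proof. by move=> aint mS S01; apply: integrableS aint. Qed.

Lemma prim0 a : prim a 0 = 0.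
Proof. by rewrite /prim set_itv1 Rintegral_set1. Qed.

Lemma prim_continuous a : mu.-integrable I01 (EFin \o a) ->
  {within `[0, 1], continuous (prim a)}.
Proof. by move=> aint; exact: parameterized_integral_continuous. Qed.

Lemma primB a x y : mu.-integrable I01 (EFin \o a) -> 0 <= x -> x <= y -> y <= 1 ->
  prim a y - prim a x = \int[mu]_(s in `]x, y]) a s.
Proof.
move=> aint x0 xy y1; rewrite /prim Rintegral_itvB//.
apply: integrable_sub01 => //.
by move=> s /=; rewrite !in_itv/= => /andP[-> /le_trans]; exact.
Qed.

Lemma le_prim a x y : mu.-integrable I01 (EFin \o a) -> 0 <= x -> x <= y -> y <= 1 ->
  (forall s, x < s <= y -> 0 <= a s) -> prim a x <= prim a y.
Proof.
move=> aint x0 xy y1 a0; rewrite -subr_ge0 primB//.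
by apply: Rintegral_ge0 => s /=; rewrite in_itv/=; exact: a0.
Qed.

Definition ac_fun c a t : R := if 0 <= t <= 1 then c + prim a t else 0.

Lemma ac_funE c a t : 0 <= t <= 1 -> ac_fun c a t = c + prim a t.
Proof. by rewrite /ac_fun => ->. Qed.

Lemma ac_affine_continuous c a : mu.-integrable I01 (EFin \o a) ->
  {within `[0, 1], continuous (fun t => c + prim a t)}.
Proof.
move=> aint t; apply: cvgD; first exact: cvg_cst.
exact: prim_continuous.
Qed.

Lemma ac_fun_continuous c a : mu.-integrable I01 (EFin \o a) ->
  {within `[0, 1], continuous (ac_fun c a)}.
Proof.
move=> aint; have := @ac_affine_continuous c a aint.
apply: subspace_eq_continuous => t; rewrite inE/= in_itv/= => t01.
by rewrite /from_subspace ac_funE.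
Qed.

Lemma ac_fun_cadlag c a : mu.-integrable I01 (EFin \o a) -> cadlag (ac_fun c a).
Proof.
move=> aint; have /(continuous_within_itvP _ ltr01)[ci c0 c1] := @ac_fun_continuous c a aint.
split=> t /andP[].
- rewrite le_eqVlt => /predU1P[<- _//|t0 t1].
  by apply: cvg_at_right_filter; apply: ci; rewrite in_itv/= t0.
- move=> t0; rewrite le_eqVlt => /predU1P[->|t1].
    by apply/cvg_ex; eexists; exact: c1.
  apply/cvg_ex; eexists; apply: cvg_at_left_filter; apply: ci.
  by rewrite in_itv/= t0.
Qed.

Lemma ac_fun_out c a t : ~ (0 <= t <= 1) -> ac_fun c a t = 0.
Proof. by rewrite /ac_fun; case: ifP. Qed.

(** The value at [0] counts as an upward jump, so that a path of this form
    carries both the absolutely continuous and the upward singular cost. *)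
Definition ac_path c a (aint : mu.-integrable I01 (EFin \o a)) : skorohod R :=
  Skorohod (ac_fun_cadlag c aint) (@ac_fun_out c a).

Lemma ac_path_bounded_variation c a (aint : mu.-integrable I01 (EFin \o a)) :
  finite_variation (ac_path c aint).
Proof.
have pint : mu.-integrable I01 (EFin \o a^\+) by exact: integrable_funrpos.
have nint : mu.-integrable I01 (EFin \o a^\-) by exact: integrable_funrneg.
have nd k (g : R -> R) : mu.-integrable I01 (EFin \o g) -> (forall s, 0 <= g s) ->
    bounded_variation 0 1 (ac_fun k g).
  move=> gint g0; apply: nondecreasing_bounded_variation => x y.
  rewrite !in_itv/= => x01 y01 xy; rewrite !ac_funE// lerD2l.
  case/andP: x01 y01 => [x0 _] /andP[_ y1].
  by apply: le_prim => // s _; exact: g0.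
have := bounded_variationD ltr01 (nd c _ pint (funrpos_ge0 a))
  (bounded_variationN (nd 0 _ nint (funrneg_ge0 a))).
congr (bounded_variation 0 1 _); apply/funext => t /=.
rewrite /ac_fun; case: ifP => [t01|]; last by rewrite subr0.
rewrite add0r -addrA; congr (_ + _); rewrite /prim.
have t_sub : `[0, t]%classic `<=` I01.
  move=> s /=; rewrite !in_itv/= => /andP[-> st]/=.
  by apply: le_trans st _; case/andP: t01.
rewrite -RintegralB//; last 2 first.
  exact: integrable_sub01.
  exact: integrable_sub01.
by apply: eq_Rintegral => s _; rewrite -[in RHS](funrposBneg a).
Qed.

(** The upward singular part of a path that jumps at the origin and is absolutely
    continuous afterwards. *)
Definition atom0 (c : {nonneg R}) : {measure set RR -> \bar R} :=
  mscale c (dirac (0 : RR)).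

Lemma atom0_lty (c : {nonneg R}) : (atom0 c setT < +oo)%E.
Proof. by rewrite /atom0 /= /mscale /= /dirac indicT mule1 ltry. Qed.

Definition ac_components (c : {nonneg R}) a : components :=
  Components a (mfrestr measurableT (atom0_lty c)) mzero.

Lemma ac_path_decomposes (c : {nonneg R}) a (aint : mu.-integrable I01 (EFin \o a)) :
  decomposes (ac_path c%:num aint) (ac_components c a).
Proof.
have upE S : up_measure (ac_components c a) S = (c%:num * \1_S 0)%:E.
  by rewrite /= /mfrestr /mrestr setIT /atom0 /= /mscale /= /dirac EFinM.
split => //.
- move=> t t01; rewrite upE /= /mzero subr0 ac_funE// addrC.
  rewrite indicE mem_set ?mulr1//= in_itv/= lexx/=; by case/andP: t01.
- exists [set 0], set0; split.
  + by split; [exact: measurable_set1|exact: measurable0].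
  + split; last by rewrite setI0.
    by rewrite setU0 => _ -> /=; rewrite in_itv/= lexx ler01.
  + by rewrite setU0 lebesgue_measure_set1.
  + split; last by [].
    by rewrite upE indicE memNset ?mulr0//= => /(_ erefl).
Qed.

(** Components are chosen, not computed, so the masses are identified through
    uniqueness. *)
Lemma ac_path_mass (c : {nonneg R}) a (aint : mu.-integrable I01 (EFin \o a)) :
  up_part (ac_path c%:num aint) 1 = c%:num /\ dn_part (ac_path c%:num aint) 1 = 0.
Proof.
have [up dn] := decomposes_mass_uniq
  (decompositionP (@ac_path_bounded_variation c%:num a aint)) (ac_path_decomposes c aint).
rewrite /up_part /dn_part up dn /= /mzero; split => //.
rewrite /mfrestr /mrestr setIT /atom0 /= /mscale /= /dirac indicE mem_set.
  by rewrite /= mulr1.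
by rewrite /= in_itv/= lexx ler01.
Qed.

Lemma ac_path_density (c : {nonneg R}) a (aint : mu.-integrable I01 (EFin \o a)) :
  ae_eq mu I01 (EFin \o dot_ac (ac_path c%:num aint)) (EFin \o a).
Proof.
exact: (decomposes_density_uniq
  (decompositionP (@ac_path_bounded_variation c%:num a aint)) (ac_path_decomposes c aint)).
Qed.

End primitive.

(** * Primitives of nonincreasing densities are concave *)

Section concave_primitive.
Context {R : realType}.
Notation mu := (@lebesgue_measure R).
Notation RR := (measurableTypeR R).
Notation I01 := (`[0%R, 1%R]%classic : set RR).
Implicit Types (a : R -> R) (t x y : R).

(** A rearrangement is controlled on the open interval only. *)
Definition nonincreasing01 a :=
  forall s s' : R, 0 < s -> s <= s' -> s' < 1 -> a s' <= a s.

Lemma Rintegral_cst_itv x y k b0 b1 : x <= y ->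
  \int[mu]_(s in [set` Interval (BSide b0 x) (BSide b1 y)]) k = k * (y - x).
Proof.
move=> xy; rewrite Rintegral_cst//; congr (_ * _).
rewrite [X in fine X](_ : _ = (y - x)%:E)//.
rewrite [LHS]lebesgue_measure_itv/= lte_fin; case: ltP => [//|yx].
by rewrite (_ : y = x) ?subrr//; apply/eqP; rewrite eq_le xy yx.
Qed.

Lemma integrable_cst_itv x y k b0 b1 :
  mu.-integrable [set` Interval (BSide b0 x) (BSide b1 y)] (EFin \o cst k).
Proof.
apply: measurable_bounded_integrable => //.
- rewrite [X in (X < _)%E]lebesgue_measure_itv/=; case: ifP => _; exact: ltry.
- by exists `|k|; split; [exact: num_real|move=> u ku z _; exact: ltW].
Qed.

(** Both chords are compared with the slope [a y]; the form without division
    holds also for degenerate triples. *)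
Lemma prim_concave a x y w : mu.-integrable I01 (EFin \o a) -> nonincreasing01 a ->
  0 <= x -> x <= y -> y <= w -> w <= 1 ->
  (w - y) * prim a x + (y - x) * prim a w <= (w - x) * prim a y.
Proof.
move=> aint a_ni x0; rewrite le_eqVlt => /predU1P[<- _ _|xy].
  by rewrite subrr mul0r addr0.
rewrite le_eqVlt => /predU1P[<- _|yw w1].
  by rewrite subrr mul0r add0r.
have y0 : 0 < y by exact: le_lt_trans xy.
have y1 : y < 1 by exact: lt_le_trans w1.
have h1 : a y * (y - x) <= prim a y - prim a x.
  rewrite (primB aint x0 (ltW xy) (ltW y1)) -(@Rintegral_cst_itv x y _ false false) ?(ltW xy)//.
  apply: le_Rintegral => //.
  - exact: integrable_cst_itv.
  - apply: integrable_sub01 => // s /=; rewrite !in_itv/= => /andP[xs sy].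
    by rewrite (le_trans x0 (ltW xs)) (le_trans sy (ltW y1)).
  - move=> s; rewrite /= in_itv/= => /andP[xs sy]; apply: a_ni => //.
    exact: le_lt_trans xs.
have h2 : prim a w - prim a y <= a y * (w - y).
  have sub : `]y, w]%classic `<=` I01.
    move=> s /=; rewrite !in_itv/= => /andP[ys sw].
    by rewrite (le_trans (ltW y0) (ltW ys)) (le_trans sw w1).
  have sub' : `]y, w[%classic `<=` I01.
    move=> s /=; rewrite in_itv/= => /andP[ys sw]; apply: sub.
    by rewrite /= in_itv/= ys ltW.
  rewrite (primB aint (ltW y0) (ltW yw) w1) -Rintegral_itv_bndo_bndc; last exact: integrable_sub01.
  rewrite -(@Rintegral_cst_itv y w _ false true) ?(ltW yw)//.
  apply: le_Rintegral => //.
  - exact: integrable_sub01.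
  - exact: integrable_cst_itv.
  - move=> s; rewrite /= in_itv/= => /andP[ys sw]; apply: a_ni => //; first exact: ltW.
    exact: lt_le_trans w1.
have {}h1 : a y * (y - x) * (w - y) <= (prim a y - prim a x) * (w - y).
  by rewrite ler_pM2r// subr_gt0.
have {}h2 : (prim a w - prim a y) * (y - x) <= a y * (w - y) * (y - x).
  by rewrite ler_pM2r// subr_gt0.
lra.
Qed.

Lemma prim_quasiconcave a x y w : mu.-integrable I01 (EFin \o a) -> nonincreasing01 a ->
  0 <= x -> x <= y -> y <= w -> w <= 1 ->
  Num.min (prim a x) (prim a w) <= prim a y.
Proof.
move=> aint a_ni x0 xy yw w1.
have [|xw] := leP w x.
  move=> wx; have -> : y = x by apply/eqP; rewrite eq_le (le_trans yw wx) xy.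
  by rewrite ge_min lexx.
rewrite -(ler_pM2l (_ : 0 < w - x)) ?subr_gt0//.
apply: le_trans (prim_concave aint a_ni x0 xy yw w1).
set m := Num.min _ _.
have mx : (w - y) * m <= (w - y) * prim a x by rewrite ler_wpM2l ?subr_ge0// ge_min lexx.
have mw : (y - x) * m <= (y - x) * prim a w.
  by rewrite ler_wpM2l ?subr_ge0// ge_min lexx orbT.
lra.
Qed.

Lemma monotone01_measurable (f : R -> R) : {in `[0, 1] &, nondecreasing_fun f} ->
  measurable_fun I01 f.
Proof.
move=> fnd; pose g t := f (Num.max 0 (Num.min t 1)).
have c01 t : Num.max 0 (Num.min t 1) \in `[0, 1].
  by rewrite in_itv/= le_max lexx/= ge_max ler01 ge_min lexx orbT.
apply: (@eq_measurable_fun _ _ _ _ _ g).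
  move=> t; rewrite inE/= in_itv/= => /andP[t0 t1].
  by rewrite /g min_l// max_r.
apply: nondecreasing_measurable; first exact: itv01_measurable.
move=> x y xy; apply: fnd; rewrite ?c01//.
rewrite ge_max !le_max lexx/=; apply/orP.
by right; rewrite le_min !ge_min xy lexx orbT.
Qed.

Lemma bounded_variation_measurable (f : R -> R) : bounded_variation 0 1 f ->
  measurable_fun I01 f.
Proof.
move=> fBV.
have fNBV : bounded_variation 0 1 (\- f) by exact: bounded_variationN.
have m1 := monotone01_measurable (fine_neg_tv_nondecreasing fBV).
have m2 := monotone01_measurable (fine_neg_tv_nondecreasing fNBV).
apply: eq_measurable_fun (measurable_funB m2 m1) => t.
by rewrite inE => /(bounded_variation_pos_neg_tvE fBV) ->.
Qed.

End concave_primitive.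

(** * The cost of a path *)

Section cost.
Context {R : realType}.
Notation mu := (@lebesgue_measure R).
Notation RR := (measurableTypeR R).
Notation I01 := (`[0%R, 1%R]%classic : set RR).
Variables (Lam : R -> \bar R) (delta : R).
Hypotheses (rate_ge0 : forall x, (0 <= rate Lam x)%E)
  (rate_meas : measurable_fun setT (rate Lam))
  (delta_gt0 : 0 < delta) (rate_delta : rate Lam (- delta) = 0%E).
Implicit Types (a : R -> R) (psi : skorohod R).

(** The infimum is reached at the slope [- delta]: idling is free. *)
Lemma inf_rate_nonpos : ereal_inf (rate Lam @` [set y : R | (y <= 0)%R]) = 0%E.
Proof.
apply/eqP; rewrite eq_le; apply/andP; split.
  by apply: ereal_inf_lbound; exists (- delta) => //=; rewrite oppr_le0 ltW.
by apply: le_ereal_inf_tmp => _ [y _ <-].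
Qed.

Lemma objectiveE psi : objective Lam psi =
  (\int[mu]_(s in I01) (rate Lam (dot_ac psi s) * (\1_[set t | 0 < psi t] s)%:E)
   + theta_dn Lam * (dn_part psi 1)%:E + theta_up Lam * (up_part psi 1)%:E)%E.
Proof.
rewrite /objective; congr (_ + _ + _)%E; apply: eq_integral => s _.
by rewrite inf_rate_nonpos mul0e adde0.
Qed.

Lemma positivity_set_measurable psi : finite_variation psi ->
  measurable (I01 `&` [set t | 0 < psi t]).
Proof.
move=> psiBV; have := bounded_variation_measurable psiBV itv01_measurable
  (measurable_itv `]0, +oo[); congr (measurable (_ `&` _)).
by apply/seteqP; split => x /=; rewrite in_itv/= andbT.
Qed.

Lemma positivity_indic_measurable psi : finite_variation psi ->
  measurable_fun I01 (fun s => (\1_[set t | 0 < psi t] s)%:E : \bar R).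
Proof.
move=> psiBV; have mE := positivity_set_measurable psiBV.
apply/measurable_EFinP.
apply: (@eq_measurable_fun _ _ _ _ _ (\1_(I01 `&` [set t | 0 < psi t]) : R -> R)).
  move=> t t01; rewrite !indicE; congr (_%:R); congr nat_of_bool.
  by move: t01; rewrite inE => t01; apply/idP/idP; rewrite !inE/=; tauto.
by apply: measurable_funTS; exact: measurable_indic.
Qed.

Lemma rate_comp_measurable a : mu.-integrable I01 (EFin \o a) ->
  measurable_fun I01 (fun s => rate Lam (a s)).
Proof.
move=> aint; apply: measurableT_comp => //.
by apply/measurable_EFinP; exact: measurable_int aint.
Qed.

Lemma dot_ac_integrable psi : finite_variation psi ->
  mu.-integrable I01 (EFin \o dot_ac psi).
Proof. by move=> /decompositionP[]. Qed.

Lemma objective_ac (c : {nonneg R}) a (aint : mu.-integrable I01 (EFin \o a)) :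
  objective Lam (ac_path c%:num aint) =
  (\int[mu]_(s in I01)
     (rate Lam (a s) * (\1_[set t | 0 < ac_fun c%:num a t] s)%:E)
   + theta_up Lam * c%:num%:E)%E.
Proof.
have fBV := @ac_path_bounded_variation R c%:num a aint.
rewrite objectiveE; have [-> ->] := ac_path_mass c aint.
rewrite mule0 adde0; congr (_ + _)%E.
have m1 := positivity_indic_measurable fBV.
apply: ae_eq_integral => //.
- by apply: emeasurable_funM => //; apply: rate_comp_measurable; exact: dot_ac_integrable.
- by apply: emeasurable_funM => //; exact: rate_comp_measurable.
- have := ac_path_density c aint; apply: filterS => s /= h /h[->//].
Qed.

Lemma path_rate_ac (c : {nonneg R}) a (aint : mu.-integrable I01 (EFin \o a)) :
  path_rate Lam (ac_path c%:num aint) =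
  (\int[mu]_(s in I01) rate Lam (a s) + theta_up Lam * c%:num%:E)%E.
Proof.
have fBV := @ac_path_bounded_variation R c%:num a aint.
rewrite /path_rate asboolT//; have [-> ->] := ac_path_mass c aint.
rewrite mule0 adde0; congr (_ + _)%E.
apply: ae_eq_integral => //.
- apply: rate_comp_measurable; exact: dot_ac_integrable.
- exact: rate_comp_measurable.
- have := ac_path_density c aint; apply: filterS => s /= h /h[->//].
Qed.

End cost.

(** * Area above the axis *)

Section area.
Context {R : realType}.
Notation mu := (@lebesgue_measure R).
Notation RR := (measurableTypeR R).
Notation I01 := (`[0%R, 1%R]%classic : set RR).

Definition pos_area (f : R -> R) : R := \int[mu]_(t in I01) Num.max (f t) 0.

Lemma continuous01_integrable (f : R -> R) : {within `[0, 1], continuous f} ->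
  mu.-integrable I01 (EFin \o f).
Proof. by move=> fc; apply: continuous_compact_integrable => //; exact: segment_compact. Qed.

Lemma continuous01_pos_integrable (f : R -> R) : {within `[0, 1], continuous f} ->
  mu.-integrable I01 (EFin \o (fun t => Num.max (f t) 0)).
Proof.
move=> fc; have := integrable_funrpos itv01_measurable (continuous01_integrable fc).
by apply: eq_integrable => // t _.
Qed.

Lemma continuous01_bounded (f : R -> R) : {within `[0, 1], continuous f} ->
  exists M : R, forall t : R, 0 <= t <= 1 -> `|f t| <= M.
Proof.
move=> fc; have := continuous_compact fc (@segment_compact _ 0 1).
move=> /compact_bounded[M [_ HM]]; exists (M + 1) => t t01.
by apply: (HM (M + 1)); [rewrite ltrDl|exists t; rewrite //= in_itv].
Qed.

(** Tilting [f] towards the line [- d t], the area above the axis goes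
    continuously from that of [f] to zero. *)
Lemma pos_area_ivt (f : R -> R) (d z : R) : {within `[0, 1], continuous f} ->
  0 <= d -> 0 <= z -> z <= pos_area f ->
  exists l, 0 <= l <= 1 /\
    pos_area (fun t => l * f t - (1 - l) * d * t) = z.
Proof.
move=> fc d0 z0 zf; pose F l t := l * f t - (1 - l) * d * t.
have Fc l : {within `[0, 1], continuous (F l)}.
  move=> t; apply: cvgB; first by apply: cvgM; [exact: cvg_cst|exact: fc].
  apply: cvgM; first exact: cvg_cst.
  exact: (@continuous_subspaceT _ _ _ id (fun x => cvg_id)).
pose A l := pos_area (F l).
have [M fM] := continuous01_bounded fc.
have M0 : 0 <= M by apply: le_trans (fM 0 _) => //; rewrite lexx ler01.
(* Positive parts are 1-Lipschitz, so A is Lipschitz in the weight. *)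
have lip l l' : A l - A l' <= `|l - l'| * (M + d).
  rewrite /A /pos_area -RintegralB//; last 2 first.
    exact: continuous01_pos_integrable.
    exact: continuous01_pos_integrable.
  rewrite -[leRHS]mulr1 -[X in _ <= _ * X](subr0 1) -(@Rintegral_cst_itv R 0 1 _ true false ler01).
  apply: le_Rintegral => //.
  - apply: (@integrableB _ _ _ mu _ itv01_measurable (EFin \o _) (EFin \o _)).
      exact: continuous01_pos_integrable (Fc l).
    exact: continuous01_pos_integrable (Fc l').
  - exact: integrable_cst_itv.
  - move=> t; rewrite /= in_itv/= => t01.
    have maxB (u v : R) : Num.max u 0 - Num.max v 0 <= `|u - v|.
      have vm : v <= Num.max v 0 by rewrite le_max lexx.
      have m0 : 0 <= Num.max v 0 by rewrite le_max lexx orbT.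
      have uv := ler_norm (u - v); have uv0 := normr_ge0 (u - v).
      by rewrite lerBlDr ge_max; apply/andP; split; lra.
    apply: (le_trans (maxB _ _)).
    have -> : F l t - F l' t = (l - l') * (f t + d * t) by rewrite /F; ring.
    rewrite normrM ler_wpM2l// (le_trans (ler_normD _ _))// lerD ?fM//.
    case/andP: t01 => t0 t1; rewrite ger0_norm ?mulr_ge0//.
    by rewrite ler_piMr.
have Ac : {within `[0, 1], continuous A}.
  apply: continuous_subspaceT => l; apply/cvgrPdist_le => e e0.
  have Md : 0 < M + d + 1 by rewrite ltr_pwDr// addr_ge0.
  near=> l'.
  have ll : `|l - l'| <= e / (M + d + 1).
    by near: l'; apply: cvgr_dist_le; [exact: cvg_id|rewrite divr_gt0].
  have b (u v : R) : `|u - v| <= e / (M + d + 1) -> A u - A v <= e.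
    move=> uv; apply: (le_trans (lip _ _)).
    apply: (@le_trans _ _ (e / (M + d + 1) * (M + d))).
      by rewrite ler_wpM2r// addr_ge0.
    rewrite mulrAC ler_pdivrMr// ler_wpM2l ?(ltW e0)// lerDl.
    exact: ler01.
  by rewrite ler_norml lerNl opprB !b// distrC.
have A0 : A 0 = 0.
  rewrite /A /pos_area; transitivity (\int[mu]_(t in I01) (0 : R)).
    apply: eq_Rintegral => t; rewrite inE/= in_itv/= => /andP[t0 _].
    by rewrite /F max_r// mul0r sub0r subr0 mul1r oppr_le0 mulr_ge0.
  by rewrite Rintegral_cst ?mul0r//; exact: itv01_measurable.
have A1 : A 1 = pos_area f.
  by apply: eq_Rintegral => t _; rewrite /F mul1r subrr !mul0r subr0.
have [|l l01 Al] := @IVT R A 0 1 z ler01 Ac.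
  by rewrite A0 A1 min_l ?max_r ?z0 ?zf// (le_trans z0 zf).
by exists l; split => //; move: l01; rewrite in_itv.
Unshelve. all: by end_near. Qed.

End area.

(** * From a concave profile to a feasible path *)

Section feasible_of_concave.
Context {R : realType}.
Notation mu := (@lebesgue_measure R).
Notation RR := (measurableTypeR R).
Notation I01 := (`[0%R, 1%R]%classic : set RR).

(** A concave function that starts nonnegative crosses zero at most once: its
    positive part follows it up to [T] and vanishes afterwards. It is therefore
    again a primitive, of the density cut at [T]. *)
Lemma concave_pos_part (c : {nonneg R}) (a : R -> R) (aint : mu.-integrable I01 (EFin \o a)) :
  nonincreasing01 a -> 0 < pos_area (fun t => c%:num + prim a t) ->
  exists2 T : R, 0 <= T <= 1 &
    (forall t : R, 0 <= t <= 1 -> Num.max (c%:num + prim a t) 0 =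
       c%:num + prim a (Num.min t T)) /\
    (forall t : R, T < t <= 1 -> c%:num + prim a T = 0).
Proof.
move=> a_ni area0; pose f t := c%:num + prim a t.
have f0 : 0 <= f 0 by rewrite /f prim0 addr0.
have fc := @ac_affine_continuous R c%:num a aint.
have fconc x y w : 0 <= x -> x <= y -> y <= w -> w <= 1 ->
    (w - y) * f x + (y - x) * f w <= (w - x) * f y.
  move=> x0 xy yw w1; have := prim_concave aint a_ni x0 xy yw w1.
  by rewrite /f; lra.
have fqc x y w : 0 <= x -> x <= y -> y <= w -> w <= 1 -> 0 <= f x -> 0 <= f w -> 0 <= f y.
  move=> x0 xy yw w1 fx fw.
  have := prim_quasiconcave aint a_ni x0 xy yw w1.
  rewrite ge_min => /orP[h|h]; [apply: le_trans fx _|apply: le_trans fw _]; by rewrite lerD2l.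
have [f1|f1] := leP 0 (f 1).
  exists 1; first by rewrite ler01 lexx.
  split=> t /andP[t0 t1]; last by have := lt_le_trans t0 t1; rewrite ltxx.
  rewrite (min_l t1) max_l//; exact: (@fqc 0 t 1).
have [t1 /andP[t10 t11] ft1] : exists2 t1 : R, 0 <= t1 <= 1 & 0 < f t1.
  apply: contrapT => H; move: area0; rewrite /pos_area.
  rewrite [X in 0 < X](_ : _ = 0) ?ltxx//.
  transitivity (\int[mu]_(t in I01) (0 : R)).
    apply: eq_Rintegral => t; rewrite inE/= in_itv/= => t01.
    by rewrite max_r// leNgt; apply/negP => ft; apply: H; exists t.
  by rewrite Rintegral_cst ?mul0r//; exact: itv01_measurable.
have fc' : {within `[t1, 1], continuous f}.
  apply: continuous_subspaceW fc => s /=; rewrite !in_itv/= => /andP[st ->].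
  by rewrite (le_trans t10).
have [|T] := IVT t11 fc' (v := 0).
  by rewrite ge_min (ltW f1) orbT/= le_max (ltW ft1).
rewrite in_itv/= => /andP[t1T T1] fT.
have t1T' : t1 < T.
  rewrite lt_neqAle t1T andbT; apply/eqP => e.
  by move: ft1; rewrite e fT ltxx.
have T0 : 0 <= T by exact: le_trans t1T.
exists T; first by rewrite T0 T1.
split=> [t /andP[t0 tle1]|t _]; last exact: fT.
have [tT|Tt] := leP t T.
  by rewrite max_l//; apply: (@fqc 0 t T) => //; rewrite fT.
have -> : c%:num + prim a T = 0 by exact: fT.
rewrite max_r//; have := @fconc t1 T t t10 t1T (ltW Tt) tle1.
rewrite fT mulr0 => h.
have h1 : 0 < (t - T) * f t1 by rewrite mulr_gt0// subr_gt0.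
have {}h : (T - t1) * f t < 0 by lra.
by rewrite ltW// -(pmulr_rlt0 _ (_ : 0 < T - t1)) ?subr_gt0.
Qed.

Variables (Lam : R -> \bar R) (delta : R).
Hypotheses (rate_ge0 : forall x, (0 <= rate Lam x)%E)
  (rate_meas : measurable_fun setT (rate Lam))
  (rate_convex : convex_ereal (rate Lam))
  (delta_gt0 : 0 < delta) (rate_delta : rate Lam (- delta) = 0%E)
  (thup_ge0 : (0 <= theta_up Lam)%E).

(** The path rate of [c + int_0^t a]. It bounds the objective, which forgives the
    slope wherever the path vanishes. *)
Definition ac_cost (c : R) (a : R -> R) : \bar R :=
  (\int[mu]_(s in I01) rate Lam (a s) + theta_up Lam * c%:E)%E.

(** The strict gain when the area exceeds [z] is what forces equality for an
    optimal path: then [l < 1] and the cost drops by that factor. *)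
Lemma feasible_of_concave (c : {nonneg R}) (a : R -> R) (z : R) :
  mu.-integrable I01 (EFin \o a) -> nonincreasing01 a ->
  0 < z -> z <= pos_area (fun t => c%:num + prim a t) ->
  exists psi l, [/\ feasible z psi, 0 <= l <= 1,
    (objective Lam psi <= l%:E * ac_cost c%:num a)%E &
    l = 1 -> pos_area (fun t => c%:num + prim a t) = z].
Proof.
move=> aint a_ni z0 za.
have fc := @ac_affine_continuous R c%:num a aint.
have [l [l01 lz]] := pos_area_ivt fc (ltW delta_gt0) (ltW z0) za.
have [l0 l1] := andP l01.
have c0 : 0 <= c%:num by [].
pose cl : {nonneg R} := NngNum (mulr_ge0 l0 c0).
pose al s := l * a s - (1 - l) * delta.
have cst_int k : mu.-integrable I01 (EFin \o cst k) by exact: integrable_cst_itv.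
have alint : mu.-integrable I01 (EFin \o al).
  have := integrableB itv01_measurable (integrableZl itv01_measurable l aint)
    (cst_int ((1 - l) * delta)).
  by apply: eq_integrable.
have al_ni : nonincreasing01 al.
  by move=> s s' s0 ss' s'1; rewrite /al lerD2r ler_wpM2l// a_ni.
have prim_al t : 0 <= t <= 1 -> prim al t = l * prim a t - (1 - l) * delta * t.
  move=> /andP[t0 t1].
  have sub : `[0, t]%classic `<=` I01.
    by move=> s /=; rewrite !in_itv/= => /andP[-> /le_trans]; exact.
  rewrite /prim RintegralB//.
  - rewrite RintegralZl//; last exact: integrable_sub01.
    by rewrite (@Rintegral_cst_itv R 0 t _ true false t0) subr0.
  - have := integrable_sub01 (integrableZl itv01_measurable l aint) _ sub.
    by apply.
  - exact: integrable_cst_itv.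
have lz' : pos_area (fun t => cl%:num + prim al t) = z.
  rewrite -lz; apply: eq_Rintegral => t; rewrite inE/= in_itv/= => t01.
  by rewrite prim_al//; congr Num.max; ring.
have [|T T01 [fmax fT]] := concave_pos_part (c := cl) alint al_ni.
  by rewrite lz'.
have [T0 T1] := andP T01.
pose a' := al \_ `[0, T].
have TI : `[0, T]%classic `<=` I01.
  by move=> s /=; rewrite !in_itv/= => /andP[-> /le_trans]; exact.
have a'int : mu.-integrable I01 (EFin \o a').
  have : mu.-integrable setT (EFin \o a').
    have mT : measurable (`[0, T]%classic : set RR) by exact: measurable_itv.
    rewrite /a' -restrict_EFin; apply/(integrable_mkcond _ mT).
    exact: integrable_sub01.
  by apply: integrableS => //; exact: itv01_measurable.
have prim_a' t : 0 <= t <= 1 -> prim a' t = prim al (Num.min t T).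
  move=> /andP[t0 t1]; rewrite /prim /a' -Rintegral_mkcondr; congr (Rintegral _ _ _).
  by apply/seteqP; split => s /=; rewrite !in_itv/= le_min; [move=> [/andP[-> ->] /andP[_ ->]]|move=> /and3P[-> -> ->]].
exists (ac_path cl%:num a'int), l.
have fE t : 0 <= t <= 1 -> ac_fun cl%:num a' t = Num.max (cl%:num + prim al t) 0.
  by move=> t01; rewrite ac_funE// prim_a'// fmax.
split; [|exact: l01| |].
- split; first exact: ac_path_bounded_variation.
    by move=> t t01; rewrite /= fE// le_max lexx orbT.
  rewrite -lz' /pos_area /Rintegral fineK; last first.
    apply: integrable_fin_num; first exact: itv01_measurable.
    by apply: continuous01_pos_integrable; exact: ac_affine_continuous.
  by apply: eq_integral => t; rewrite inE/= in_itv/= => t01; rewrite fE.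
- rewrite (objective_ac rate_ge0 rate_meas delta_gt0 rate_delta) /ac_cost ge0_muleDr; last 2 first.
    by apply: integral_ge0.
    by rewrite mule_ge0// lee_fin.
  rewrite EFinM muleCA; apply: leeD => //.
  have rm := rate_comp_measurable rate_meas aint.
  rewrite -ge0_integralZl//.
  apply: ge0_le_integral.
  + exact: itv01_measurable.
  + by move=> s _; rewrite mule_ge0// lee_fin.
  + by apply: emeasurable_funM; [exact: rate_comp_measurable|
      exact: positivity_indic_measurable (@ac_path_bounded_variation R cl%:num a' a'int)].
  + by apply: measurable_funeM; exact: rate_comp_measurable.
  + move=> s; rewrite /= in_itv/= => s01; rewrite indicE.
    have [|] := boolP (s \in _); last by rewrite mule0 mule_ge0// lee_fin.
    rewrite inE/= mule1 => fs.
    have sT : s <= T.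
      rewrite leNgt; apply/negP => Ts; move: fs; rewrite ac_funE// prim_a'//.
      rewrite min_r ?(ltW Ts)// (fT s) ?ltxx// Ts; by case/andP: s01.
    rewrite /a' patchE mem_set; last by rewrite /= in_itv/= sT; case/andP: s01 => ->.
    have := rate_convex (a s) (- delta) l01.
    rewrite rate_delta mule0 adde0 /al; apply: le_trans.
    by rewrite mulrN.
- by move=> l1'; rewrite -lz; apply: eq_Rintegral => t _; rewrite l1' mul1r subrr !mul0r subr0.
Qed.

End feasible_of_concave.

(** * A nonnegative path is dominated by its mass on the positivity set *)

Section zero_set_path.
Context {R : realType}.
Notation mu := (@lebesgue_measure R).
Notation RR := (measurableTypeR R).
Notation I01 := (`[0%R, 1%R]%classic : set RR).

Lemma skorohod_measurable (psi : skorohod R) : finite_variation psi ->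
  measurable_fun setT (psi : RR -> RR).
Proof.
move=> psiBV; have := bounded_variation_measurable psiBV.
move=> /(measurable_restrictT _ itv01_measurable); congr measurable_fun.
apply/funext => t; rewrite patchE; case: ifPn => //.
by rewrite notin_setE/= in_itv/= => /path_out ->.
Qed.

(** [psi] is extended by zero to the left of the origin, so that it starts from
    zero at [- 1] and its jump at the origin is an increment like any other. The
    two measures are the Jordan parts of the charge of [psi]. *)
Lemma zero_set_mass_le0 (psi : skorohod R) (c : components) :
  finite_variation psi -> decomposes psi c ->
  (forall t : R, 0 <= t <= 1 -> 0 <= psi t) ->
  forall t : R, 0 <= t <= 1 ->
  signed_mass c (`[0, t] `&` [set s | psi s = 0]) <= 0.
Proof.
move=> psiBV dpsi psi0 t t01; have mpsi := skorohod_measurable psiBV.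
have [nu [nuE nuI nu_f]] := decomposes_charge dpsi.
have [P [N PN]] := Hahn_decomposition nu.
have massE S : measurable S ->
    fine (jordan_pos PN S) - fine (jordan_neg PN S) = signed_mass c S.
  move=> mS; apply: EFin_inj; rewrite -nuE// (jordan_decomp PN mS) /cadd /=.
  by rewrite cscaleN1 /= EFinB !fineK// fin_num_measure.
have m01 : measurable I01 by exact: measurable_itv.
have out x : x < 0 -> psi x = 0.
  by move=> x0; apply: path_out; rewrite leNgt x0.
have [t0 t1] := andP t01.
have mZ : measurable (psi @^-1` [set 0] : set RR).
  by rewrite -[X in measurable X]setTI; exact: mpsi.
have mD : measurable (`]-1, t]%classic : set RR) by exact: measurable_itv.
have := @zero_set_le R (jordan_pos PN) (jordan_neg PN) psi (-1) t.
have -> : (`]-1, t]%classic `&` psi @^-1` [set 0]) = `]-1, t]%classic `&` [set s | psi s = 0].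
  by [].
move=> H; have {H} : fine (jordan_pos PN (`]-1, t]%classic `&` psi @^-1` [set 0])) <=
    fine (jordan_neg PN (`]-1, t]%classic `&` psi @^-1` [set 0])).
  apply: H => //.
  - by apply: lt_le_trans t0; rewrite oppr_lt0.
  - move=> x /andP[x1 xt]; have [x0|x0] := ltP x 0; first by rewrite out.
    by apply: psi0; rewrite x0 (le_trans xt).
  - by apply: out; rewrite oppr_lt0.
  - move=> x /andP[x1 xt]; have [x0|x0] := ltP x 0.
      apply: cvg_near_cst; near=> s.
      have s0 : s < 0 by near: s; exact: nbhs_right_lt.
      by rewrite (out x)// out.
    have [+ _] := path_cadlag psi; apply.
    by rewrite x0 (lt_le_trans xt).
  - move=> x y x1 xy yt; rewrite massE; last exact: measurable_itv.
    apply: EFin_inj; rewrite -nuE; last exact: measurable_itv.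
    have mxy : measurable (`]x, y]%classic : set RR) by exact: measurable_itv.
    rewrite nuI//; have [y0|y0] := ltP y 0.
      rewrite (_ : _ `&` _ = set0) ?charge0 ?out ?subrr//; first exact: le_lt_trans xy y0.
      apply/seteqP; split => s //=; rewrite !in_itv/= => -[/andP[_ sy] /andP[s0 _]].
      by have := le_lt_trans (le_trans s0 sy) y0; rewrite ltxx.
    have y1 : y <= 1 by exact: le_trans yt t1.
    have [x0|x0] := ltP x 0.
      rewrite (out x)// subr0 -nu_f ?y0//; congr (nu _).
      apply/seteqP; split => s /=; rewrite !in_itv/=.
        by move=> [/andP[_ ->] /andP[->]].
      by move=> /andP[s0 sy]; rewrite s0 sy (lt_le_trans x0 s0) (le_trans sy y1).
    have m0x : measurable (`[0, x]%classic : set RR) by exact: measurable_itv.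
    have m0y : measurable (`[0, y]%classic : set RR) by exact: measurable_itv.
    rewrite EFinB -(nu_f y) ?y0// -(nu_f x) ?x0 ?(le_trans xy)//.
    rewrite (_ : _ `&` _ = `[0, y] `\` `[0, x]); last first.
      apply/seteqP; split => s /=; rewrite !in_itv/=.
        move=> [/andP[xs ->] /andP[-> _]]; split => //.
        by rewrite leNgt xs.
      move=> [/andP[s0 sy]]; rewrite s0/= => /negP; rewrite -ltNge => xs.
      by rewrite xs sy (le_trans sy y1).
    rewrite chargeD// setIidr// => s /=; rewrite !in_itv/= => /andP[-> sx]/=.
    exact: le_trans xy.
have mDZ : measurable ((`]-1, t]%classic : set RR) `&` psi @^-1` [set 0]) by exact: measurableI.
have mtZ : measurable ((`[0, t]%classic : set RR) `&` psi @^-1` [set 0]).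
  by apply: measurableI => //; exact: measurable_itv.
rewrite -subr_le0 massE// => H; apply: le_trans H.
rewrite le_eqVlt; apply/orP; left; apply/eqP; apply: EFin_inj; rewrite -!nuE//.
rewrite nuI// [in RHS]nuI//; congr (nu _).
apply/seteqP; split => s /=; rewrite !in_itv/=.
  by move=> [[/andP[s0 ->] ->] ->]; rewrite (lt_le_trans _ s0)// oppr_lt0.
by move=> [[/andP[_ ->] ->] /andP[-> ->]].
Unshelve. all: by end_near. Qed.

Lemma path_le_positive_mass (psi : skorohod R) (c : components) :
  finite_variation psi -> decomposes psi c ->
  (forall t : R, 0 <= t <= 1 -> 0 <= psi t) ->
  forall t : R, 0 <= t <= 1 ->
  psi t <= signed_mass c (`[0, t] `&` [set s | 0 < psi s]).
Proof.
move=> psiBV dpsi psi0 t t01; have mpsi := skorohod_measurable psiBV.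
have [nu [nuE nuI nu_f]] := decomposes_charge dpsi.
have [t0 t1] := andP t01.
have m0t : measurable (`[0, t]%classic : set RR) by exact: measurable_itv.
have mZ : measurable ((`[0, t]%classic : set RR) `&` psi @^-1` [set 0]).
  by apply: measurableI => //; rewrite -[X in measurable X]setTI; exact: mpsi.
have mE : measurable ((`[0, t]%classic : set RR) `&` psi @^-1` `]0, +oo[).
  have mp : measurable (`]0, +oo[%classic : set RR) by exact: measurable_itv.
  by apply: measurableI => //; rewrite -[X in measurable X]setTI; exact: mpsi.
have EE : `[0, t] `&` [set s | 0 < psi s] = `[0, t] `&` psi @^-1` `]0, +oo[.
  by congr (_ `&` _); apply/seteqP; split => s /=; rewrite in_itv/= andbT.
have := zero_set_mass_le0 psiBV dpsi psi0 t01; rewrite EE => Zle.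
suff : psi t = signed_mass c (`[0, t] `&` psi @^-1` `]0, +oo[) +
    signed_mass c (`[0, t] `&` [set s | psi s = 0]) by move=> ->; rewrite gerDl.
apply: EFin_inj; rewrite EFinD -!nuE// -nu_f// -chargeU//.
- congr (nu _); rewrite -setIUr; apply/esym/setIidl => s.
  rewrite /= !in_itv/= andbT => /andP[s0 st].
  have := psi0 s; rewrite s0 (le_trans st t1) => /(_ isT).
  by rewrite le_eqVlt => /predU1P[e|h]; [right|left].
- apply/seteqP; split => s // -[[_ /=]]; rewrite in_itv/= andbT => h [_ /= e].
  by move: h; rewrite e ltxx.
Qed.

End zero_set_path.

(** * Time spent in a set as a change of clock *)

Section occupation_time.
Context {R : realType}.
Notation mu := (@lebesgue_measure R).
Notation RR := (measurableTypeR R).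
Notation I01 := (`[0%R, 1%R]%classic : set RR).
Variable E : set RR.
Hypotheses (mE : measurable E) (E01 : E `<=` I01).

(** Time spent in [E] before [t], seen as a primitive in order to inherit
    continuity and monotonicity. *)
Definition occupation (t : R) : R := prim (\1_E : R -> R) t.

Lemma indic_integrable : mu.-integrable I01 (EFin \o (\1_E : R -> R)).
Proof.
have m01 := @itv01_measurable R.
apply: measurable_bounded_integrable => //.
- by rewrite [X in (X < _)%E]lebesgue_measure_itv/= lte_fin ltr01 oppr0 adde0 ltry.
- exists 1; split => // y y1 x _; apply: le_trans (ltW y1).
  by rewrite indicE; case: (x \in E); rewrite /= ?normr1 ?normr0.
Qed.

Lemma occupationE (t : R) : 0 <= t <= 1 -> (occupation t)%:E = mu (`[0, t] `&` E).
Proof.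
move=> /andP[t0 t1]; have m0t : measurable (`[0, t]%classic : set RR) by exact: measurable_itv.
rewrite /occupation /prim /Rintegral fineK; last first.
  apply: integrable_fin_num => //; apply: (integrable_sub01 indic_integrable) => //.
  by move=> s /=; rewrite !in_itv/= => /andP[-> /le_trans]; exact.
by rewrite integral_indic// setIC.
Qed.

Lemma occupation_continuous : {within `[0, 1], continuous occupation}.
Proof. exact/prim_continuous/indic_integrable. Qed.

Lemma occupation0 : occupation 0 = 0.
Proof. exact: prim0. Qed.

Lemma occupation_nondecreasing (s t : R) : 0 <= s -> s <= t -> t <= 1 ->
  occupation s <= occupation t.
Proof.
move=> s0 st t1; apply: le_prim => //; exact: indic_integrable.
Qed.

Lemma occupation_ge0 (t : R) : 0 <= t <= 1 -> 0 <= occupation t.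
Proof. by move=> /andP[t0 t1]; rewrite -occupation0 occupation_nondecreasing. Qed.

Lemma occupation_le_id (t : R) : 0 <= t <= 1 -> occupation t <= t.
Proof.
move=> t01; have [t0 t1] := andP t01; rewrite -lee_fin occupationE//.
apply: (@le_trans _ _ (mu `[0, t]%classic)).
  have m0t : measurable (`[0, t]%classic : set RR) by exact: measurable_itv.
  apply: le_measure; rewrite ?inE//; exact: measurableI.
by rewrite lebesgue_measure_itv/= lte_fin; case: ltP => //; rewrite oppr0 adde0.
Qed.

Let L := occupation 1.
Let L0 : 0 <= L. Proof. by apply: occupation_ge0; rewrite ler01 lexx. Qed.

Lemma occupation1E : (occupation 1)%:E = mu E.
Proof. by rewrite occupationE ?ler01 ?lexx// setIidr. Qed.

Let m_occ : measurable_fun E occupation.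
Proof.
have m01 := @itv01_measurable R.
apply: (@measurable_funS _ _ _ _ I01) => //.
apply: subspace_continuous_measurable_fun; first exact: itv01_measurable.
exact: occupation_continuous.
Qed.

Let occ_ivt (y : R) : 0 <= y <= L -> exists2 t : R, 0 <= t <= 1 & occupation t = y.
Proof.
move=> /andP[y0 yL].
have [|t t01 ty] := IVT ler01 occupation_continuous (v := y).
  by rewrite occupation0 min_l// max_r// y0 yL.
by exists t => //; move: t01; rewrite in_itv.
Qed.

Let low (y : R) := E `&` [set t | occupation t <= y].

Let m_low y : measurable (low y).
Proof.
have := m_occ mE (measurable_itv `]-oo, y]); congr (measurable (_ `&` _)).
Qed.

(* Continuity of the clock makes every level y the reading of some time, and at
   that time the clock has measured y. *)
Let mu_low (y : R) : 0 <= y < L -> mu (low y) = y%:E.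
Proof.
move=> /andP[y0 yL]; apply/eqP; rewrite eq_le; apply/andP; split.
  apply/lee_addgt0Pr => e e0; rewrite -EFinD.
  pose y' := Num.min (y + e) L.
  have y'L : 0 <= y' <= L.
    by rewrite /y' le_min L0 ge_min lexx orbT (addr_ge0 y0 (ltW e0)).
  have yy' : y < y' by rewrite lt_min yL ltrDl e0.
  have [t t01 ty'] := occ_ivt y'L.
  apply: (@le_trans _ _ y'%:E); last by rewrite lee_fin ge_min lexx.
  rewrite -ty' occupationE//; apply: le_measure; rewrite ?inE//.
    by apply: measurableI => //; exact: measurable_itv.
  move=> s [Es /= sy]; split => //=; have := E01 Es; rewrite /= !in_itv/= => /andP[s0 s1].
  rewrite s0/= leNgt; apply/negP => ts.
  have t0 : 0 <= t by case/andP: t01.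
  have := le_trans (occupation_nondecreasing t0 (ltW ts) s1) sy.
  by rewrite ty' leNgt yy'.
have [|t t01 ty] := occ_ivt (y := y); first by rewrite y0 ltW.
rewrite -ty occupationE//; apply: le_measure; rewrite ?inE//.
  by apply: measurableI => //; exact: measurable_itv.
move=> s [/=]; rewrite in_itv/= => /andP[s0 st] Es; split => //=.
by apply: occupation_nondecreasing => //; case/andP: t01.
Qed.

(** Run on its own clock, the set [E] has no holes: the clock pushes Lebesgue
    measure on [E] to Lebesgue measure on an interval. *)
Lemma occupation_integral (h : RR -> \bar R) :
  measurable_fun setT h -> (forall x, 0 <= h x)%E ->
  (\int[mu]_(t in E) h (occupation t) = \int[mu]_(x in `[0%R, occupation 1]) h x)%E.
Proof.
move=> mh h0.
have mL : measurable (`[0, L]%classic : set RR) by exact: measurable_itv.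
apply: (@equimeasurable_integral R E `[0, L]%classic occupation id) => //.
  by rewrite -occupation1E ltry.
move=> y; have [y0|y0] := ltP y 0.
  rewrite (_ : E `&` _ = E); last first.
    apply/setIidl => t Et /=; apply: (lt_le_trans y0).
    by apply: occupation_ge0; have := E01 Et; rewrite /= in_itv.
  rewrite (_ : `[0, L]%classic `&` _ = `[0, L]%classic); last first.
    by apply/setIidl => t /=; rewrite in_itv/= => /andP[/(lt_le_trans y0)].
  rewrite -occupation1E -/L lebesgue_measure_itv/= lte_fin.
  case: ltP => [_|Ll0]; first by rewrite oppr0 adde0.
  by congr (_%:E); apply/eqP; rewrite eq_le Ll0 L0.
have [yL|Ly] := ltP y L; last first.
  rewrite (_ : E `&` _ = set0); last first.
    apply/seteqP; split => t // [/E01]; rewrite /= in_itv/= => /andP[t0 t1].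
    by move=> /(le_lt_trans Ly); rewrite ltNge occupation_nondecreasing.
  rewrite (_ : `[0, L]%classic `&` _ = set0) ?measure0//.
  apply/seteqP; split => t //=; rewrite in_itv/= => -[/andP[_ tL]].
  by move=> /(le_lt_trans Ly); rewrite ltNge tL.
rewrite (_ : E `&` _ = E `\` low y); last first.
  apply/seteqP; split => t /=; rewrite /low.
    by move=> [Et yt]; split => // -[_ /=]; rewrite leNgt yt.
  by move=> [Et nt]; split => //; rewrite ltNge; apply/negP => ?; apply: nt.
rewrite (_ : `[0, L]%classic `&` _ = `]y, L]%classic); last first.
  apply/seteqP; split => t /=; rewrite !in_itv/=; first by move=> [/andP[_ ->] ->].
  by move=> /andP[yt ->]; rewrite yt (le_trans y0 (ltW yt)).
rewrite lebesgue_measure_itv/= lte_fin yL.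
transitivity (mu E - mu (low y))%E; last by rewrite -occupation1E mu_low// y0.
rewrite [LHS]measureD//.
  by rewrite setIidr//; exact: subIsetl.
by rewrite [X in (X < _)%E](_ : _ = L%:E) ?ltry// -[LHS]/(mu E) -occupation1E.
Qed.

End occupation_time.

(** * Rearranging the excursions of a path *)

Section excursions.
Context {R : realType}.
Notation mu := (@lebesgue_measure R).
Notation RR := (measurableTypeR R).
Notation I01 := (`[0%R, 1%R]%classic : set RR).
Variables (psi : skorohod R) (delta : R).
Hypotheses (psiBV : finite_variation psi)
  (psi_ge0 : forall t : R, 0 <= t <= 1 -> 0 <= psi t).

Definition positivity_set : set RR := I01 `&` [set t | 0 < psi t].
Local Notation E := positivity_set.

(** The slope off the positivity set is replaced by the free slope, so that idle
    time costs nothing and is sorted among the descents. *)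
Definition excursion_density (s : R) : R := if 0 < psi s then dot_ac psi s else - delta.

Definition excursion_rearr : R -> R := rearr excursion_density.

Let mE : measurable E. Proof. exact: positivity_set_measurable. Qed.
Let E01 : E `<=` I01. Proof. exact: subIsetl. Qed.

Let aint : mu.-integrable I01 (EFin \o dot_ac psi). Proof. exact: dot_ac_integrable. Qed.

Lemma excursion_density_integrable : mu.-integrable I01 (EFin \o excursion_density).
Proof.
have m01 := @itv01_measurable R.
have h1 : mu.-integrable I01 ((EFin \o dot_ac psi) \_ E).
  apply/(integrable_restrict _ _) => //; rewrite setIidr//.
  exact: integrable_sub01.
have mD : measurable (I01 `\` E) by exact: measurableD.
have h2 : mu.-integrable I01 ((EFin \o cst (- delta)) \_ (I01 `\` E)).
  apply/(integrable_restrict _ _) => //; rewrite setIidr; last by move=> s [].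
  by apply: (integrable_sub01 (@integrable_cst_itv R 0 1 (- delta) true false) mD) => s [].
apply: eq_integrable (integrableD m01 h1 h2) => // s; rewrite inE => s01 /=.
rewrite /excursion_density !patchE; have [ps|ps] := ltP 0 (psi s).
  by rewrite mem_set//= memNset/= ?adde0// => -[_]; apply; split.
rewrite memNset/=; last by move=> [_ /=]; rewrite ltNge ps.
by rewrite mem_set/= ?add0e//; split => // -[_ /=]; rewrite ltNge ps.
Qed.

Let ddint := excursion_density_integrable.

Lemma excursion_rearr_integrable : mu.-integrable I01 (EFin \o excursion_rearr).
Proof. exact: rearr_integrable. Qed.

Lemma excursion_rearr_nonincreasing : nonincreasing01 excursion_rearr.
Proof. by move=> s s' s0 ss' s1; exact: rearr_nonincreasing. Qed.

Lemma excursion_le (t : R) : 0 <= t <= 1 ->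
  psi t <= prim excursion_rearr (occupation E t)
     + fine (up_measure (decomposition psi) (`[0, t] `&` E))
     - fine (dn_measure (decomposition psi) (`[0, t] `&` E)).
Proof.
move=> t01; have [t0 t1] := andP t01.
have sub : `[0, t]%classic `<=` I01.
  by move=> s /=; rewrite !in_itv/= => /andP[-> /le_trans]; exact.
have EE : `[0, t] `&` [set s | 0 < psi s] = `[0, t] `&` E.
  by rewrite /E setIA (setIidl sub).
have m0t : measurable (`[0, t]%classic : set RR) by exact: measurable_itv.
have mEt : measurable ((`[0, t]%classic : set RR) `&` E) by exact: measurableI.
have Et01 : (`[0, t]%classic : set RR) `&` E `<=` I01 by move=> s [/sub].
apply: (le_trans (path_le_positive_mass psiBV (decompositionP psiBV) psi_ge0 t01)).
rewrite EE /signed_mass lerD2r lerD2r setIidl//.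
rewrite (_ : \int[mu]_(s in _) _ = \int[mu]_(s in (`[0, t] `&` E)) excursion_density s).
  apply: hardy_littlewood => //.
  by rewrite occupationE.
apply: eq_Rintegral => s; rewrite inE => -[_ [_ /= ps]].
by rewrite /excursion_density ps.
Qed.

Variables (Lam : R -> \bar R).
Hypotheses (rate_ge0 : forall x, (0 <= rate Lam x)%E)
  (rate_meas : measurable_fun setT (rate Lam))
  (delta_gt0 : 0 < delta) (rate_delta : rate Lam (- delta) = 0%E).

(** Integrals of the rate are invariant under rearrangement, and the idle part
    contributes [rate (- delta) = 0]. *)
Lemma excursion_cost : objective Lam psi =
  (ac_cost Lam (up_part psi 1) excursion_rearr + theta_dn Lam * (dn_part psi 1)%:E)%E.
Proof.
rewrite (objectiveE rate_ge0 delta_gt0 rate_delta) /ac_cost addeAC; congr (_ + _ + _)%E.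
rewrite (rearr_integral ddint rate_meas rate_ge0).
apply: eq_integral => s _; rewrite /excursion_density indicE.
have [ps|ps] := ltP 0 (psi s); first by rewrite mem_set// mule1.
by rewrite memNset/= ?mule0 ?rate_delta// ltNge ps.
Qed.

End excursions.

(** * Comparison of areas *)

Section excursion_area.
Context {R : realType}.
Notation mu := (@lebesgue_measure R).
Notation RR := (measurableTypeR R).
Notation I01 := (`[0%R, 1%R]%classic : set RR).

Lemma ge0_subset_Rintegral (A B : set RR) (f : R -> R) : measurable A -> measurable B ->
  A `<=` B -> mu.-integrable B (EFin \o f) -> (forall x, B x -> 0 <= f x) ->
  \int[mu]_(x in A) f x <= \int[mu]_(x in B) f x.
Proof.
move=> mA mB AB fint f0; have fintA : mu.-integrable A (EFin \o f) by exact: integrableS fint.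
rewrite /Rintegral fine_le//; [exact: integrable_fin_num..|].
apply: ge0_subset_integral => //; exact: measurable_int fint.
Qed.

Lemma third_gap (x y v w e : R) : `|x - y| < e -> `|v - w| < e ->
  3%:R * e = v - x -> y + e <= w.
Proof. by rewrite !ltr_norml => /andP[? ?] /andP[? ?] ?; lra. Qed.

Variables (psi : skorohod R) (delta z : R).
Hypothesis psi_feas : feasible z psi.

Let psiBV : finite_variation psi. Proof. by case: psi_feas. Qed.
Let psi_ge0 (t : R) : 0 <= t <= 1 -> 0 <= psi t.
Proof. by case: psi_feas => _ + _; apply. Qed.

Local Notation E := (positivity_set psi).
Local Notation b := (excursion_rearr psi delta).
Local Notation u := (occupation E).

Let mE : measurable E. Proof. exact: positivity_set_measurable. Qed.
Let E01 : E `<=` I01. Proof. exact: subIsetl. Qed.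

(** All upward jumps are moved to the beginning and the slopes are sorted: this
    is the concave competitor of [psi]. *)
Definition excursion_path (x : R) : R := up_part psi 1 + prim b x.

Let bint : mu.-integrable I01 (EFin \o b). Proof. exact: excursion_rearr_integrable. Qed.

Let path_cont : {within `[0, 1], continuous excursion_path}.
Proof. exact: ac_affine_continuous. Qed.

Let G (t : R) : R := Num.max (excursion_path (u t)) 0.

Let u01 (t : R) : 0 <= t <= 1 -> 0 <= u t <= 1.
Proof.
move=> t01; rewrite occupation_ge0// (le_trans (occupation_le_id mE t01))//.
by case/andP: t01.
Qed.

(** The correction counts the upward singular mass that [psi] has not used yet
    at time [t], whereas the competitor has used it from the start. *)
Lemma excursion_le_path (t : R) : 0 <= t <= 1 ->
  psi t <= excursion_path (u t) - fine (up_measure (decomposition psi) `]t, 1]%classic).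
Proof.
move=> t01; have [t0 t1] := andP t01.
apply: (le_trans (excursion_le delta psiBV psi_ge0 t01)).
have m0t : measurable (`[0, t]%classic : set RR) by exact: measurable_itv.
have mt1 : measurable (`]t, 1]%classic : set RR) by exact: measurable_itv.
have mEt : measurable ((`[0, t]%classic : set RR) `&` E) by exact: measurableI.
have := fine_ge0 (measure_ge0 (dn_measure (decomposition psi)) (`[0, t] `&` E)).
have pfin S : measurable S -> up_measure (decomposition psi) S \is a fin_num.
  by move=> mS; exact: fin_num_measure.
have p1 : up_part psi 1 = fine (up_measure (decomposition psi) `[0, t]%classic) +
    fine (up_measure (decomposition psi) `]t, 1]%classic).
  rewrite /up_part -fineD ?pfin//; congr fine; rewrite -measureU//.
    by congr (up_measure _ _); rewrite -itv_bndbnd_setU// bnd_simp.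
  apply/seteqP; split => s //=; rewrite !in_itv/= => -[/andP[_ st] /andP[ts _]].
  by have := lt_le_trans ts st; rewrite ltxx.
have p2 : fine (up_measure (decomposition psi) (`[0, t] `&` E)) <=
    fine (up_measure (decomposition psi) `[0, t]%classic).
  by rewrite fine_le ?pfin//; apply: le_measure; rewrite ?inE//; exact: subIsetl.
rewrite /excursion_path; lra.
Qed.

Let psi_le_G (t : R) : 0 <= t <= 1 -> psi t <= G t.
Proof.
move=> t01; rewrite le_max; apply/orP; left; apply: (le_trans (excursion_le_path t01)).
by rewrite gerBl fine_ge0.
Qed.

(* Cut to the unit interval, where the competitor is known to be continuous. *)
Let h : RR -> \bar R := (EFin \o (fun x => Num.max (excursion_path x) 0)) \_ I01.

Let pos_int : mu.-integrable I01 (EFin \o (fun x => Num.max (excursion_path x) 0)).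
Proof. exact: continuous01_pos_integrable. Qed.

Let mh : measurable_fun setT h.
Proof. by apply/(measurable_restrictT _ (@itv01_measurable R)); exact: measurable_int pos_int. Qed.

Let h0 x : (0 <= h x)%E.
Proof. by rewrite /h patchE; case: ifP => // _; rewrite lee_fin le_max lexx orbT. Qed.

Let hG (t : R) : E t -> h (u t) = (G t)%:E.
Proof.
move=> /E01; rewrite /= in_itv/= => t01.
by rewrite /h patchE mem_set//= in_itv/= u01.
Qed.

Let L01 : 0 <= u 1 <= 1. Proof. by apply: u01; rewrite ler01 lexx. Qed.

Let int_G_le : (\int[mu]_(t in E) (G t)%:E <= (pos_area excursion_path)%:E)%E.
Proof.
have -> : (\int[mu]_(t in E) (G t)%:E = \int[mu]_(t in E) h (u t))%E.
  by apply: eq_integral => t; rewrite inE => Et; rewrite hG.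
rewrite occupation_integral// /pos_area /Rintegral fineK; last first.
  by apply: integrable_fin_num; [exact: itv01_measurable|exact: pos_int].
have mL : measurable (`[0, u 1]%classic : set RR) by exact: measurable_itv.
have sub : `[0, u 1]%classic `<=` I01.
  move=> s /=; rewrite !in_itv/= => /andP[-> sL]; apply: le_trans sL _.
  by case/andP: L01.
have -> : (\int[mu]_(x in `[0%R, u 1]) h x =
    \int[mu]_(x in `[0%R, u 1]) (Num.max (excursion_path x) 0)%:E)%E.
  by apply: eq_integral => x; rewrite inE => /sub x01; rewrite /h patchE mem_set.
apply: ge0_subset_integral => //.
- exact: measurable_int pos_int.
- by move=> x _; rewrite lee_fin le_max lexx orbT.
Qed.

Let mG : measurable_fun E (fun t => (G t)%:E : \bar R).
Proof.
apply: (@eq_measurable_fun _ _ _ _ _ (h \o u)).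
  by move=> t; rewrite inE => Et /=; rewrite hG.
apply: measurableT_comp => //.
have m01 := @itv01_measurable R.
apply: (@measurable_funS _ _ _ _ I01) => //.
apply: subspace_continuous_measurable_fun => //.
exact: occupation_continuous.
Qed.

Let G_integrable : mu.-integrable E (EFin \o G).
Proof.
apply/integrableP; split => //.
have -> : (\int[mu]_(t in E) `|(EFin \o G) t| = \int[mu]_(t in E) (G t)%:E)%E.
  by apply: eq_integral => t _ /=; rewrite ger0_norm// le_max lexx orbT.
by apply: le_lt_trans int_G_le _; rewrite ltry.
Qed.

Let psi_integrable : mu.-integrable E (EFin \o psi).
Proof.
apply: le_integrable G_integrable => //.
  apply/measurable_EFinP; apply: measurable_funTS; exact: skorohod_measurable.
move=> t /E01; rewrite /= in_itv/= => t01; rewrite lee_fin.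
by rewrite !ger0_norm ?psi_ge0 ?psi_le_G// le_max lexx orbT.
Qed.

Let int_psi : \int[mu]_(t in E) psi t = z.
Proof.
have [_ _ psi_z] := psi_feas; rewrite /Rintegral -[RHS]/(fine z%:E) -psi_z; congr fine.
rewrite [RHS](eq_integral ((EFin \o psi) \_ E)).
  rewrite -integral_mkcondr setIidr//.
move=> t; rewrite inE/= in_itv/= => t01; rewrite patchE; case: ifPn => //.
rewrite notin_setE => nE; congr (_%:E); apply/eqP; rewrite eq_le psi_ge0// andbT.
by rewrite leNgt; apply/negP => pt; apply: nE; split; rewrite //= in_itv.
Qed.

Let int_G : \int[mu]_(t in E) G t <= pos_area excursion_path.
Proof.
have Gfin : (\int[mu]_(t in E) (G t)%:E)%E \is a fin_num by exact: integrable_fin_num.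
by have := int_G_le; rewrite -(fineK Gfin) lee_fin.
Qed.

Lemma excursion_area_ge : z <= pos_area excursion_path.
Proof.
rewrite -int_psi; apply: le_trans int_G; apply: le_Rintegral => //.
by move=> t /E01; rewrite /= in_itv; exact: psi_le_G.
Qed.

Lemma excursion_path_continuous :
  {within `[0, 1], continuous (fun t : R => excursion_path (u t))}.
Proof.
apply/subspace_continuousP => t /=; rewrite in_itv/= => t01 P Pt.
have /subspace_continuousP/(_ t) := occupation_continuous mE.
rewrite /= in_itv/= => /(_ t01) uc.
have /subspace_continuousP/(_ (u t)) := path_cont.
rewrite /= in_itv/= => /(_ (u01 t01)) /(_ P Pt) pP.
have {}pP : \forall v \near u t, `[0, 1]%classic v -> P (excursion_path v) := pP.
have : \forall s \near t, `[0, 1]%classic s -> `[0, 1]%classic (u s) -> P (excursion_path (u s)).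
  exact: uc pP.
apply: filterS => s sP s01; apply: sP => //.
by move: s01; rewrite /= !in_itv; exact: u01.
Qed.

Let path_rc (t : R) : 0 <= t < 1 ->
  excursion_path (u s) @[s --> t^'+] --> excursion_path (u t).
Proof.
move=> /andP[t0 t1]; have t01 : 0 <= t <= 1 by rewrite t0 ltW.
have /subspace_continuousP/(_ t) := excursion_path_continuous.
rewrite /= in_itv/= => /(_ t01) tc P /tc tP.
have {}tP : \forall s \near t, `[0, 1]%classic s -> P (excursion_path (u s)) := tP.
have right01 : \forall s \near t^'+, 0 <= s <= 1.
  near=> s; apply/andP; split.
    by apply: (le_trans t0); apply: ltW; near: s; exact: nbhs_right_gt.
  by near: s; exact: nbhs_right_le.
have {}tP : \forall s \near t^'+, `[0, 1]%classic s -> P (excursion_path (u s)).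
  by rewrite near_withinE; apply: filterS tP => s sP _.
by apply: filterS2 right01 tP => s s01; apply; rewrite /= in_itv.
Unshelve. all: by end_near. Qed.

(** A strict gap at one time persists on a short interval to its right, by right
    continuity, and therefore shows in the integrals. *)
Lemma excursion_area_gt (t : R) : 0 <= t < 1 -> 0 < psi t ->
  psi t < excursion_path (u t) -> z < pos_area excursion_path.
Proof.
move=> t01 pt ptG; have [t0 t1] := andP t01.
pose e := (excursion_path (u t) - psi t) / 3%:R.
have e0 : 0 < e by rewrite divr_gt0// subr_gt0.
have psi_rc : psi s @[s --> t^'+] --> psi t by have [+ _] := path_cadlag psi; apply.
have : \forall s \near t^'+, [/\ E s & psi s + e <= G s].
  near=> s.
  have ps : `|psi t - psi s| < e by near: s; move/cvgrPdist_lt : psi_rc; exact.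
  have gs : `|excursion_path (u t) - excursion_path (u s)| < e.
    by near: s; move/cvgrPdist_lt : (path_rc t01); exact.
  have ts : t < s by near: s; exact: nbhs_right_gt.
  have s1 : s <= 1 by near: s; exact: nbhs_right_le.
  split; last first.
    rewrite le_max; apply/orP; left.
    apply: (third_gap ps gs).
    by rewrite /e mulrC divfK ?pnatr_eq0.
  split; rewrite /= ?in_itv/= ?s1 ?(le_trans t0 (ltW ts))//.
  by near: s; apply: (cvgr_gt _ psi_rc).
move=> [r /= r0 rP].
have E_itv (s : R) : t < s -> s < t + r -> [/\ E s & psi s + e <= G s].
  move=> ts str; apply: (rP s) => //=.
  by rewrite /ball_ /= distrC gtr0_norm ?subr_gt0// ltrBlDl.
pose W := (`]t, t + r[%classic : set RR).
have mW : measurable W by exact: measurable_itv.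
have WE : W `<=` E.
  by move=> s; rewrite /W/= in_itv/= => /andP[ts str]; have [] := E_itv s ts str.
have Gpsi_int : mu.-integrable E (EFin \o (fun s => G s - psi s)).
  by have := integrableB mE G_integrable psi_integrable; exact: eq_integrable.
apply: lt_le_trans int_G; rewrite -subr_gt0 -int_psi -RintegralB//.
apply: (@lt_le_trans _ _ (\int[mu]_(s in W) e)).
  by rewrite Rintegral_cst_itv ?lerDl ?(ltW r0)// addrAC subrr add0r mulr_gt0.
apply: (@le_trans _ _ (\int[mu]_(s in W) (G s - psi s))).
  apply: le_Rintegral => //.
  - exact: integrable_cst_itv.
  - exact: integrableS Gpsi_int.
  - move=> s; rewrite /W/= in_itv/= => /andP[ts str].
    by have [_] := E_itv s ts str; lra.
apply: ge0_subset_Rintegral => // s /E01; rewrite /= in_itv/= => s01.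
by rewrite subr_ge0 psi_le_G.
Unshelve. all: by end_near. Qed.

End excursion_area.

(** * Area and the Skorohod topology *)

Section shift.
Context {R : realType}.
Notation mu := (@lebesgue_measure R).
Notation RR := (measurableTypeR R).
Notation I01 := (`[0%R, 1%R]%classic : set RR).

Lemma integral_shift (h : RR -> \bar R) (e : R) : measurable_fun setT h ->
  (forall x, 0 <= h x)%E ->
  (\int[mu]_(s in I01) h (s + e)%R = \int[mu]_(s in `[e, (1 + e)%R]) h s)%E.
Proof.
move=> mh h0; have m01 := @itv01_measurable R.
have m2 : measurable (`[e, (1 + e)%R]%classic : set RR) by exact: measurable_itv.
apply: (@equimeasurable_integral R I01 `[e, 1 + e]%classic (fun s => s + e) id) => //.
- by apply: measurable_funTS; exact: measurable_funD.
- by rewrite lebesgue_measure_itv/= lte_fin ltr01 oppr0 adde0 ltry.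
- move=> y.
  have itvE (a c : R) : a <= c ->
      `[a, c]%classic `&` [set x | y < x] = if y < a then `[a, c]%classic else `]y, c]%classic.
    move=> ac; case: ltP => ya; apply/seteqP; split => x /=; rewrite !in_itv/=.
    + by move=> [].
    + by move=> /andP[ax xc]; split; [rewrite ax xc|exact: lt_le_trans ax].
    + by move=> [/andP[_ ->] ->].
    + by move=> /andP[yx ->]; rewrite yx (le_trans ya (ltW yx)).
  have -> : I01 `&` [set x | y < x + e] =
      if y - e < 0 then `[0, 1]%classic else `]y - e, 1]%classic.
    case: ltP => ye; apply/seteqP; split => x /=; rewrite !in_itv/=.
    + by move=> [].
    + by move=> /andP[x0 x1]; split; [rewrite x0 x1|lra].
    + by move=> [/andP[_ ->] yx]; rewrite andbT; lra.
    + by move=> /andP[yx ->]; split; [rewrite andbT|]; lra.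
  rewrite itvE ?lerDr// subr_lt0; case: ltP => ye.
    rewrite !lebesgue_measure_itv/= !lte_fin ltr01 ltrDr ltr01 oppr0 adde0.
    by rewrite -EFinB addrK.
  rewrite !lebesgue_measure_itv/= !lte_fin ltrBlDr.
  by case: ifP => // _; rewrite -!EFinB; congr (_%:E); ring.
Qed.

(** After a change of variables the two integrals cancel except on strips of
    width [2 e] at both ends. *)
Lemma monotone_shift_integral (W : R -> R) (M e : R) : nondecreasing_fun W ->
  (forall s, 0 <= W s <= M) -> 0 < e -> e < 2^-1 ->
  \int[mu]_(s in I01) (W (s + e) - W (s - e)) <= 2 * e * M.
Proof.
move=> Wnd WM e0 e2.
have mW : measurable_fun setT (W : RR -> RR) by exact: nondecreasing_measurable.
have WE0 s : (0 <= (W s)%:E)%E by rewrite lee_fin; case/andP: (WM s).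
have bint (g : RR -> RR) x y b0 b1 : measurable_fun setT g -> (forall s, 0 <= g s <= M) ->
    mu.-integrable [set` Interval (BSide b0 x) (BSide b1 y)] (EFin \o g).
  move=> mg gM; apply: measurable_bounded_integrable => //.
  - by rewrite [X in (X < _)%E]lebesgue_measure_itv/=; case: ifP => _; exact: ltry.
  - exact: measurable_funTS.
  - exists M; split; [exact: num_real|move=> k Mk s _].
    case/andP: (gM s) => g0 gM'; apply: le_trans (ltW Mk).
    by rewrite /= ger0_norm.
have shiftR (d : R) : \int[mu]_(s in I01) W (s + d) = \int[mu]_(s in `[d, 1 + d]) W s.
  congr fine; apply: (@integral_shift (EFin \o W)) => //.
  exact/measurable_EFinP.
have mWd d : measurable_fun setT (fun s : RR => W (s + d) : RR).
  by apply: (@measurableT_comp _ _ _ _ _ _ W) => //; exact: measurable_funD.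
rewrite RintegralB//; last 2 first.
  exact: bint.
  exact: bint.
rewrite !shiftR.
have -> : \int[mu]_(s in `[e, 1 + e]) W s =
    \int[mu]_(s in `[e, 1 - e]) W s + \int[mu]_(s in `]1 - e, 1 + e]) W s.
  rewrite -Rintegral_setU//.
  - by rewrite -itv_bndbnd_setU// bnd_simp; lra.
  - by rewrite -itv_bndbnd_setU ?bnd_simp; [exact: bint|lra|lra].
  - apply/disj_setPS => s /=; rewrite !in_itv/= => -[/andP[_ s1] /andP[s2 _]].
    by have := lt_le_trans s2 s1; rewrite ltxx.
have h1 : \int[mu]_(s in `[e, 1 - e]) W s <= \int[mu]_(s in `[- e, 1 - e]) W s.
  apply: ge0_subset_Rintegral => //.
  - move=> s /=; rewrite !in_itv/= => /andP[es ->]; rewrite andbT; lra.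
  - exact: bint.
  - by move=> s _; case/andP: (WM s).
have h2 : \int[mu]_(s in `]1 - e, 1 + e]) W s <= M * (1 + e - (1 - e)).
  rewrite -(@Rintegral_cst_itv R (1 - e) (1 + e) M false false); last by lra.
  apply: le_Rintegral => //; first exact: bint.
    exact: integrable_cst_itv.
  by move=> s _; case/andP: (WM s).
apply: (@le_trans _ _ (M * (1 + e - (1 - e)))); last first.
  by rewrite le_eqVlt; apply/orP; left; apply/eqP; ring.
rewrite lerBlDr addrC; exact: lerD.
Qed.

(** A time change of size [e] moves the value of [phi] at time [s] by at most the
    increment of its variation between [s - e] and [s + e], and such increments
    have an integral of order [e]. *)
Lemma J1_pos_area (phi f : skorohod R) (e : R) : finite_variation phi ->
  mu.-integrable I01 (EFin \o (fun t => Num.max (f t) 0)) ->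
  0 < e -> e < 2^-1 -> J1_ball phi e f ->
  pos_area f <= pos_area phi + e * (2 * fine (total_variation 0 1 phi) + 1).
Proof.
move=> phiBV fint e0 e2 [l [[[lfun linj lsurj] lhomo] lP]].
(* Extends the variation function monotonically to the line. *)
pose clamp (t : R) : R := Num.max 0 (Num.min t 1).
have clamp01 t : 0 <= clamp t <= 1.
  by rewrite le_max lexx/= ge_max ler01 ge_min lexx orbT.
have clamp_nd s t : s <= t -> clamp s <= clamp t.
  move=> st; rewrite ge_max !le_max lexx/=; apply/orP; right.
  by rewrite le_min !ge_min st lexx orbT.
have clampE (t : R) : 0 <= t <= 1 -> clamp t = t.
  by move=> /andP[t0 t1]; rewrite /clamp min_l// max_r.
pose V t := fine (total_variation 0 t phi).
have Vfin t : 0 <= t <= 1 -> total_variation 0 t phi \is a fin_num.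
  move=> /andP[t0 t1]; apply/bounded_variationP => //.
  exact: bounded_variationl t0 t1 phiBV.
have V_inc s t : 0 <= s -> s <= t -> t <= 1 -> `|phi t - phi s| <= V t - V s.
  move=> s0 st t1; rewrite -lee_fin; apply: (le_trans (total_variation_ge phi st)).
  have s01 : 0 <= s <= 1 by rewrite s0 (le_trans st).
  have t01 : 0 <= t <= 1 by rewrite t1 (le_trans s0).
  have := total_variationD phi s0 st.
  rewrite /V EFinB !fineK ?Vfin// => ->.
  by rewrite addeAC subee ?Vfin// add0e.
pose W t := V (clamp t).
have Wnd : nondecreasing_fun W.
  move=> s t st; rewrite -subr_ge0 /W; apply: le_trans (V_inc _ _ _ (clamp_nd _ _ st) _) => //.
    by case/andP: (clamp01 s).
  by case/andP: (clamp01 t).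
have W01 s : 0 <= W s <= V 1.
  apply/andP; split.
    by rewrite fine_ge0// total_variation_ge0//; case/andP: (clamp01 s).
  rewrite -subr_ge0 /W; case/andP: (clamp01 s) => c0 c1.
  by apply: le_trans (V_inc _ _ c0 c1 _).
have key (s : R) : 0 <= s <= 1 ->
    Num.max (f s) 0 <= Num.max (phi s) 0 + (W (s + e) - W (s - e)) + e.
  move=> s01; have /lsurj[t /= t01 lt_] : `[0, 1]%classic s by rewrite /= in_itv.
  move: t01; rewrite in_itv/= => t01.
  have [lt1 lt2] := lP t t01; move: lt1 lt2; rewrite lt_ => lt1 lt2.
  have fs : f s <= phi t + e by move: lt2; rewrite ltr_norml => /andP[]; lra.
  have inc (x y : R) : 0 <= x <= 1 -> 0 <= y <= 1 -> s - e <= x -> x <= y -> y <= s + e ->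
      `|phi y - phi x| <= W (s + e) - W (s - e).
    move=> x01 y01 sx xy ys; have [x0 x1] := andP x01; have [y0 y1] := andP y01.
    apply: (le_trans (V_inc _ _ x0 xy y1)).
    have := Wnd _ _ sx; have := Wnd _ _ ys; rewrite /W (clampE x)// (clampE y)//.
    lra.
  have [st1 st2] : s - e <= t /\ t <= s + e.
    by move: lt1; rewrite ltr_norml => /andP[]; split; lra.
  have pt : phi t <= phi s + (W (s + e) - W (s - e)).
    have [st|/ltW ts] := leP s t.
      by have := inc s t s01 t01 _ st st2; have := ler_norm (phi t - phi s); rewrite gerBl (ltW e0) => ? /(_ isT); lra.
    have := inc t s t01 s01 st1 ts; rewrite lerDl (ltW e0) => /(_ isT).
    by have := ler_norm (phi t - phi s); rewrite distrC; lra.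
  have W0 : 0 <= W (s + e) - W (s - e) by rewrite subr_ge0 Wnd//; lra.
  have m1 : phi s <= Num.max (phi s) 0 by rewrite le_max lexx.
  have m0 : 0 <= Num.max (phi s) 0 by rewrite le_max lexx orbT.
  by rewrite ge_max; apply/andP; split; lra.
have m01 := @itv01_measurable R.
have mW (d : R) : measurable_fun setT (fun s : RR => W (s + d) : RR).
  apply: (@measurableT_comp _ _ _ _ _ _ W) => //; last exact: measurable_funD.
  exact: nondecreasing_measurable.
have bint (g : R -> R) M : measurable_fun I01 g -> (forall s : R, 0 <= s <= 1 -> `|g s| <= M) ->
    mu.-integrable I01 (EFin \o g).
  move=> mg gM; apply: measurable_bounded_integrable => //.
  - by rewrite [X in (X < _)%E]lebesgue_measure_itv/= lte_fin ltr01 oppr0 adde0 ltry.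
  - exists M; split; [exact: num_real|move=> k Mk s /=]; rewrite in_itv/= => s01.
    by apply: le_trans (gM s s01) (ltW Mk).
have iW : mu.-integrable I01 (EFin \o (fun s => W (s + e) - W (s - e))).
  apply: (bint _ (V 1)); first exact: measurable_funTS (measurable_funB (mW e) (mW (- e))).
  move=> s _; rewrite ger0_norm ?subr_ge0 ?Wnd//; last by lra.
  by case/andP: (W01 (s + e)); case/andP: (W01 (s - e)); lra.
have iphi : mu.-integrable I01 (EFin \o (fun s => Num.max (phi s) 0)).
  have phib s : 0 <= s <= 1 -> `|phi s| <= `|phi 0| + V 1.
    move=> /andP[s0 s1]; have := V_inc 0 s (lexx 0) s0 s1; have := V_inc s 1 s0 s1 (lexx 1).
    have := normr_ge0 (phi 1 - phi s).
    have : 0 <= V 0 by rewrite fine_ge0// total_variation_ge0.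
    have := ler_normD (phi s - phi 0) (phi 0); rewrite subrK; lra.
  have mphi := bounded_variation_measurable phiBV.
  have := integrable_funrpos m01 (bint _ _ mphi phib).
  by apply: eq_integrable => // s _.
have ie : mu.-integrable I01 (EFin \o cst e) by exact: integrable_cst_itv.
rewrite /pos_area; apply: (@le_trans _ _ (\int[mu]_(s in I01)
    (Num.max (phi s) 0 + (W (s + e) - W (s - e)) + e))).
  apply: le_Rintegral => //.
    by have := integrableD m01 (integrableD m01 iphi iW) ie; exact: eq_integrable.
rewrite RintegralD//; last first.
  by have := integrableD m01 iphi iW; exact: eq_integrable.
rewrite RintegralD// (@Rintegral_cst_itv R 0 1 e true false ler01).
have := monotone_shift_integral Wnd W01 e0 e2.
rewrite -/(V 1); lra.
Qed.

End shift.

(** * Existence of an optimal path *)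

Section existence.
Context {R : realType}.
Notation mu := (@lebesgue_measure R).
Notation RR := (measurableTypeR R).
Notation I01 := (`[0%R, 1%R]%classic : set RR).
Variables (Lam : R -> \bar R) (delta : R).
Hypotheses (rate_ge0 : forall x, (0 <= rate Lam x)%E)
  (rate_meas : measurable_fun setT (rate Lam))
  (rate_convex : convex_ereal (rate Lam))
  (delta_gt0 : 0 < delta) (rate_delta : rate Lam (- delta) = 0%E)
  (thdn_ge0 : (0 <= theta_dn Lam)%E)
  (thup_ge0 : (0 <= theta_up Lam)%E).

Lemma up_part_ge0 (psi : skorohod R) : 0 <= up_part psi 1.
Proof. exact: fine_ge0. Qed.

Lemma dn_part_ge0 (psi : skorohod R) : 0 <= dn_part psi 1.
Proof. exact: fine_ge0. Qed.

Lemma ac_cost_ge0 (c : R) (a : R -> R) : 0 <= c -> (0 <= ac_cost Lam c a)%E.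
Proof.
move=> c0; apply: adde_ge0; first by apply: integral_ge0 => s _; exact: rate_ge0.
by rewrite mule_ge0// lee_fin.
Qed.

Lemma excursion_ac_cost_le (psi : skorohod R) : finite_variation psi ->
  (ac_cost Lam (up_part psi 1) (excursion_rearr psi delta) <= objective Lam psi)%E.
Proof.
move=> psiBV; rewrite (excursion_cost psiBV rate_ge0 rate_meas delta_gt0 rate_delta).
by rewrite leeDl// mule_ge0// lee_fin dn_part_ge0.
Qed.

Lemma objective_ge0 (psi : skorohod R) : finite_variation psi ->
  (0 <= objective Lam psi)%E.
Proof.
move=> psiBV; apply: le_trans (excursion_ac_cost_le psiBV).
exact/ac_cost_ge0/up_part_ge0.
Qed.

(** The constant profile [z] has exactly area [z]. *)
Lemma feasible_exists (z : R) : 0 < z -> exists psi : skorohod R, feasible z psi.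
Proof.
move=> z0; have z0' := ltW z0.
have iz : mu.-integrable I01 (EFin \o cst 0) by exact: integrable_cst_itv.
have za : z <= pos_area (fun t : R => z + prim (cst 0) t).
  rewrite /pos_area (@eq_Rintegral _ _ _ mu _ (cst z)).
    by rewrite (@Rintegral_cst_itv R 0 1 z true false)// subr0 mulr1.
  move=> t; rewrite inE/= in_itv/= => /andP[t0 _].
  by rewrite /prim Rintegral_cst_itv// mul0r addr0 max_l.
have [psi [l [? _ _ _]]] := @feasible_of_concave R Lam delta rate_ge0 rate_meas rate_convex
  delta_gt0 rate_delta thup_ge0 (NngNum z0') _ z iz (fun _ _ _ _ _ => lexx 0) z0 za.
by exists psi.
Qed.

(** The comparison made for excursions, with the identity as clock: up to any
    time, sorting the slopes and jumping first can only raise the path. *)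
Lemma rearranged_path (phi : skorohod R) : finite_variation phi ->
  pos_area phi <= pos_area (fun t => up_part phi 1 + prim (rearr (dot_ac phi)) t).
Proof.
move=> phiBV; have aint := dot_ac_integrable phiBV.
have m01 := @itv01_measurable R.
have mphi : measurable_fun I01 phi by exact: bounded_variation_measurable.
have bint := rearr_integrable aint.
have le_path (t : R) : 0 <= t <= 1 ->
    phi t <= up_part phi 1 + prim (rearr (dot_ac phi)) t.
  move=> t01; have [t0 t1] := andP t01.
  have m0t : measurable (`[0, t]%classic : set RR) by exact: measurable_itv.
  have m0 : measurable (`[0, 1]%classic : set RR) by exact: measurable_itv.
  have [_ /(_ t t01) -> _] := decompositionP phiBV.
  have h1 : \int[mu]_(s in `[0, t]) dot_ac phi s <= prim (rearr (dot_ac phi)) t.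
    apply: (hardy_littlewood aint) => //.
      by move=> s /=; rewrite !in_itv/= => /andP[-> /le_trans]; exact.
    have := @lebesgue_measure_itv R `[0, t]; rewrite /= lte_fin => ->.
    by case: ltP => t0'; rewrite ?oppr0 ?adde0//; congr (_%:E); lra.
  have h2 : fine (up_measure (decomposition phi) `[0, t]%classic) <= up_part phi 1.
    rewrite /up_part fine_le ?fin_num_measure//.
    apply: le_measure; rewrite ?inE// => s /=.
    by rewrite !in_itv/= => /andP[-> /le_trans]; exact.
  have h3 := fine_ge0 (measure_ge0 (dn_measure (decomposition phi)) `[0, t]%classic).
  by rewrite -/(dot_ac phi); lra.
have path_int : mu.-integrable I01
    (EFin \o (fun t => Num.max (up_part phi 1 + prim (rearr (dot_ac phi)) t) 0)).
  by apply: continuous01_pos_integrable; exact: ac_affine_continuous.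
have maxle (t : R) : 0 <= t <= 1 -> Num.max (phi t) 0 <=
    Num.max (up_part phi 1 + prim (rearr (dot_ac phi)) t) 0.
  by move=> t01; rewrite ge_max !le_max lexx le_path// orbT.
apply: le_Rintegral => //.
apply: le_integrable path_int => //.
  by apply/measurable_EFinP; exact: measurable_funrpos.
move=> t /=; rewrite in_itv/= => t01; rewrite lee_fin !ger0_norm ?le_max ?lexx ?orbT//.
by rewrite -le_max; exact: maxle.
Qed.

Lemma rearranged_cost (phi : skorohod R) : finite_variation phi ->
  (ac_cost Lam (up_part phi 1) (rearr (dot_ac phi)) <= path_rate Lam phi)%E.
Proof.
move=> phiBV; rewrite /path_rate asboolT// /ac_cost.
rewrite (rearr_integral (dot_ac_integrable phiBV) rate_meas rate_ge0) leeD2r//.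
by rewrite leeDl// mule_ge0// lee_fin dn_part_ge0.
Qed.

Hypothesis path_rate_good : good_rate_function (path_rate Lam).

Lemma optimal_exists (z : R) : 0 < z -> exists psi, optimal Lam z psi.
Proof.
move=> z0; have [psi0 psi0f] := feasible_exists z0.
set m := ereal_inf (objective Lam @` feasible z).
have mle psi : feasible z psi -> (m <= objective Lam psi)%E.
  by move=> psif; apply: ereal_inf_lbound; exists psi.
have [moo|moo] := eqVneq m +oo%E.
  exists psi0; split => // phi /mle; rewrite moo leye_eq => /eqP ->; exact: leey.
have m0 : (0 <= m)%E.
  by apply: le_ereal_inf_tmp => _ [psi [psiBV _ _] <-]; exact: objective_ge0.
have mfin : m \is a fin_num by rewrite ge0_fin_numE// ltey.
have near_opt (n : nat) : exists psi, feasible z psi /\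
    (objective Lam psi <= m + (n.+1%:R^-1)%:E)%E.
  have [|_ [psi psif <-] /ltW psim] := lb_ereal_inf_adherent (_ : 0 < n.+1%:R^-1) mfin.
    by [].
  by exists psi.
have /choice[psi_ psiP] := near_opt.
have psiBV n : finite_variation (psi_ n) by have [[]] := psiP n.
(* The minimizing paths themselves may have a larger path rate than objective,
   since idling has a path rate: compactness applies to their competitors. *)
pose f n := ac_path (up_part (psi_ n) 1) (excursion_rearr_integrable delta (psiBV n)).
have f_rate n : (path_rate Lam (f n) <= m + (n.+1%:R^-1)%:E)%E.
  have := @path_rate_ac R Lam rate_meas (NngNum (up_part_ge0 (psi_ n))) _
    (excursion_rearr_integrable delta (psiBV n)).
  rewrite /= -/(f n) => ->; have [_] := psiP n; apply: le_trans.
  exact: excursion_ac_cost_le.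
have f_area n : z <= pos_area (f n).
  have [psif _] := psiP n; apply: (le_trans (excursion_area_ge delta psif)).
  rewrite le_eqVlt; apply/orP; left; apply/eqP; apply: eq_Rintegral => t.
  by rewrite inE/= in_itv/= => t01; rewrite ac_funE.
have f_int n : mu.-integrable I01 (EFin \o (fun t => Num.max (f n t) 0)).
  have := continuous01_pos_integrable (@ac_affine_continuous R (up_part (psi_ n) 1) _
    (excursion_rearr_integrable delta (psiBV n))).
  by apply: eq_integrable => // t; rewrite inE/= in_itv/= => t01; rewrite ac_funE.
have [_ rate_lsc rate_cpt] := path_rate_good.
have {}rate_cpt := rate_cpt (fine m + 1).
have [|phi [_ phi_cl]] := rate_cpt (f @ \oo) _.
  exists 0%N => // n _; rewrite /=; apply: (le_trans (f_rate n)).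
  rewrite EFinD fineK// leeD2l// lee_fin.
  by rewrite invf_le1// ler1n.
have phi_rate : (path_rate Lam phi <= m)%E.
  rewrite leNgt; apply/negP => mphi.
  have [a /andP[ma aphi]] : exists a : R, (m < a%:E < path_rate Lam phi)%E.
    move: mphi; rewrite -(fineK mfin); case: (path_rate Lam phi) => [r| |].
    - by rewrite lte_fin => mr; exists ((fine m + r) / 2);
        rewrite !lte_fin; apply/andP; split; lra.
    - by move=> _; exists (fine m + 1); rewrite lte_fin ltrDl ltr01 ltry.
    - by rewrite ltNge leNye.
  have [V phiV VP] := rate_lsc phi a aphi.
  have Fa : (f @ \oo) [set g | (path_rate Lam g <= a%:E)%E].
    have am : 0 < a - fine m by move: ma; rewrite -(fineK mfin) lte_fin subr_gt0.
    have := near_infty_natSinv_lt (PosNum am); rewrite /=; apply: filterS => n /ltW na.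
    by apply: (le_trans (f_rate n)); rewrite -(fineK mfin) lee_fin -lerBrDl.
  have [g [/= ga /VP]] := phi_cl _ _ Fa phiV.
  by rewrite ltNge ga.
have phiBV : finite_variation phi.
  move: phi_rate; rewrite /path_rate; case: asboolP => // _.
  by rewrite leye_eq (negbTE moo).
have phi_area : z <= pos_area phi.
  rewrite leNgt; apply/negP => phiz.
  set K := 2 * fine (total_variation 0 1 phi) + 1.
  have K0 : 0 < K.
    by rewrite /K ltr_wpDl// mulr_ge0// fine_ge0// total_variation_ge0.
  pose e := Num.min (3^-1) ((z - pos_area phi) / (2 * K)).
  have e0 : 0 < e by rewrite lt_min invr_gt0 divr_gt0 ?subr_gt0 ?mulr_gt0 ?ltr0n.
  have e2 : e < 2^-1 by rewrite gt_min; apply/orP; left; lra.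
  have : (range f `&` ball phi e) !=set0.
    by apply: phi_cl; [exists 0%N => // n _; exists n|exact: nbhsx_ballx].
  move=> [_ [[n _ <-] fn]]; have := J1_pos_area phiBV (f_int n) e0 e2 fn.
  rewrite -/K; have : e * K <= (z - pos_area phi) / 2.
    have : e <= (z - pos_area phi) / (2 * K) by rewrite ge_min lexx orbT.
    rewrite -(ler_pM2r K0) => /le_trans; apply.
    by rewrite le_eqVlt; apply/orP; left; apply/eqP; field; rewrite gt_eqF.
  have := f_area n; lra.
have aint := dot_ac_integrable phiBV.
have [psi [l [psif l01 psil _]]] := @feasible_of_concave R Lam delta rate_ge0 rate_meas rate_convex
  delta_gt0 rate_delta thup_ge0 (NngNum (up_part_ge0 phi)) _ z (rearr_integrable aint)
  (rearr_nonincreasing aint) z0 (le_trans phi_area (rearranged_path phiBV)).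
have [l0 l1] := andP l01.
exists psi; split => // phi' /mle; apply: le_trans.
apply: (le_trans psil); apply: le_trans phi_rate; apply: le_trans (rearranged_cost phiBV).
by rewrite gee_pMl ?ac_cost_ge0//= ?up_part_ge0.
Qed.

End existence.

(** * Structure of the optimal paths *)

Section one_sided_limits_and_chords.
Context {R : realType}.

Lemma right_limit_eq (f g : R -> R) (a b lf lg : R) : a < b ->
  (forall s, a < s < b -> f s = g s) ->
  f s @[s --> a^'+] --> lf -> g s @[s --> a^'+] --> lg -> lf = lg.
Proof.
move=> ab fg flf glg; have glf : g s @[s --> a^'+] --> lf.
  apply: cvg_trans flf; apply: near_eq_cvg; near=> s; apply: fg; apply/andP; split.
    by near: s; exact: nbhs_right_gt.
  by near: s; exact: nbhs_right_lt.
exact: cvg_unique glf glg.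
Unshelve. all: by end_near. Qed.

Lemma left_limit_eq (f g : R -> R) (a b lf lg : R) : a < b ->
  (forall s, a < s < b -> f s = g s) ->
  f s @[s --> b^'-] --> lf -> g s @[s --> b^'-] --> lg -> lf = lg.
Proof.
move=> ab fg flf glg; have glf : g s @[s --> b^'-] --> lf.
  apply: cvg_trans flf; apply: near_eq_cvg; near=> s; apply: fg; apply/andP; split.
    by near: s; exact: nbhs_left_gt.
  by near: s; exact: nbhs_left_lt.
exact: cvg_unique glf glg.
Unshelve. all: by end_near. Qed.

Lemma chord_concave_on (T0 T1 : R) (f : R -> R) :
  (forall x y w : R, T0 <= x -> x <= y -> y <= w -> w <= T1 ->
    (w - y) * f x + (y - x) * f w <= (w - x) * f y) ->
  concave_on `[T0, T1] f.
Proof.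
move=> fchord.
have chord (x w s : R) : T0 <= x -> x < w -> w <= T1 -> 0 <= s -> s <= 1 ->
    s * f x + (1 - s) * f w <= f (s * x + (1 - s) * w).
  move=> x0 xw w1 s0 s1; rewrite -(ler_pM2l (_ : 0 < w - x)) ?subr_gt0//.
  have xw0 : 0 <= w - x by rewrite subr_ge0 ltW.
  have := fchord x (s * x + (1 - s) * w) w x0 _ _ w1.
  have -> : s * x + (1 - s) * w - x = (1 - s) * (w - x) by ring.
  have -> : w - (s * x + (1 - s) * w) = s * (w - x) by ring.
  have -> : (w - x) * (s * f x + (1 - s) * f w) =
    s * (w - x) * f x + (1 - s) * (w - x) * f w by ring.
  apply.
  - rewrite -subr_ge0 (_ : _ - x = (1 - s) * (w - x)); last by ring.
    by rewrite mulr_ge0// subr_ge0.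
  - rewrite -subr_ge0 (_ : w - _ = s * (w - x)); last by ring.
    by rewrite mulr_ge0.
move=> t x y /[!inE] /= /[!in_itv] /= /andP[x0 x1] /andP[y0 y1].
have t0 : 0 <= t%:inum :> R by [].
have t1 : t%:inum <= 1 :> R by [].
change (- f (t%:inum * x + (1 - t%:inum) * y) <=
  t%:inum * (- f x) + (1 - t%:inum) * (- f y)).
rewrite !mulrN -opprD lerN2.
have [xy|yx|xy] := ltgtP x y.
- exact: chord.
- have := chord y x (1 - t%:inum) y0 yx x1.
  rewrite subr_ge0 lerBlDr lerDl (_ : 1 - (1 - t%:inum) = t%:inum); last by ring.
  by move=> /(_ t1 t0); rewrite (addrC (_ * f y)) (addrC (_ * y)).
- rewrite xy (_ : t%:inum * y + _ = y); last by ring.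
  by rewrite le_eqVlt; apply/orP; left; apply/eqP; ring.
Qed.

End one_sided_limits_and_chords.

Section structure.
Context {R : realType}.
Notation mu := (@lebesgue_measure R).
Notation RR := (measurableTypeR R).
Notation I01 := (`[0%R, 1%R]%classic : set RR).
Variables (Lam : R -> \bar R) (delta z : R) (psi : skorohod R).
Hypotheses (rate_ge0 : forall x, (0 <= rate Lam x)%E)
  (rate_meas : measurable_fun setT (rate Lam))
  (rate_convex : convex_ereal (rate Lam))
  (delta_gt0 : 0 < delta) (rate_delta : rate Lam (- delta) = 0%E)
  (thdn_gt0 : (0 < theta_dn Lam)%E)
  (thup_ge0 : (0 <= theta_up Lam)%E)
  (z_gt0 : 0 < z) (psi_opt : optimal Lam z psi)
  (cost_fin : (0 < objective Lam psi < +oo)%E).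

Let psi_feas : feasible z psi. Proof. by case: psi_opt. Qed.
Let psiBV : finite_variation psi. Proof. by case: psi_feas. Qed.
Let psi_ge0 (t : R) : 0 <= t <= 1 -> 0 <= psi t.
Proof. by case: psi_feas => _ + _; apply. Qed.

Local Notation E := (positivity_set psi).
Local Notation u := (occupation E).
Local Notation path := (excursion_path psi delta).

Let mE : measurable E. Proof. exact: positivity_set_measurable. Qed.
Let E01 : E `<=` I01. Proof. exact: subIsetl. Qed.

Let C := ac_cost Lam (up_part psi 1) (excursion_rearr psi delta).

(** The competitor yields a feasible path of cost at most [l C], while
    [C <= objective psi]; optimality with a positive finite cost leaves only
    [l = 1] and no downward singular cost. *)
Lemma optimal_tight : dn_part psi 1 = 0 /\ pos_area path = z.
Proof.
have [J0 Joo] := andP cost_fin; have [_ psi_min] := psi_opt.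
have JE := excursion_cost psiBV rate_ge0 rate_meas delta_gt0 rate_delta.
rewrite -/C in JE.
have C0 : (0 <= C)%E by exact/(ac_cost_ge0 rate_ge0 thup_ge0)/up_part_ge0.
have CJ : (C <= objective Lam psi)%E.
  exact: (excursion_ac_cost_le rate_ge0 rate_meas delta_gt0 rate_delta (ltW thdn_gt0)).
have Cfin : C \is a fin_num by rewrite ge0_fin_numE// (le_lt_trans CJ).
have [phi [l [phif /andP[l0 l1] phil lz]]] := @feasible_of_concave R Lam delta rate_ge0 rate_meas
  rate_convex delta_gt0 rate_delta thup_ge0 (NngNum (up_part_ge0 psi)) _ z
  (excursion_rearr_integrable delta psiBV) (excursion_rearr_nonincreasing delta psiBV) z_gt0
  (excursion_area_ge delta psi_feas).
have Jl : (objective Lam psi <= l%:E * C)%E by exact: le_trans (psi_min _ phif) phil.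
have lC : (l%:E * C <= C)%E by rewrite gee_pMl.
have JC : objective Lam psi = C by apply/eqP; rewrite eq_le CJ (le_trans Jl lC).
split.
  apply/eqP; rewrite eq_le dn_part_ge0 andbT leNgt; apply/negP => q0.
  have : (0 < theta_dn Lam * (dn_part psi 1)%:E)%E by rewrite mule_gt0// lte_fin.
  by rewrite -(lteDl _ Cfin) -JE JC ltxx.
apply: lz; apply/eqP; rewrite eq_le l1/= -lee_fin.
have C0' : (0 < C)%E by rewrite -JC.
rewrite -(@lee_pmul2r _ C)// mul1e -{1}JC.
exact: Jl.
Qed.

Let dn_part0 : dn_part psi 1 = 0. Proof. by case: optimal_tight. Qed.

(** A strict inequality at one time would give the competitor more than area
    [z]. *)
Lemma optimal_path (t : R) : 0 <= t < 1 -> 0 < psi t ->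
  psi t = path (u t) /\ fine (up_measure (decomposition psi) `]t, 1]%classic) = 0.
Proof.
move=> t01 pt; have [t0 t1] := andP t01.
have [_ area_z] := optimal_tight.
have t01' : 0 <= t <= 1 by rewrite t0 ltW.
have p0 := fine_ge0 (measure_ge0 (up_measure (decomposition psi)) `]t, 1]%classic).
have le_path := excursion_le_path delta psi_feas t01'.
have ge_path : path (u t) <= psi t.
  rewrite leNgt; apply/negP => lt_path.
  by have := excursion_area_gt psi_feas t01 pt lt_path; rewrite area_z ltxx.
by split; lra.
Qed.

(** After a time of positivity no singular mass is left, upward or downward. *)
Lemma optimal_increment (t s : R) : 0 <= t < 1 -> 0 < psi t -> t <= s <= 1 ->
  psi s = psi t - prim (dot_ac psi) t + prim (dot_ac psi) s.
Proof.
move=> t01 pt /andP[ts s1]; have [t0 t1] := andP t01.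
have [_ pt1] := optimal_path t01 pt.
have s01 : 0 <= s <= 1 by rewrite s1 (le_trans t0).
have t01' : 0 <= t <= 1 by rewrite t0 ltW.
have [_ psiE _] := decompositionP psiBV.
rewrite (psiE s s01) (psiE t t01').
have pfin (m : {finite_measure set RR -> \bar R}) (S : set RR) : measurable S ->
  m S \is a fin_num by move=> mS; exact: fin_num_measure.
have q0 (x : R) : 0 <= x <= 1 -> fine (dn_measure (decomposition psi) `[0, x]%classic) = 0.
  move=> /andP[x0 x1]; apply/eqP; rewrite eq_le fine_ge0// andbT -[leRHS]dn_part0.
  rewrite /dn_part fine_le ?pfin//; apply: le_measure; rewrite ?inE// => y /=.
  by rewrite !in_itv/= => /andP[-> /le_trans]; exact.
rewrite !q0//.
have -> : fine (up_measure (decomposition psi) `[0, s]%classic) =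
    fine (up_measure (decomposition psi) `[0, t]%classic).
  have <- : (`[0, t] `|` `]t, s])%classic = `[0, s]%classic :> set RR.
    by rewrite -itv_bndbnd_setU// bnd_simp.
  have mts : measurable (`]t, s]%classic : set RR) by exact: measurable_itv.
  have m0t : measurable (`[0, t]%classic : set RR) by exact: measurable_itv.
  have mt1 : measurable (`]t, 1]%classic : set RR) by exact: measurable_itv.
  rewrite measureU//; last first.
    apply/seteqP; split => y //=; rewrite !in_itv/= => -[/andP[_ yt] /andP[ty _]].
    by have := lt_le_trans ty yt; rewrite ltxx.
  rewrite fineD ?pfin// [X in _ + X](_ : _ = 0) ?addr0//.
  apply/eqP; rewrite eq_le fine_ge0// andbT -[leRHS]pt1 fine_le ?pfin//.
  apply: le_measure; rewrite ?inE// => y /=.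
  by rewrite !in_itv/= => /andP[-> /le_trans]; exact.
rewrite -/(dot_ac psi) -/(prim _ t) -/(prim _ s); ring.
Qed.

Lemma optimal_continuous_after (t : R) : 0 <= t < 1 -> 0 < psi t ->
  {within `[t, 1], continuous psi}.
Proof.
move=> t01 pt; have [t0 t1] := andP t01.
have /continuous_subspaceW : `[t, 1]%classic `<=` `[0, 1]%classic.
  by move=> x /=; rewrite !in_itv/= => /andP[/(le_trans t0) -> ->].
move=> /(_ _ _ (@ac_affine_continuous R (psi t - prim (dot_ac psi) t) _
  (dot_ac_integrable psiBV))).
apply: subspace_eq_continuous => s; rewrite inE/= in_itv/= => ts.
by rewrite /from_subspace -(optimal_increment t01 pt ts).
Qed.

(** Between [x] and [w] the competitor stays above the smaller of its two end
    values by quasi-concavity, so [psi] avoids all small positive values, and by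
    continuity it cannot vanish at [y]. *)
Lemma optimal_positive_between (x y w : R) : 0 <= x -> x < y -> y < w -> w <= 1 ->
  0 < psi x -> 0 < psi w -> 0 < psi y.
Proof.
move=> x0 xy yw w1 px pw.
have y01 : 0 <= y <= 1 by rewrite (ltW (le_lt_trans x0 xy)) (ltW (lt_le_trans yw w1)).
rewrite lt_neqAle psi_ge0// andbT; apply/eqP => /esym py.
have x01 : 0 <= x < 1 by rewrite x0 (lt_trans xy (lt_le_trans yw w1)).
have pc := optimal_continuous_after x01 px.
have pcW (a b : R) : x <= a -> b <= 1 -> {within `[a, b], continuous psi}.
  move=> xa b1; apply: continuous_subspaceW pc => s /=; rewrite !in_itv/=.
  by move=> /andP[/(le_trans xa) -> /le_trans]; exact.
(* The identification of psi with its competitor is available before time 1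
   only, so w is moved to the left. *)
have [v [yv v1 pv]] : exists v : R, [/\ y < v, v < 1 & 0 < psi v].
  have /(IVT (ltW yw)) : {within `[y, w], continuous psi} by exact: pcW (ltW xy) w1.
  move=> /(_ (psi w / 2)); rewrite py => -[|v].
    by rewrite ge_min divr_ge0 ?(ltW pw)//= le_max orbC ler_pdivrMr// ler_peMr ?(ltW pw)// ler1n.
  rewrite in_itv/= => /andP[yv vw] pv; exists v.
  have p2 : 0 < psi w / 2 by rewrite divr_gt0.
  split; last by rewrite pv.
    by rewrite lt_neqAle yv andbT; apply/eqP => e; move: p2; rewrite -pv -e py ltxx.
  apply: lt_le_trans w1; rewrite lt_neqAle vw andbT; apply/eqP => e.
  by move: pv; rewrite e => h; move: p2; rewrite -h; lra.
have v0 : 0 <= v by rewrite (le_trans _ (ltW yv))//; case/andP: y01.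
have v01 : 0 <= v < 1 by rewrite v0.
have [pxE _] := optimal_path x01 px; have [pvE _] := optimal_path v01 pv.
have [k [k0 kx kmin]] : exists k : R,
    [/\ 0 < k, k <= psi x & Num.min (psi x) (psi v) = k].
  by exists (Num.min (psi x) (psi v)); rewrite lt_min px pv ge_min lexx.
have bint := excursion_rearr_integrable delta psiBV.
have low (s : R) : x <= s -> s <= y -> 0 < psi s -> k <= psi s.
  move=> xs sy ps.
  have sv : s <= v by rewrite (le_trans sy) ?ltW.
  have s0 : 0 <= s by rewrite (le_trans x0).
  have s01 : 0 <= s < 1 by rewrite s0 (le_lt_trans sv).
  have [-> _] := optimal_path s01 ps.
  rewrite -kmin pxE pvE /excursion_path -addr_minr lerD2l.
  apply: (prim_quasiconcave bint (excursion_rearr_nonincreasing delta psiBV)).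
  - by rewrite occupation_ge0// x0 ltW//; case/andP: x01.
  - by apply: occupation_nondecreasing => //; rewrite (le_trans sv)// ltW.
  - by apply: occupation_nondecreasing => //; rewrite ltW.
  - by rewrite (le_trans (occupation_le_id mE _))// ?v0 ltW.
have /(IVT (ltW xy)) : {within `[x, y], continuous psi}.
  by apply: pcW => //; case/andP: y01.
move=> /(_ (k / 2)); rewrite py => -[|s].
  rewrite ge_min divr_ge0 ?(ltW k0) ?orbT//= le_max; apply/orP; left.
  by apply: le_trans kx; rewrite ler_pdivrMr// ler_peMr ?(ltW k0)// ler1n.
rewrite in_itv/= => /andP[xs sy] ps.
have := low s xs sy; rewrite ps divr_gt0// => /(_ isT).
by rewrite leNgt ltr_pdivrMr// ltr_pMr// ltr1n.
Qed.

Lemma feasible_positive : exists2 t : R, 0 <= t < 1 & 0 < psi t.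
Proof.
apply: contrapT => npos.
have psi0 (t : R) : 0 <= t < 1 -> psi t = 0.
  move=> t01; apply/eqP; rewrite eq_le psi_ge0 ?andbT.
    by rewrite leNgt; apply/negP => pt; apply: npos; exists t.
  by case/andP: t01 => -> /ltW.
have [_ _] := psi_feas; rewrite -integral_itv_bndo_bndc.
  rewrite (eq_integral (cst 0%E)) ?integral0.
    by move=> [z0]; move: z_gt0; rewrite -z0 ltxx.
  by move=> t; rewrite inE/= in_itv/= => /psi0 ->.
by apply/measurable_EFinP/measurable_funTS; exact: skorohod_measurable.
Qed.

Lemma optimal_structure : exists T0 T1 : R,
  [/\ 0 <= T0 /\ T0 < T1 <= 1,
      (forall t, T0 < t < T1 -> 0 < psi t) /\
      (forall t, 0 <= t <= 1 -> ~ (T0 <= t <= T1) -> psi t = 0),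
      concave_on `[T0, T1] psi
    & {within `]T0, T1], continuous psi}].
Proof.
have [t0 t001 pt0] := feasible_positive; have [t00 t01] := andP t001.
have EP (t : R) : E t <-> 0 <= t <= 1 /\ 0 < psi t.
  by rewrite /positivity_set/= in_itv.
have Et0 : E t0 by apply/EP; rewrite t00 ltW.
have E0 : E !=set0 by exists t0.
have Elb : has_lbound E by exists 0 => t /EP[/andP[]].
have Eub : has_ubound E by exists 1 => t /EP[/andP[]].
pose T0 := inf E; pose T1 := sup E.
have EleT0 (t : R) : E t -> T0 <= t by move=> Et; exact: ge_inf.
have EgeT1 (t : R) : E t -> t <= T1 by move=> Et; exact: ub_le_sup.
have T0_ge0 : 0 <= T0 by apply: lb_le_inf => // t /EP[/andP[]].
have T1_le1 : T1 <= 1 by apply: ge_sup => // t /EP[/andP[]].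
have T01 : T0 < T1.
  have psi_rc : psi s @[s --> t0^'+] --> psi t0 by have [+ _] := path_cadlag psi; apply.
  have [s [ts s1 ps]] : exists s : R, [/\ t0 < s, s <= 1 & 0 < psi s].
    have : \forall s \near t0^'+, [/\ t0 < s, s <= 1 & 0 < psi s].
      near=> s; split.
      - by near: s; exact: nbhs_right_gt.
      - by near: s; exact: nbhs_right_le.
      - by near: s; exact: (cvgr_gt _ psi_rc).
    by move=> /filter_ex.
  apply: (le_lt_trans (EleT0 _ Et0)); apply: (lt_le_trans ts); apply: EgeT1.
  by apply/EP; rewrite s1 (le_trans t00 (ltW ts)).
have T0_lt1 : T0 < 1 by exact: lt_le_trans T01 T1_le1.
have inner (t : R) : T0 < t -> t < T1 -> 0 < psi t.
  move=> /(inf_lt E0)[x /EP[/andP[x0 _] px] xt] /(sup_gt E0)[w /EP[/andP[_ w1] pw] tw].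
  exact: optimal_positive_between x0 xt tw w1 px pw.
(* T0 itself need not belong to the positivity set, so continuity at x is taken
   from a time of positivity between T0 and x. *)
have below (x : R) : T0 < x -> exists t, [/\ 0 <= t < 1, 0 < psi t & t < x].
  move=> T0x; have [|t /EP[/andP[t_0 _] pt] tx] := inf_lt E0 (_ : T0 < Num.min x T1).
    by rewrite lt_min T0x.
  move: tx; rewrite lt_min => /andP[tx tT1]; exists t; split => //.
  by rewrite t_0 (lt_le_trans tT1).
have psi_cont : {within `]T0, T1], continuous psi}.
  apply/subspace_continuousP => x /=; rewrite in_itv/= => /andP[T0x xT1].
  have [t [t_01 pt tx]] := below x T0x.
  have /subspace_continuousP/(_ x) := optimal_continuous_after t_01 pt.
  rewrite /= in_itv/= (ltW tx) (le_trans xT1)// => /(_ isT) xc P /xc xP.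
  have {}xP : \forall s \near x, `[t, 1]%classic s -> P (psi s) := xP.
  rewrite /nbhs/= /within/=.
  have : \forall s \near x, t < s by exact: lt_nbhsr.
  apply: filterS2 xP => s sP ts; rewrite in_itv/= => /andP[_ sT1]; apply: sP.
  by rewrite /= in_itv/= (ltW ts) (le_trans sT1).
exists T0, T1; split => //; first by rewrite T01.
  split=> [t /andP[]|t t_01 out]; first exact: inner.
  apply/eqP; rewrite eq_le psi_ge0// andbT leNgt; apply/negP => pt; apply: out.
  by have Et : E t by [apply/EP]; rewrite EleT0// EgeT1.
have psiE_in (t : R) : T0 < t < T1 -> psi t = path (u t).
  move=> /andP[T0t tT1]; have pt := inner t T0t tT1.
  have t_01 : 0 <= t < 1 by rewrite (le_trans T0_ge0 (ltW T0t)) (lt_le_trans tT1).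
  by have [] := optimal_path t_01 pt.
have pathW (a c : R) : 0 <= a -> c <= 1 ->
    {within `[a, c], continuous (fun t : R => path (u t))}.
  have uc := @excursion_path_continuous R psi delta z psi_feas.
  move=> a0 c1; apply: continuous_subspaceW uc.
  by move=> s /=; rewrite !in_itv/= => /andP[/(le_trans a0) -> /le_trans]; exact.
have [_ path_right path_left] :=
  (@continuous_within_itvP R R R T0 T1 (fun t : R => path (u t)) T01).1
    (pathW T0 T1 T0_ge0 T1_le1).
have psiE_T0 : psi T0 = path (u T0).
  have psi_rc : psi s @[s --> T0^'+] --> psi T0.
    by have [+ _] := path_cadlag psi; apply; rewrite T0_ge0.
  exact: right_limit_eq T01 psiE_in psi_rc path_right.
have psiE_T1 : psi T1 = path (u T1).
  have [t [t_01 pt tT1]] := below T1 T01; have [t_0 t_1] := andP t_01.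
  have [|_ _ psi_lc] := (@continuous_within_itvP R R R t T1 psi tT1).1.
    apply: continuous_subspaceW (optimal_continuous_after t_01 pt) => s /=.
    by rewrite !in_itv/= => /andP[-> /le_trans]; exact.
  exact: left_limit_eq T01 psiE_in psi_lc path_left.
have psiE (t : R) : T0 <= t -> t <= T1 -> psi t = path (u t).
  rewrite le_eqVlt => /orP[/eqP <- //|T0t].
  by rewrite le_eqVlt => /orP[/eqP -> //|tT1]; apply: psiE_in; rewrite T0t.
(* Up to the two endpoints, the positivity set before t is ]T0, t[. *)
have uE (t : R) : T0 <= t -> t <= T1 -> u t = t - T0.
  move=> T0t tT1.
  have t_01 : 0 <= t <= 1 by rewrite (le_trans T0_ge0)// (le_trans tT1).
  have mc : measurable (`[T0, t]%classic : set RR) by exact: measurable_itv.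
  have mo : measurable (`]T0, t[%classic : set RR) by exact: measurable_itv.
  have m0t : measurable (`[0, t]%classic : set RR) by exact: measurable_itv.
  have mEt : measurable ((`[0, t]%classic : set RR) `&` E) by exact: measurableI.
  have muI b0 b1 : mu [set` Interval (BSide b0 T0) (BSide b1 t)] = (t - T0)%:E.
    rewrite [LHS]lebesgue_measure_itv/= lte_fin; case: ltP => // tT0.
    by have -> : t = T0; [apply/eqP; rewrite eq_le tT0 T0t|rewrite subrr].
  apply: EFin_inj; rewrite (occupationE mE t_01).
  apply/eqP; rewrite eq_le; apply/andP; split.
    rewrite -(muI true false); apply: le_measure; rewrite ?inE// => s [].
    by rewrite /= !in_itv/= => /andP[_ ->] /EleT0 ->.
  rewrite -(muI false true); apply: le_measure; rewrite ?inE// => s.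
  rewrite /= in_itv/= => /andP[T0s st].
  have s0 : 0 <= s by rewrite (le_trans T0_ge0 (ltW T0s)).
  split; first by rewrite /= in_itv/= s0 ltW.
  apply/EP; rewrite s0 (le_trans (ltW st)); last by case/andP: t_01.
  by split => //; apply: inner => //; exact: lt_le_trans tT1.
apply: chord_concave_on => x y w xT0 xy yw wT1.
have [xT1 wT0] : x <= T1 /\ T0 <= w by split; [rewrite (le_trans xy) ?(le_trans yw)|rewrite (le_trans xT0) ?(le_trans xy)].
have [yT0 yT1] : T0 <= y /\ y <= T1 by split; [rewrite (le_trans xT0)|rewrite (le_trans yw)].
rewrite !psiE// !uE// /excursion_path.
have x0 : 0 <= x - T0 by rewrite subr_ge0.
have xy' : x - T0 <= y - T0 by rewrite lerD2r.
have yw' : y - T0 <= w - T0 by rewrite lerD2r.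
have w1 : w - T0 <= 1 by rewrite lerBlDr (le_trans wT1)// (le_trans T1_le1)// lerDl.
have := prim_concave (excursion_rearr_integrable delta psiBV)
  (excursion_rearr_nonincreasing delta psiBV) x0 xy' yw' w1.
rewrite (_ : w - T0 - (y - T0) = w - y); last by ring.
rewrite (_ : y - T0 - (x - T0) = y - x); last by ring.
rewrite (_ : w - T0 - (x - T0) = w - x); last by ring.
rewrite !mulrDr => h.
rewrite (_ : forall A B C D : R, A + B + (C + D) = (A + C) + (B + D)); last by move=> *; ring.
rewrite -mulrDl (_ : w - y + (y - x) = w - x); last by ring.
by rewrite lerD2l.
Unshelve. all: by end_near. Qed.

End structure.

Unset Implicit Arguments.

Theorem theorem4 (R : realType) (d : measure_display) (T : measurableType d)
    (P : probability T R) (X : nat -> {RV P >-> R}) (Lam : R -> \bar R)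
    (LamE : forall theta : R,
       scaled_cgf P X theta n @[n --> \oo] --> Lam theta)
    (theta_dn_gt0 : (0 < theta_dn Lam)%E)
    (theta_up_gt0 : (0 < theta_up Lam)%E)
    (ldp : satisfies_ldp P (fun n w => scaled_path (X ^~ w) n) (path_rate Lam))
    (path_rate_good : good_rate_function (path_rate Lam))
    (rate_good : good_rate_function (rate Lam))
    (rate_convex : convex_ereal (rate Lam))
    (drift : exists delta : R, 0 < delta /\ rate Lam (- delta) = 0%E)
    (z : R) (z_gt0 : 0 < z) :
  (exists psi, optimal Lam z psi) /\
  forall psi : skorohod R, optimal Lam z psi ->
    (0 < objective Lam psi < +oo)%E ->
    exists T0 T1 : R,
      [/\ 0 <= T0 /\ T0 < T1 <= 1,
          (forall t, T0 < t < T1 -> 0 < psi t) /\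
          (forall t, 0 <= t <= 1 -> ~ (T0 <= t <= T1) -> psi t = 0),
          concave_on `[T0, T1] psi
        & {within `]T0, T1], continuous psi}].
Proof.
have [delta [delta_gt0 rate_delta]] := drift.
have [rate_ge0 rate_lsc _] := rate_good.
have rate_meas := lower_semicontinuous_measurable rate_lsc.
split=> [|psi psi_opt cost_fin].
  exact: (optimal_exists rate_ge0 rate_meas rate_convex delta_gt0 rate_delta
    (ltW theta_dn_gt0) (ltW theta_up_gt0) path_rate_good).
exact: (optimal_structure rate_ge0 rate_meas rate_convex delta_gt0 rate_delta
  theta_dn_gt0 (ltW theta_up_gt0) z_gt0 psi_opt cost_fin).
Qed.
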